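(* Let ${\mathcal H}$ denote either super hyperbolic space ${\mathcal H}^2$ or ${\mathcal H}^3$. Given distinct $P,Q\in{\mathcal H}$, there is a unique super geodesic containing them. In fact, define $d=\langle P,Q\rangle$ and set $\ell=\sqrt{\frac{d+1}{d-1}}$. Then the distance $D$ between $P$ and $Q$ is given by $\cosh D=d$ with $\exp D=\frac{\ell+1}{\ell-1}$. The super segment $\overline{PQ}$ from $P$ to $Q$ is parametrized by $$X(t)=\frac{tE+t^{-1}F}{2},\quad 1\le t\le\frac{\ell+1}{\ell-1},$$ where $t=\exp s$, with $s$ equal to arc length, and $$E=M\{(1-\ell)P+(1+\ell)Q\},\qquad F=N\{(1+\ell)P+(1-\ell)Q\}$$ lie in ${\mathcal L}_+$, where $M=\frac{\ell-1}{2\ell}$, $N=\frac{\ell+1}{2\ell}$ are taken so that $\langle E,F\rangle=2$.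
   Context: Super numbers: $\hat{\mathbb R}$ and $\hat{\mathbb C}$ are the ${\mathbb Z}/2$-graded algebras of polynomials over ${\mathbb R}$, respectively ${\mathbb C}$, in infinitely many anti-commuting generators of degree one; $[0]$ and $[1]$ denote even and odd parts. The body $a_\#$ is the degree-zero term of $a$; inequalities between elements of $\hat{\mathbb R}$ mean the corresponding inequalities of bodies. Functions such as $\sqrt{\ },\exp,\cosh$ are extended to even super numbers by Taylor expansion about the body. Complex conjugation conjugates coefficients. ${\mathbb R}^{3,1|4}=\{(x_1,x_2,x|\phi,\psi):x_1,x_2\in\hat{\mathbb R}[0],x\in\hat{\mathbb C}[0],\phi,\psi\in\hat{\mathbb C}[1]\}$ with bilinear form $2\langle(x_1,x_2,x|\phi,\psi),(y_1,y_2,y|\xi,\eta)\rangle=x_1y_2+x_2y_1-(x\bar y+\bar xy)+\phi\eta+\xi\psi+\bar\phi\bar\eta+\bar\xi\bar\psi$. ${\mathbb R}^{2,1|2}$ is the subspace where $x\in\hat{\mathbb R}[0]$ and $\phi,\psi\in\hat{\mathbb R}[1]$, with the restricted form (quadratic form $x_1x_2-x^2+2\phi\psi$). In either case put ${\mathcal H}=\{X:\langle X,X\rangle=1,\ x_1+x_2>0\}$ (denoted ${\mathcal H}^2\subset{\mathbb R}^{2,1|2}$, ${\mathcal H}^3\subset{\mathbb R}^{3,1|4}$), with the metric induced by the bilinear form; ${\mathbb H}=\{X:\langle X,X\rangle=-1\}$; and ${\mathcal L}_+=\{X:\langle X,X\rangle=0,\ x_1+x_2>0\}$. A super geodesic is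 a curve in ${\mathcal H}$ critical for the functional $\int\big(|\langle\dot X,\dot X\rangle|+\lambda(\langle X,X\rangle-1)\big)\,dt$ ($\lambda$ a Lagrange multiplier); parametrized by arc length it has the form $L_{U,V}=\{\cosh s\,U+\sinh s\,V\}$ with $U\in{\mathcal H}$, $V\in{\mathbb H}$, $\langle U,V\rangle=0$. ''Distinct'' points $P,Q$ of ${\mathcal H}$ are understood in the sense that $\langle P,Q\rangle>1$ (as super numbers, i.e. on bodies). *)

(* Defs.v *)
From HB Require Import structures.
From mathcomp Require Import all_boot all_order all_algebra finmap.
From mathcomp Require Import all_classical all_reals all_analysis.
From mathcomp Require Import complex ring.
(* The notations of monalg clash with those of mathcomp-analysis. *)
From mathcomp Require Import -(notations) monalg.

Set Implicit Arguments.
Unset Strict Implicit.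
Unset Printing Implicit Defensive.

Import Order.TTheory GRing.Theory Num.Theory.
Import numFieldNormedType.Exports.

Local Open Scope fset_scope.
Local Open Scope ring_scope.

(* Polynomials over [K] in anti-commuting generators theta_0, theta_1, ...:
   the finite set I = {i1 < ... < ik} stands for the monomial
   theta_i1 ... theta_ik, and [mcoeff I a] is its coefficient in [a]. *)
Definition grassmann (K : comNzRingType) := malg {fset nat} K.

Section GrassmannRing.
Context {K : comNzRingType}.

HB.instance Definition _ :=
  GRing.Lmodule.copy (grassmann K) (malg {fset nat} K).

Definition inversions (I J : {fset nat}) : nat :=
  (\sum_(i <- I) \sum_(j <- J) (j < i))%N.

Definition gsign (I J : {fset nat}) : K :=
  if fdisjoint I J then (-1) ^+ inversions I J else 0.

Definition gone : grassmann K := mkmalgU fset0 1.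

Definition gmul (a b : grassmann K) : grassmann K :=
  \sum_(I <- msupp a) \sum_(J <- msupp b)
    mkmalgU (I `|` J) (gsign I J * (mcoeff I a * mcoeff J b)).

Lemma gmulw (d1 d2 : {fset {fset nat}}) (a b : grassmann K) :
    msupp a `<=` d1 -> msupp b `<=` d2 ->
  gmul a b = \sum_(I <- d1) \sum_(J <- d2)
    mkmalgU (I `|` J) (gsign I J * (mcoeff I a * mcoeff J b)).
Proof.
move=> le_d1 le_d2; rewrite /gmul (big_fset_incl _ le_d1) /=; last first.
  move=> I _ /mcoeff_outdom aI0; rewrite big1 // => J _.
  by rewrite aI0 mul0r mulr0 monalgU0.
apply: eq_bigr => I _; apply: (big_fset_incl _ le_d2) => J _.
by move=> /mcoeff_outdom bJ0; rewrite bJ0 !mulr0 monalgU0.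
Qed.

Lemma gmulDl : left_distributive gmul +%R.
Proof.
move=> a b c; pose d := msupp a `|` msupp b.
rewrite (@gmulw d (msupp c) (a + b)) ?msuppD_le //.
rewrite (@gmulw d (msupp c) a) ?fsubsetUl //.
rewrite (@gmulw d (msupp c) b) ?fsubsetUr // -big_split /=.
apply: eq_bigr => I _; rewrite -big_split /=; apply: eq_bigr => J _.
by rewrite mcoeffD mulrDl mulrDr monalgUD.
Qed.

Lemma gmulDr : right_distributive gmul +%R.
Proof.
move=> c a b; pose d := msupp a `|` msupp b.
rewrite (@gmulw (msupp c) d c (a + b)) ?msuppD_le //.
rewrite (@gmulw (msupp c) d c a) ?fsubsetUl //.
rewrite (@gmulw (msupp c) d c b) ?fsubsetUr // -big_split /=.
apply: eq_bigr => I _; rewrite -big_split /=; apply: eq_bigr => J _.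
by rewrite mcoeffD !mulrDr monalgUD.
Qed.

Lemma gmulUU I J (x y : K) :
  gmul (mkmalgU I x) (mkmalgU J y) = mkmalgU (I `|` J) (gsign I J * (x * y)).
Proof.
by rewrite (gmulw msuppU_le msuppU_le) !big_seq_fset1 !mcoeffUU.
Qed.

Lemma gmul0l a : gmul 0 a = 0.
Proof. by rewrite /gmul msupp0 big_seq_fset0. Qed.

Lemma gmul0r a : gmul a 0 = 0.
Proof. by rewrite /gmul big1 // => I _; rewrite msupp0 big_seq_fset0. Qed.

Lemma gmul_suml T (r : seq T) (F : T -> grassmann K) b :
  gmul (\sum_(i <- r) F i) b = \sum_(i <- r) gmul (F i) b.
Proof.
elim: r => [|i r IHr]; first by rewrite !big_nil gmul0l.
by rewrite !big_cons gmulDl IHr.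
Qed.

Lemma gmul_sumr T (r : seq T) (F : T -> grassmann K) b :
  gmul b (\sum_(i <- r) F i) = \sum_(i <- r) gmul b (F i).
Proof.
elim: r => [|i r IHr]; first by rewrite !big_nil gmul0r.
by rewrite !big_cons gmulDr IHr.
Qed.

Lemma sumn_fsetU (I J : {fset nat}) (F : nat -> nat) : fdisjoint I J ->
  (\sum_(i <- I `|` J) F i = \sum_(i <- I) F i + \sum_(i <- J) F i)%N.
Proof.
move=> dIJ; rewrite -big_cat; apply: perm_big; apply: uniq_perm => //.
- rewrite cat_uniq !fset_uniq andbT /=; apply/hasPn => j jJ.
  by apply: contraL jJ; exact: (fdisjointP dIJ).
- by move=> i; rewrite mem_cat in_fsetU.
Qed.

Lemma inversionsUl I J L : fdisjoint I J ->
  inversions (I `|` J) L = (inversions I L + inversions J L)%N.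
Proof. exact: sumn_fsetU. Qed.

Lemma inversionsUr I J L : fdisjoint J L ->
  inversions I (J `|` L) = (inversions I J + inversions I L)%N.
Proof.
move=> dJL; rewrite /inversions -big_split /=; apply: eq_bigr => i _.
exact: sumn_fsetU.
Qed.

Lemma gsignA I J L :
  gsign I J * gsign (I `|` J) L = gsign J L * gsign I (J `|` L).
Proof.
rewrite /gsign fdisjointUX fdisjointXU.
have [dIJ|_] /= := boolP (fdisjoint I J); last by rewrite mul0r mulr0.
have [dJL|_] := boolP (fdisjoint J L); last by rewrite andbF mulr0 mul0r.
rewrite andbT; case: ifP => // _; last by rewrite !mulr0.
by rewrite -!exprD inversionsUl // inversionsUr //; congr (_ ^+ _); ring.
Qed.

Lemma gmulA : associative gmul.
Proof.
move=> a b c; pose m (x : grassmann K) I := mkmalgU I (mcoeff I x).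
transitivity (\sum_(I <- msupp a) \sum_(J <- msupp b) \sum_(L <- msupp c)
    gmul (m a I) (gmul (m b J) (m c L))).
  rewrite {1}(monalgE a) gmul_suml; apply: eq_bigr => I _.
  rewrite {1}(monalgE b) gmul_suml gmul_sumr; apply: eq_bigr => J _.
  by rewrite {1}(monalgE c) [gmul (m b J) _]gmul_sumr [LHS]gmul_sumr.
rewrite [in RHS](monalgE a) [gmul _ b]gmul_suml [RHS]gmul_suml; apply: eq_bigr => I _.
rewrite [in RHS](monalgE b) [gmul (mkmalgU I _) _]gmul_sumr [RHS]gmul_suml.
apply: eq_bigr => J _.
rewrite [in RHS](monalgE c) [RHS]gmul_sumr; apply: eq_bigr => L _.
rewrite !gmulUU fsetUA; congr mkmalgU.
have -> x y z : gsign I (J `|` L) * (x * (gsign J L * (y * z)))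
    = gsign J L * gsign I (J `|` L) * (x * (y * z)) by ring.
by rewrite -gsignA; ring.
Qed.

Lemma gmul1l : left_id gone gmul.
Proof.
move=> a; rewrite [in RHS](monalgE a) [in LHS](monalgE a) gmul_sumr.
apply: eq_bigr => I _; rewrite gmulUU fset0U /gsign fdisjoint0X.
by rewrite /inversions big_seq_fset0 expr0 !mul1r.
Qed.

Lemma gmul1r : right_id gone gmul.
Proof.
move=> a; rewrite [in RHS](monalgE a) [in LHS](monalgE a) gmul_suml.
apply: eq_bigr => I _; rewrite gmulUU fsetU0 /gsign fdisjointX0.
rewrite /inversions big1 ?expr0 ?mul1r ?mulr1 // => i _.
by rewrite big_seq_fset0.
Qed.

Lemma gone_neq0 : gone != 0.
Proof. by rewrite monalgU_eq0 oner_neq0. Qed.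

HB.instance Definition _ := GRing.Zmodule_isNzRing.Build (grassmann K)
  gmulA gmul1l gmul1r gmulDl gmulDr gone_neq0.

Lemma gscaleAl (x : K) (a b : grassmann K) : x *: (a * b) = (x *: a) * b.
Proof.
change (x *: gmul a b = gmul (x *: a) b).
rewrite (gmulw (msuppZ_le x a) (fsubset_refl (msupp b))) /gmul scaler_sumr.
apply: eq_bigr => I _; rewrite scaler_sumr; apply: eq_bigr => J _.
apply/malgP => L; rewrite mcoeffZ !mcoeffU mcoeffZ mulrnAr.
by congr (_ *+ _); ring.
Qed.

HB.instance Definition _ :=
  GRing.Lmodule_isLalgebra.Build K (grassmann K) gscaleAl.

Lemma gscaleAr (x : K) (a b : grassmann K) : x *: (a * b) = a * (x *: b).
Proof.
change (x *: gmul a b = gmul a (x *: b)).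
rewrite (gmulw (fsubset_refl (msupp a)) (msuppZ_le x b)) /gmul scaler_sumr.
apply: eq_bigr => I _; rewrite scaler_sumr; apply: eq_bigr => J _.
apply/malgP => L; rewrite mcoeffZ !mcoeffU mcoeffZ mulrnAr.
by congr (_ *+ _); ring.
Qed.

HB.instance Definition _ :=
  GRing.Lalgebra_isAlgebra.Build K (grassmann K) gscaleAr.

End GrassmannRing.

Section GrassmannTheory.
Context {K : comNzRingType}.
Implicit Type a : grassmann K.

Definition is_even a : Prop :=
  forall I : {fset nat}, mcoeff I a != 0 -> ~~ odd #|` I|.

Definition is_odd a : Prop :=
  forall I : {fset nat}, mcoeff I a != 0 -> odd #|` I|.

Definition body a : K := mcoeff fset0 a.

Definition soul a : grassmann K := a - (body a)%:A.

Definition generators a : {fset nat} := (\bigcup_(I <- msupp a) I)%fset.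

(* A product of more factors without body than there are generators is zero,
   so [soul a ^+ k = 0] for [k >= nil_order a]. *)
Definition nil_order a : nat := #|` generators a|.+1.

End GrassmannTheory.

Definition map_coeff (K L : comNzRingType) (f : K -> L) (a : grassmann K) :
    grassmann L :=
  mkmalg [fsfun I in msupp a => f (mcoeff I a)].

Local Open Scope classical_set_scope.
Local Open Scope ring_scope.

Section SuperNumbers.
Variable R : realType.

Definition superR := grassmann R.
Definition superC := grassmann R[i].

Definition gcomplex : superR -> superC := map_coeff (real_complex R).
Definition gRe : superC -> superR := map_coeff (@complex.Re R).
Definition gIm : superC -> superR := map_coeff (@complex.Im R).
Definition gconj : superC -> superC := map_coeff (@conjc R).

Definition is_real (z : superC) : Prop := gconj z = z.

(* Taylor extension of [f] to an even super number [a]; the sum is the whole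
   Taylor series because the soul is nilpotent. *)
Definition taylor (f : R -> R) (a : superR) : superR :=
  \sum_(k < nil_order a)
    ((derive1n k f (body a) / k`!%:R) *: soul a ^+ k : superR).

Definition gsqrt : superR -> superR := taylor Num.sqrt.
Definition gexp : superR -> superR := taylor expR.
Definition gcosh : superR -> superR :=
  taylor (fun x => (expR x + expR (- x)) / 2).
Definition ginv : superR -> superR := taylor GRing.inv.
Definition gnorm : superR -> superR := taylor (fun x => `|x|).

(* Quintuples (x_1, x_2, x | phi, psi); the parities are imposed by [ambient]. *)
Definition superspace := (superR * superR * superC * superC * superC)%type.

Section Coordinates.
Variable X : superspace.
Definition x1 : superR := X.1.1.1.1.
Definition x2 : superR := X.1.1.1.2.
Definition xc : superC := X.1.1.2.
Definition phi : superC := X.1.2.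
Definition psi : superC := X.2.
End Coordinates.

Definition sscale (a : superR) (X : superspace) : superspace :=
  (a * x1 X, a * x2 X, gcomplex a * xc X, gcomplex a * phi X,
   gcomplex a * psi X).

(* The argument of [gRe] is invariant under conjugation, so [gRe] merely
   identifies it with an element of [superR]. *)
Definition sform (X Y : superspace) : superR :=
  2^-1 *: (x1 X * x2 Y + x2 X * x1 Y
    + gRe (- (xc X * gconj (xc Y) + gconj (xc X) * xc Y)
           + phi X * psi Y + phi Y * psi X
           + gconj (phi X) * gconj (psi Y) + gconj (phi Y) * gconj (psi X))).

(* H2 stands for R^{2,1|2} and H3 for R^{3,1|4}. *)
Variant dimension := H2 | H3.

Definition ambient (h : dimension) (X : superspace) : Prop :=
  [/\ is_even (x1 X), is_even (x2 X), is_even (xc X),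
      is_odd (phi X) & is_odd (psi X)] /\
  (h = H2 -> [/\ is_real (xc X), is_real (phi X) & is_real (psi X)]).

Definition hyperbolic (h : dimension) : set superspace :=
  [set X | [/\ ambient h X, sform X X = 1 & 0 < body (x1 X + x2 X)]].

Definition light_cone (h : dimension) : set superspace :=
  [set X | [/\ ambient h X, sform X X = 0 & 0 < body (x1 X + x2 X)]].

(* Differentiation in a real variable is coefficientwise. *)
Definition gderiv (f f' : R -> superR) : Prop :=
  forall (I : {fset nat}) (t : R),
    is_derive t 1 (fun u => mcoeff I (f u)) (mcoeff I (f' t)).

Definition gcderiv (f f' : R -> superC) : Prop :=
  gderiv (fun t => gRe (f t)) (fun t => gRe (f' t)) /\
  gderiv (fun t => gIm (f t)) (fun t => gIm (f' t)).

Definition sderiv (X X' : R -> superspace) : Prop :=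
  [/\ gderiv (x1 \o X) (x1 \o X'), gderiv (x2 \o X) (x2 \o X'),
      gcderiv (xc \o X) (xc \o X'), gcderiv (phi \o X) (phi \o X') &
      gcderiv (psi \o X) (psi \o X')].

(* A smooth curve is given together with its derivatives of all orders, which
   it determines; as a coefficientwise derivative need not be a polynomial,
   their existence in [superspace] is a requirement. *)
Record curve := Curve {
  jet : nat -> R -> superspace;
  jetP : forall n, sderiv (jet n) (jet n.+1)
}.

Definition position (X : curve) : R -> superspace := jet X 0.
Definition velocity (X : curve) : R -> superspace := jet X 1.

(* Taylor extension of a curve to an even super parameter. *)
Definition curve_ext (X : curve) (s : superR) : superspace :=
  \sum_(k < nil_order s)
    sscale (k`!%:R^-1 *: soul s ^+ k : superR) (jet X k (body s)).

Definition lagrangian (lambda : superR) (X V : superspace) : superR :=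
  gnorm (sform V V) + lambda * (sform X X - 1).

Definition action_coeff (I : {fset nat}) (lambda : R -> superR)
    (X eta : curve) (a b : R) (eps : R) : R :=
  (\int[lebesgue_measure]_(t in `[a, b])
    mcoeff I (lagrangian (lambda t)
      (position X t + sscale eps%:A (position eta t))
      (velocity X t + sscale eps%:A (velocity eta t))))%R.

(* Vanishing first variation, on every compact interval, for all variations
   in the ambient space with fixed end points. *)
Definition critical (h : dimension) (X : curve) : Prop :=
  exists lambda : R -> superR,
  [/\ forall t, is_even (lambda t),
      forall I : {fset nat}, continuous (fun t => mcoeff I (lambda t)) &
      forall (a b : R) (eta : curve), a < b ->
        (forall t, ambient h (position eta t)) ->
        position eta a = 0 -> position eta b = 0 ->
        forall I : {fset nat},
          is_derive (0 : R) 1 (action_coeff I lambda X eta a b) 0].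

(* The velocity must not be null: [|.|] is a function of super numbers only
   where the body does not vanish. *)
Definition geodesic_curve (h : dimension) (X : curve) : Prop :=
  [/\ forall t, hyperbolic h (position X t),
      forall t, body (sform (velocity X t) (velocity X t)) != 0 &
      critical h X].

Definition super_geodesic (h : dimension) (G : set superspace) : Prop :=
  exists2 X, geodesic_curve h X & G = [set curve_ext X s | s in is_even].

Definition unit_speed (X : curve) : Prop :=
  forall t, gnorm (sform (velocity X t) (velocity X t)) = 1.

Definition geodesic_arc (h : dimension) (P Q : superspace) (X : curve)
    (a b : R) : Prop :=
  [/\ geodesic_curve h X, a < b, position X a = P & position X b = Q].

(* Length of a geodesic arc, by coefficientwise integration. *)
Definition is_distance (h : dimension) (P Q : superspace) (D : superR) : Prop :=
  exists X a b, geodesic_arc h P Q X a b /\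
  forall I : {fset nat}, mcoeff I D =
    (\int[lebesgue_measure]_(t in `[a, b])
      mcoeff I (gsqrt (gnorm (sform (velocity X t) (velocity X t)))))%R.

Definition super_segment (h : dimension) (P Q : superspace)
    (S : set superspace) : Prop :=
  exists X a b, geodesic_arc h P Q X a b /\
  S = [set curve_ext X s | s in [set s | is_even s /\ a <= body s <= b]].

End SuperNumbers.

(* Main.v *)
(** Testing criticality against bump variations gives the Euler-Lagrange
    equation [X'' = k^2 X] along a geodesic, where [<X', X'> = - k^2] for a
    constant even [k] of positive body.  Hence
    [X(t) = (exp (k t) E0 + exp (- k t) F0) / 2] with [E0], [F0] null and
    [<E0, F0> = 2].  If this curve passes through [P] at [exp alpha] and
    through [Q] at [exp beta], then [w = exp (beta - alpha)] satisfies
    [w + 1/w = 2 d = T + 1/T], that is [(w - T) (1 - 1/(w T)) = 0].  Orienting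
    the curve so that [w] has body greater than 1 makes the second factor
    invertible, so [w = T]; then [P] and [Q] determine the two null vectors,
    and the curve is a reparametrization of [(exp s E + exp (- s) F) / 2]. *)
Require Import Defs.
From HB Require Import structures.
From mathcomp Require Import all_boot all_order all_algebra finmap.
From mathcomp Require Import all_classical all_reals all_analysis.
From mathcomp Require Import complex ring lra.
From mathcomp Require Import -(notations) monalg.

Set Implicit Arguments.
Unset Strict Implicit.
Unset Printing Implicit Defensive.

Import Order.TTheory GRing.Theory Num.Theory.
Import numFieldNormedType.Exports.

Local Open Scope fset_scope.
Local Open Scope ring_scope.

(** Two features of super numbers shape the argument. Products do not commute; only even numbers are
    central, so polynomial identities between even numbers are proved in the commutative ring they
    form and carried back. And a comparison of bodies never gives an equality: it only makes an even
    factor invertible, after which the factor is cancelled. A geodesic is only assumed to have a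
    velocity whose square has nonzero body. That this body is negative is the reversed
    Cauchy-Schwarz inequality for vectors tangent to the hyperboloid. Near such a velocity the
    absolute value is a change of sign, so for a small real perturbation the Lagrangian is exactly
    quadratic, and its variation needs no differentiation under the integral. The parameters [alpha]
    and [beta] are even super numbers, while the ends of a geodesic arc are real. The unit-speed
    line through [P] and [Q] therefore reaches [Q] at a parameter that need not be real; lengths and
    segments use the same line run at the super speed [D] over the real interval from 0 to 1. *)

(** * Coefficients, parity and commutation in the Grassmann algebra *)

Section GrassmannProduct.
Context {K : comNzRingType}.
Implicit Types (a b : grassmann K) (I J L : {fset nat}).

Lemma gmulE a b : a * b = \sum_(I <- msupp a) \sum_(J <- msupp b)
  mkmalgU (I `|` J) (gsign I J * (mcoeff I a * mcoeff J b)) :> grassmann K.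
Proof. by []. Qed.

(** The index set depends on [I] alone and not on the supports of the factors. For factors varying
    with a real parameter, each coefficient of the product is thus a fixed finite sum, to be
    differentiated or integrated term by term. *)
Lemma mcoeffM I a b : mcoeff I (a * b) =
  \sum_(J <- fpowerset I) gsign J (I `\` J) * (mcoeff J a * mcoeff (I `\` J) b).
Proof.
change (a * b) with (gmul a b).
pose d1 := msupp a `|` fpowerset I; pose d2 := msupp b `|` fpowerset I.
rewrite (@gmulw _ d1 d2) ?fsubsetUl // raddf_sum /=.
have sub1 : fpowerset I `<=` d1 by exact: fsubsetUr.
rewrite -(big_fset_incl _ sub1) /=; last first.
  move=> J _ JI; rewrite raddf_sum big1 //= => L _; rewrite mcoeffU.
  case: eqP => [E|_]; last by rewrite mulr0n.
  by move: JI; rewrite fpowersetE -E fsubsetUl.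
rewrite !big_seq; apply: eq_bigr => J; rewrite fpowersetE => JI.
have ID : I `\` J \in d2 by rewrite in_fsetU fpowersetE fsubsetDl orbT.
rewrite raddf_sum (bigD1_seq (I `\` J)) //= ?fset_uniq // mcoeffU.
have -> : J `|` (I `\` J) = I by rewrite fsetUDl fsetDv fsetD0; apply/fsetUidPr.
rewrite eqxx mulr1n big1 ?addr0 // => L LI; rewrite mcoeffU.
case: eqP => [E|_]; last by rewrite mulr0n.
rewrite mulr1n /gsign; case: ifP => [dJL|]; last by rewrite mul0r.
move: LI; rewrite -E fsetDUl fsetDv fset0U.
suff -> : L `\` J = L by rewrite eqxx.
by apply/fsetDidPl; rewrite fdisjoint_sym.
Qed.

Lemma mcoeffM_neq0 I a b : mcoeff I (a * b) != 0 ->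
  exists J L, [/\ mcoeff J a != 0, mcoeff L b != 0, fdisjoint J L & I = J `|` L].
Proof.
rewrite mcoeffM => nz.
have [J /andP[]] : exists J, (J \in fpowerset I) &&
   (gsign J (I `\` J) * (mcoeff J a * mcoeff (I `\` J) b) != 0 :> K).
  have [//|H] := pselect (exists J, (J \in fpowerset I) &&
   (gsign J (I `\` J) * (mcoeff J a * mcoeff (I `\` J) b) != 0 :> K)).
  move/eqP: nz; case; rewrite big_seq big1 // => J JI.
  by apply/eqP; apply: contra_notT H => nz; exists J; rewrite JI nz.
rewrite fpowersetE => JI nz'; exists J, (I `\` J); split.
- by apply: contraNneq nz' => ->; rewrite mul0r mulr0.
- by apply: contraNneq nz' => ->; rewrite !mulr0.
- by rewrite fdisjoint_sym; apply/fdisjointP => i; rewrite in_fsetD => /andP[].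
- by rewrite fsetUDl fsetDv fsetD0; apply/esym/fsetUidPr.
Qed.

Lemma mcoeff1 I : mcoeff I (1 : grassmann K) = (I == fset0)%:R.
Proof.
change (mcoeff I (gone : grassmann K) = (I == fset0)%:R).
by rewrite /gone mcoeffU eq_sym.
Qed.

Lemma bodyM a b : body (a * b) = body a * body b.
Proof.
rewrite /body mcoeffM fpowerset0 big_seq_fset1 fset0D /gsign fdisjoint0X.
by rewrite /inversions big_seq_fset0 expr0 mul1r.
Qed.

Lemma body1 : body (1 : grassmann K) = 1.
Proof. by rewrite /body mcoeff1 eqxx. Qed.

Lemma bodyD a b : body (a + b) = body a + body b. Proof. exact: mcoeffD. Qed.
Lemma bodyB a b : body (a - b) = body a - body b. Proof. exact: mcoeffB. Qed.
Lemma bodyN a : body (- a) = - body a. Proof. exact: mcoeffN. Qed.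
Lemma bodyZ (x : K) a : body (x *: a) = x * body a. Proof. exact: mcoeffZ. Qed.
Lemma body0 : body (0 : grassmann K) = 0. Proof. exact: mcoeff0. Qed.

Lemma body_alg (x : K) : body (x%:A : grassmann K) = x.
Proof. by rewrite bodyZ body1 mulr1. Qed.

(** One predicate for both parities, so that sign rules can be stated by boolean operations on them;
    [0] has both parities. *)
Definition has_parity (p : bool) a :=
  forall I, mcoeff I a != 0 -> odd #|` I| = p.

Lemma is_evenE a : is_even a <-> has_parity false a.
Proof.
by split=> H I /H; [move/negbTE | move=> ->].
Qed.

Lemma is_oddE a : is_odd a <-> has_parity true a.
Proof. by split=> H I /H. Qed.

Lemma parity0 p : has_parity p 0.
Proof. by move=> I; rewrite mcoeff0 eqxx. Qed.

Lemma parityD p a b : has_parity p a -> has_parity p b -> has_parity p (a + b).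
Proof.
move=> Ha Hb I; rewrite mcoeffD; have [->|/Ha//] := eqVneq (mcoeff I a) 0.
by rewrite add0r => /Hb.
Qed.

Lemma parityZ p (x : K) a : has_parity p a -> has_parity p (x *: a).
Proof.
move=> Ha I; rewrite mcoeffZ => nz; apply: Ha.
by apply: contraNneq nz => ->; rewrite mulr0.
Qed.

Lemma parityN p a : has_parity p a -> has_parity p (- a).
Proof. by move=> Ha I; rewrite mcoeffN oppr_eq0 => /Ha. Qed.

Lemma parityB p a b : has_parity p a -> has_parity p b -> has_parity p (a - b).
Proof. by move=> Ha Hb; apply: parityD => //; exact: parityN. Qed.

Lemma parityM p q a b :
  has_parity p a -> has_parity q b -> has_parity (p (+) q) (a * b).
Proof.
move=> Ha Hb I /mcoeffM_neq0[J [L [/Ha HJ /Hb HL dJL ->]]].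
by rewrite cardfsU (eqP dJL) cardfs0 subn0 oddD HJ HL.
Qed.

Lemma parity1 : has_parity false 1.
Proof.
move=> I; rewrite mcoeff1; case: (eqVneq I fset0) => [->|_]; first by rewrite cardfs0.
by rewrite mulr0n eqxx.
Qed.

Lemma parity_sum p T (r : seq T) (F : T -> grassmann K) :
  (forall i, has_parity p (F i)) -> has_parity p (\sum_(i <- r) F i).
Proof.
by move=> H; elim/big_rec: _ => [|i x _ Hx]; [exact: parity0 | exact: parityD].
Qed.

Lemma even0 : is_even (0 : grassmann K). Proof. by apply/is_evenE/parity0. Qed.
Lemma even1 : is_even (1 : grassmann K). Proof. by apply/is_evenE/parity1. Qed.

Lemma evenD a b : is_even a -> is_even b -> is_even (a + b).
Proof. by rewrite !is_evenE; exact: parityD. Qed.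

Lemma evenN a : is_even a -> is_even (- a).
Proof. by rewrite !is_evenE; exact: parityN. Qed.

Lemma evenB a b : is_even a -> is_even b -> is_even (a - b).
Proof. by rewrite !is_evenE; exact: parityB. Qed.

Lemma evenM a b : is_even a -> is_even b -> is_even (a * b).
Proof. by rewrite !is_evenE; exact: parityM. Qed.

Lemma evenZ (x : K) a : is_even a -> is_even (x *: a).
Proof. by rewrite !is_evenE; exact: parityZ. Qed.

Lemma evenA (x : K) : is_even (x%:A : grassmann K).
Proof. by apply: evenZ; exact: even1. Qed.

Lemma evenX a n : is_even a -> is_even (a ^+ n).
Proof.
move=> Ha; elim: n => [|n IH]; first by rewrite expr0; exact: even1.
by rewrite exprS; exact: evenM.
Qed.

Lemma even_sum T (r : seq T) (F : T -> grassmann K) :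
  (forall i, is_even (F i)) -> is_even (\sum_(i <- r) F i).
Proof.
by move=> H; apply/is_evenE/parity_sum => i; exact/is_evenE.
Qed.

(** For disjoint [I] and [J] each pair in [I] times [J] is an inversion in exactly one of the two
    orders, so the two inversion numbers add up to the product of the cardinals. *)
Lemma gsignC I J :
  gsign I J = (-1) ^+ (odd #|` I| && odd #|` J|) * gsign J I :> K.
Proof.
rewrite /gsign fdisjoint_sym; case: ifP => [dIJ|]; last by rewrite mulr0.
have inv_card : (inversions I J + inversions J I = #|` I| * #|` J|)%N.
  rewrite /inversions [X in (_ + X)%N]exchange_big -big_split /=.
  under eq_bigr => i _ do rewrite -big_split /=.
  transitivity (\sum_(i <- I) \sum_(j <- J) 1)%N.
    rewrite big_seq [RHS]big_seq; apply: eq_bigr => i iI.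
    rewrite big_seq [RHS]big_seq; apply: eq_bigr => j jJ.
    case: ltngtP => // eij.
    by move/fdisjointP: dIJ => /(_ j jJ); rewrite eij iI.
  by rewrite !big_const_seq !count_predT !iter_addn_0 mul1n mulnC.
rewrite -[LHS]signr_odd -[X in _ * X]signr_odd -signr_addb.
by congr (_ ^+ _); rewrite -oddM -inv_card oddD -addbA addbb addbF.
Qed.

Lemma parity_comm p q a b : has_parity p a -> has_parity q b ->
  a * b = (-1) ^+ (p && q) * (b * a).
Proof.
move=> Ha Hb; rewrite mulr_sign !gmulE [LHS]exchange_big /=.
rewrite (_ : (if p && q then _ else _) = (-1) ^+ (p && q) *: \sum_(I <- msupp b)
  \sum_(J <- msupp a) mkmalgU (I `|` J) (gsign I J * (mcoeff I b * mcoeff J a))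
   :> grassmann K); last by case: (p && q); rewrite ?expr1 ?scaleN1r ?scale1r.
rewrite scaler_sumr [LHS]big_seq [RHS]big_seq; apply: eq_bigr => I.
rewrite -mcoeff_neq0 => /Hb HI.
rewrite scaler_sumr [LHS]big_seq [RHS]big_seq; apply: eq_bigr => J.
rewrite -mcoeff_neq0 => /Ha HJ.
apply/malgP => L; rewrite mcoeffZ !mcoeffU fsetUC mulrnAr gsignC HI HJ.
by congr (_ *+ _); rewrite -mulrA [mcoeff J a * _]mulrC.
Qed.

(** No parity is asked of [b]: it splits into an odd and an even part, and an even number commutes
    with each. *)
Lemma even_comm a b : is_even a -> a * b = b * a.
Proof.
move=> /is_evenE Ha.
pose part p : grassmann K := \sum_(I <- msupp b | odd #|` I| == p)
  mkmalgU I (mcoeff I b).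
have -> : b = part true + part false.
  rewrite {1}(monalgE b) (bigID (fun I : {fset nat} => odd #|` I| == true)) /=.
  by congr (_ + _); apply: eq_bigl => I; case: odd.
have Hp p : has_parity p (part p).
  rewrite /part; elim/big_ind: _ => [|x y|I /eqP HI]; [exact: parity0|exact: parityD|].
  move=> J; rewrite mcoeffU; case: (eqVneq I J) => [<- //|_].
  by rewrite mulr0n eqxx.
by rewrite mulrDr mulrDl !(parity_comm Ha (Hp _)) !expr0 !mul1r.
Qed.

End GrassmannProduct.

(** * Degree filtration and nilpotence of the soul *)

Section Soul.
Context {K : comNzRingType}.
Implicit Types (a b nu : grassmann K) (I S : {fset nat}).

(** The filtration by lowest degree inside the exterior algebra on the finite set [S]. It is
    multiplicative and reaches zero once [n] exceeds the cardinal of [S], which gives nilpotence of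
    souls and termination of iterations. *)
Definition supported (n : nat) S a :=
  forall I, mcoeff I a != 0 -> (n <= #|` I|)%N && (I `<=` S).

Lemma supported0 n S : supported n S 0.
Proof. by move=> I; rewrite mcoeff0 eqxx. Qed.

Lemma supportedD n S a b :
  supported n S a -> supported n S b -> supported n S (a + b).
Proof.
move=> Ha Hb I; rewrite mcoeffD; have [->|/Ha//] := eqVneq (mcoeff I a) 0.
by rewrite add0r => /Hb.
Qed.

Lemma supportedZ n S (x : K) a : supported n S a -> supported n S (x *: a).
Proof.
move=> Ha I; rewrite mcoeffZ => nz; apply: Ha.
by apply: contraNneq nz => ->; rewrite mulr0.
Qed.

Lemma supportedN n S a : supported n S a -> supported n S (- a).
Proof. by move=> Ha I; rewrite mcoeffN oppr_eq0 => /Ha. Qed.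

Lemma supportedM n m S a b :
  supported n S a -> supported m S b -> supported (n + m) S (a * b).
Proof.
move=> Ha Hb I /mcoeffM_neq0[J [L [/Ha/andP[nJ JS] /Hb/andP[mL LS] dJL ->]]].
by rewrite fsubUset JS LS cardfsU (eqP dJL) cardfs0 subn0 leq_add.
Qed.

Lemma supported_alg S (x : K) : supported 0 S x%:A.
Proof.
apply: supportedZ => I; rewrite mcoeff1; case: (eqVneq I fset0) => [->|_].
  by rewrite fsub0set.
by rewrite mulr0n eqxx.
Qed.

Lemma supported1 S : supported 0 S 1.
Proof. by rewrite -[1]scale1r; exact: supported_alg. Qed.

Lemma supportedX n S a k : supported n S a -> supported (k * n) S (a ^+ k).
Proof.
move=> Ha; elim: k => [|k IH]; first by rewrite expr0; exact: supported1.
by rewrite exprS mulSn; exact: supportedM.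
Qed.

Lemma supportedW n m S a : (n <= m)%N -> supported m S a -> supported n S a.
Proof.
by move=> nm Ha I /Ha/andP[mI ->]; rewrite andbT (leq_trans nm).
Qed.

Lemma supported_sum n S T (r : seq T) (F : T -> grassmann K) :
  (forall i, supported n S (F i)) -> supported n S (\sum_(i <- r) F i).
Proof.
by move=> H; elim/big_rec: _ => [|i x _ Hx]; [exact: supported0 | exact: supportedD].
Qed.

Lemma supported_eq0 n S a : (#|` S| < n)%N -> supported n S a -> a = 0.
Proof.
move=> Sn Ha; apply/malgP => I; rewrite mcoeff0; apply/eqP.
apply: contraTT Sn => /Ha/andP[nI IS]; rewrite -leqNgt (leq_trans nI) //.
exact: fsubset_leq_card.
Qed.

Lemma supported_generators a : supported 0 (generators a) a.
Proof. by move=> I; rewrite mcoeff_neq0 => Ia; rewrite bigfcup_sup. Qed.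

Lemma supported_body0 S a : supported 0 S a -> body a = 0 -> supported 1 S a.
Proof.
move=> Ha a0 I nz; have /andP[_ ->] := Ha I nz; rewrite andbT cardfs_gt0.
by apply: contraNneq nz => ->; rewrite -/(body a) a0.
Qed.

Lemma soulE a : a = (body a)%:A + soul a.
Proof. by rewrite /soul addrC subrK. Qed.

Lemma body_soul a : body (soul a) = 0.
Proof. by rewrite bodyB body_alg subrr. Qed.

Lemma even_soul a : is_even a -> is_even (soul a).
Proof. by move=> Ha; apply: evenB => //; exact: evenA. Qed.

Lemma soul_alg (x : K) : soul (x%:A : grassmann K) = 0.
Proof. by rewrite /soul body_alg subrr. Qed.

Lemma soulZ (x : K) a : soul (x *: a) = x *: soul a.
Proof. by rewrite /soul scalerBr bodyZ scalerA. Qed.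

Lemma soulN a : soul (- a) = - soul a.
Proof. by rewrite -scaleN1r soulZ scaleN1r. Qed.

Lemma soul_body0 a : body a = 0 -> soul a = a.
Proof. by move=> a0; rewrite /soul a0 scale0r subr0. Qed.

Lemma soul_supported S a : supported 0 S a -> supported 1 S (soul a).
Proof.
move=> Ha; apply: supported_body0 (body_soul a).
by apply: supportedD => //; apply: supportedN; exact: supported_alg.
Qed.

Lemma supported_nilp S a k : supported 1 S a -> (#|` S| < k)%N -> a ^+ k = 0.
Proof.
move=> Ha Sk; apply: (supported_eq0 Sk).
by have := supportedX (k := k) Ha; rewrite muln1.
Qed.

Lemma soul_nilp a k : (nil_order a <= k)%N -> soul a ^+ k = 0.
Proof.
by move=> ak; apply: supported_nilp ak; exact/soul_supported/supported_generators.
Qed.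

Lemma exprZN a k : (- a) ^+ k = ((-1) ^+ k : K) *: a ^+ k.
Proof. by rewrite -exprZn scaleN1r. Qed.

Lemma nilp_leq nu n m : (n <= m)%N -> nu ^+ n = 0 -> nu ^+ m = 0.
Proof. by move=> nm n0; rewrite -(subnK nm) exprD n0 mulr0. Qed.

(** A truncated series in a nilpotent element does not depend on where it is cut, as long as both
    cuts lie beyond nilpotence; this frees Taylor sums from the particular bound [nil_order]. *)
Lemma nilp_sum_widen (V : lmodType K) (f : nat -> grassmann K -> V) nu n m :
    (forall k, f k 0 = 0) -> nu ^+ n = 0 -> nu ^+ m = 0 ->
  \sum_(k < n) f k (nu ^+ k) = \sum_(k < m) f k (nu ^+ k).
Proof.
move=> f0; wlog nm : n m / (n <= m)%N.
  by move=> W n0 m0; case/orP: (leq_total n m) => H; [|symmetry]; apply: W.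
move=> n0 _; rewrite (big_ord_widen m (fun k => f k (nu ^+ k)) nm).
rewrite big_mkcond; apply: eq_bigr => k _.
by case: ltnP => // nk; rewrite (nilp_leq nk n0) f0.
Qed.

(** The coefficients shift by one and the top term dies. The factor [*+ (0 < k)] removes the
    spurious value [c 0] that [k.-1] produces at [k = 0]. *)
Lemma mulr_nilp_sum (c : nat -> K) nu n : nu ^+ n = 0 ->
  nu * \sum_(k < n) c k *: nu ^+ k = \sum_(k < n) (c k.-1 *+ (0 < k)%N) *: nu ^+ k.
Proof.
move=> n0; rewrite mulr_sumr.
have E (k : 'I_n) : nu * (c k *: nu ^+ k) = (c k.+1.-1 *+ (0 < k.+1)%N) *: nu ^+ k.+1.
  by rewrite -scalerAr exprS.
rewrite (eq_bigr _ (fun k _ => E k)).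
pose F k := (c k.-1 *+ (0 < k)%N) *: nu ^+ k.
have : \sum_(k < n.+1) F k = \sum_(k < n.+1) F k by [].
rewrite {1}big_ord_recl big_ord_recr /= /F n0 scaler0 addr0 mulr0n scale0r add0r.
by [].
Qed.

Lemma body_nilp_sum (c : nat -> K) nu n : body nu = 0 ->
  body (\sum_(k < n.+1) c k *: nu ^+ k) = c 0%N.
Proof.
move=> nu0; rewrite big_ord_recl expr0 bodyD bodyZ body1 mulr1 /body raddf_sum.
rewrite big1 ?addr0 //= => k _; rewrite -/(body _) bodyZ exprS bodyM nu0.
by rewrite mul0r mulr0.
Qed.

End Soul.

(** * Taylor extension of the elementary functions *)

Section Taylor.
Variable R : realType.
Implicit Types (a b u : superR R) (f : R -> R).
Local Open Scope classical_set_scope.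

Lemma taylorE f a n : soul a ^+ n = 0 ->
  taylor f a = \sum_(k < n) (derive1n k f (body a) / k`!%:R) *: soul a ^+ k.
Proof.
move=> n0; rewrite /taylor.
apply: (nilp_sum_widen (f := fun k x => (derive1n k f (body a) / k`!%:R) *: x)) => //.
  by move=> k; rewrite scaler0.
exact: soul_nilp.
Qed.

Lemma body_taylor f a : body (taylor f a) = f (body a).
Proof.
rewrite /taylor /nil_order (body_nilp_sum (fun k => derive1n k f (body a) / k`!%:R)) ?body_soul //.
by rewrite fact0 divr1.
Qed.

Lemma even_taylor f a : is_even a -> is_even (taylor f a).
Proof.
move=> Ha; apply: even_sum => k; apply: evenZ; apply: evenX.
exact: even_soul.
Qed.

(** A candidate closed form for all derivatives at once, so that iterated derivatives are checked by
    one induction. In the next lemma [U] must be open, since a derivative at a point depends on a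
    neighbourhood. *)
Definition jet_on (U : set R) (g : nat -> R -> R) : Prop :=
  forall k y, U y -> is_derive y 1 (g k) (g k.+1 y).

Lemma derive1n_on (U : set R) f (g : nat -> R -> R) : open U ->
    (forall y, U y -> f y = g 0%N y) ->
    jet_on U g ->
  forall k y, U y -> derive1n k f y = g k y.
Proof.
move=> oU fg dg; elim=> [|k IH] y Uy; first by rewrite derive1n0 fg.
rewrite derive1nS derive1E (@near_eq_derive _ _ _ _ (g k)).
  by have := dg k y Uy => dgk; rewrite derive_val.
have : open_nbhs y U by [].
by move=> /open_nbhs_nbhs; apply: filterS => z Uz; exact: IH.
Qed.

Lemma taylor_on (U : set R) f (g : nat -> R -> R) a n : open U ->
    (forall y, U y -> f y = g 0%N y) ->
    jet_on U g ->
    U (body a) -> soul a ^+ n = 0 ->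
  taylor f a = \sum_(k < n) (g k (body a) / k`!%:R) *: soul a ^+ k.
Proof.
move=> oU fg dg Ua n0; rewrite (taylorE _ n0); apply: eq_bigr => k _.
by rewrite (derive1n_on oU fg dg).
Qed.

Lemma gexpE a n : soul a ^+ n = 0 ->
  gexp a = expR (body a) *: \sum_(k < n) k`!%:R^-1 *: soul a ^+ k.
Proof.
move=> n0; rewrite /gexp (@taylor_on setT _ (fun _ => expR) _ n) //.
- by rewrite scaler_sumr; apply: eq_bigr => k _; rewrite scalerA.
- exact: openT.
- by move=> k y _; exact: is_derive_expR.
Qed.

Lemma scale_half (V : lmodType R) (x y c e : R) (m : V) :
  ((x + e * y) / 2 / c) *: m =
  2^-1 *: (x *: (c^-1 *: m)) + 2^-1 *: (y *: (c^-1 *: (e *: m))).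
Proof. by rewrite !scalerA -scalerDl; congr (_ *: _); ring. Qed.

Lemma gcoshE a : gcosh a = 2^-1 *: (gexp a + gexp (- a)).
Proof.
have n0 := soul_nilp (leqnn (nil_order a)).
have n0N : soul (- a) ^+ nil_order a = 0 by rewrite soulN exprNn n0 mulr0.
rewrite (gexpE n0) (gexpE n0N) /gcosh.
(* The sign in the k-th derivative of the hyperbolic cosine is the one produced by powers of the
   soul of [- a]. *)
rewrite (@taylor_on setT _ (fun k x => (expR x + (-1) ^+ k * expR (- x)) / 2) _ (nil_order a)) //.
- rewrite 2!scaler_sumr -big_split /=.
  rewrite scaler_sumr.
  apply: eq_bigr => k _.
  rewrite scalerDr.
  rewrite soulN bodyN.
  rewrite (exprZN (soul a) k).
  move: (soul a ^+ k) => m.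
  exact: scale_half.
- exact: openT.
- by move=> y _; rewrite expr0 mul1r.
- move=> k y _.
  have d1 : is_derive y 1 (fun x : R => expR (- x)) (- expR (- y)).
    have dN : is_derive y 1 (fun x : R => - x) (- 1) by exact: is_deriveN.
    by apply: is_derive_eq (is_derive1_comp (is_derive_expR (- y)) dN) _; rewrite mulrN1.
  have := is_deriveZ 2^-1 (is_deriveD (is_derive_expR y) (is_deriveZ ((-1) ^+ k) d1)).
  rewrite (_ : _ \*: _ = fun x => (expR x + (-1) ^+ k * expR (- x)) / 2); last first.
    by apply/funext => x; rewrite [LHS]mulrC.
  move=> H; apply: is_derive_eq H _.
  by rewrite /GRing.scale /= exprS; ring.
Qed.

Lemma ginvM a : is_even a -> body a != 0 -> a * ginv a = 1.
Proof.
move=> Ha a0; set n := nil_order a.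
have n0 : soul a ^+ n = 0 by exact: soul_nilp.
rewrite /ginv (@taylor_on [set x | x != 0] _
  (fun k x => (-1) ^+ k * k`!%:R * (x ^+ k.+1)^-1) _ n) //; last first.
- move=> k y y0; rewrite /mkset in y0.
  have dX : is_derive y 1 (fun x : R => x ^+ k.+1) (k.+1%:R * y ^+ k).
    have H := is_deriveX k.+1 (is_derive_id y 1); rewrite exprfctE in H.
    by apply: is_derive_eq H _; rewrite [LHS]mulr1.
  have dV := is_deriveV (f := fun x : R => x ^+ k.+1) (expf_neq0 k.+1 y0) dX.
  have := is_deriveZ ((-1) ^+ k * k`!%:R) dV; move=> H; apply: is_derive_eq H _.
  rewrite /GRing.scale /= factS natrM !exprS; field.
  by rewrite y0 expf_neq0.
- by move=> y _; rewrite fact0 expr0 expr1 !mul1r.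
(* Since [a] is its body times [1 - mu] with [mu] nilpotent, the Taylor sum of the inverse is a
   finite geometric series in [mu]. *)
pose mu := - ((body a)^-1 *: soul a).
have {1}-> : a = body a *: (1 - mu).
  by rewrite opprK scalerDr scalerA divff // scale1r -soulE.
have -> : \sum_(k < n) ((-1) ^+ k * k`!%:R * (body a ^+ k.+1)^-1 / k`!%:R) *: soul a ^+ k
   = (body a)^-1 *: \sum_(k < n) mu ^+ k.
  rewrite scaler_sumr; apply: eq_bigr => k _.
  rewrite /mu -scaleNr exprZn scalerA; congr (_ *: _).
  rewrite exprS [in RHS]exprNn [in RHS]exprVn; field.
  by rewrite a0 expf_neq0 //= pnatr_eq0 -lt0n fact_gt0.
rewrite -scalerAr -scalerAl scalerA mulVf // scale1r -opprB mulNr -subrX1.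
by rewrite /mu exprNn exprZn n0 scaler0 mulr0 sub0r opprK.
Qed.

Lemma gnormE a : body a != 0 -> Defs.gnorm a = Num.sg (body a) *: a.
Proof.
move=> a0; set n := nil_order a; set s := Num.sg (body a).
have n0 : soul a ^+ n.+2 = 0 by apply: soul_nilp; rewrite /n leqW.
(* On the open half-line containing the body, the absolute value is the linear map with slope [s].
   The order is raised by two so that the constant and linear terms can always be split off. *)
rewrite /Defs.gnorm (@taylor_on [set x | 0 < s * x] _
  (fun k x => if k == 0%N then s * x else if k == 1%N then s else 0) _ n.+2) //.
- rewrite big_ord_recl big_ord_recl big1 => [|k _]; last by rewrite mul0r scale0r.
  rewrite /= addr0 !divr1 expr0 expr1 -scalerA -scalerDr; congr (_ *: _).
  by rewrite -soulE.
- rewrite (_ : mkset _ = (fun x => s * x) @^-1` [set x | 0 < x]) //.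
  apply: open_comp; last exact: open_gt.
  by move=> x _; exact: mulrl_continuous.
- move=> y /= sy; rewrite /s in sy *.
  case: (ltgtP (body a) 0) a0 sy => // [b0|b0] _.
    by rewrite ltr0_sg // !mulN1r oppr_gt0 => y0; rewrite ltr0_norm.
  by rewrite gtr0_sg // !mul1r => y0; rewrite gtr0_norm.
- move=> [|[|k]] y _ /=; [|exact: is_derive_cst|exact: is_derive_cst].
  by apply: is_derive_eq (is_deriveZ s (is_derive_id y 1)) _; rewrite [LHS]mulr1.
- by rewrite /= /s -normrEsg normr_gt0.
Qed.

End Taylor.

(** * The commutative ring of even super numbers *)

Section EvenPart.
Variable K : comNzRingType.

Definition evenb (a : grassmann K) : bool :=
  all (fun I : {fset nat} => ~~ odd #|` I|) (msupp a).

Lemma evenP a : reflect (is_even a) (evenb a).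
Proof.
apply: (iffP allP) => H I; first by rewrite mcoeff_neq0 => /H.
by rewrite -mcoeff_neq0 => /H.
Qed.

Lemma evenb_subring : subring_closed evenb.
Proof.
split=> [|a b /evenP Ha /evenP Hb|a b /evenP Ha /evenP Hb]; apply/evenP.
- exact: even1.
- exact: evenB.
- exact: evenM.
Qed.

HB.instance Definition _ := GRing.isSubringClosed.Build (grassmann K) evenb
  evenb_subring.

(** Identities between even numbers become accessible to [ring] here; [val] carries them back to the
    non-commutative algebra. *)
Record even_part := EvenPart {
  even_val :> grassmann K;
  _ : even_val \in evenb
}.

HB.instance Definition _ := [isSub for even_val].
HB.instance Definition _ := [Choice of even_part by <:].
HB.instance Definition _ := [SubChoice_isSubNzRing of even_part by <:].

Lemma even_part_mulC (x y : even_part) : x * y = y * x.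
Proof.
apply: val_inj; rewrite !rmorphM /=; apply: even_comm.
by apply/evenP; exact: (valP x).
Qed.

HB.instance Definition _ :=
  GRing.PzRing_hasCommutativeMul.Build even_part even_part_mulC.

Lemma even_partP (a : grassmann K) :
  is_even a -> exists x : even_part, a = \val x.
Proof. by move=> /evenP Ha; exists (EvenPart Ha). Qed.

End EvenPart.

(** * Coefficientwise derivatives and continuity *)

Section Derivative.
Variable R : realType.
Implicit Types (f g df dg : R -> superR R) (a b : superR R) (t : R).
Local Open Scope classical_set_scope.

Lemma gderiv_eq f df dg : gderiv f df -> (forall t, df t = dg t) -> gderiv f dg.
Proof. by move=> H E I t; rewrite -E; exact: H. Qed.

Lemma eq_gderiv f g df : gderiv f df -> (forall t, f t = g t) -> gderiv g df.
Proof. by move=> H /funext <-. Qed.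

Lemma gderiv_cst a : gderiv (fun _ => a) (fun _ => 0).
Proof. by move=> I t; rewrite mcoeff0; exact: is_derive_cst. Qed.

Lemma gderivD f g df dg : gderiv f df -> gderiv g dg ->
  gderiv (fun t => f t + g t) (fun t => df t + dg t).
Proof.
move=> Hf Hg I t; rewrite mcoeffD.
have := is_deriveD (Hf I t) (Hg I t).
by congr is_derive; apply/funext => u /=; rewrite mcoeffD.
Qed.

Lemma gderivS (c dc : R -> R) f df :
    (forall t, is_derive t 1 c (dc t)) -> gderiv f df ->
  gderiv (fun t => c t *: f t) (fun t => dc t *: f t + c t *: df t).
Proof.
move=> Hc Hf I t; rewrite mcoeffD !mcoeffZ.
have := is_deriveM (Hc t) (Hf I t); rewrite /GRing.scale /= addrC.
rewrite [_ * dc t]mulrC.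
by congr is_derive; apply/funext => u /=; rewrite mcoeffZ.
Qed.

Lemma gderivZ (c : R) f df : gderiv f df ->
  gderiv (fun t => c *: f t) (fun t => c *: df t).
Proof.
move=> Hf; apply: (gderiv_eq (gderivS (fun t => is_derive_cst c t 1) Hf)) => t.
by rewrite scale0r add0r.
Qed.

Lemma is_derive_bigsum (T : Type) (r : seq T) (F : T -> R -> R) (dF : T -> R) t :
    (forall i, is_derive t 1 (F i) (dF i)) ->
  is_derive t 1 (fun u => \sum_(i <- r) F i u) (\sum_(i <- r) dF i).
Proof.
move=> H; elim: r => [|i r IH].
  rewrite big_nil (_ : (fun _ => _) = cst 0); first exact: is_derive_cst.
  by apply/funext => u; rewrite big_nil.
rewrite big_cons (_ : (fun _ => _) = F i + (fun u => \sum_(j <- r) F j u)).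
  exact: is_deriveD.
by apply/funext => u; rewrite big_cons.
Qed.

Lemma gderiv_sum (T : Type) (r : seq T) (F dF : T -> R -> superR R) :
    (forall i, gderiv (F i) (dF i)) ->
  gderiv (fun t => \sum_(i <- r) F i t) (fun t => \sum_(i <- r) dF i t).
Proof.
move=> H I t; rewrite raddf_sum /=.
have := is_derive_bigsum (dF := fun i => mcoeff I (dF i t)) r (fun i => H i I t).
by congr is_derive; apply/funext => u /=; rewrite raddf_sum.
Qed.

Lemma gderivM f g df dg : gderiv f df -> gderiv g dg ->
  gderiv (fun t => f t * g t) (fun t => df t * g t + f t * dg t).
Proof.
move=> Hf Hg I t; rewrite mcoeffD (mcoeffM I (df t)) (mcoeffM I (f t)).
rewrite -big_split /=.
pose F (J : {fset nat}) (u : R) : R :=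
  gsign J (I `\` J)%fset * (mcoeff J (f u) * mcoeff (I `\` J)%fset (g u)).
pose dF (J : {fset nat}) : R :=
  gsign J (I `\` J)%fset * (mcoeff J (df t) * mcoeff (I `\` J)%fset (g t)) +
  gsign J (I `\` J)%fset * (mcoeff J (f t) * mcoeff (I `\` J)%fset (dg t)).
have H J : is_derive t 1 (F J) (dF J).
  have := is_deriveZ (gsign J (I `\` J)%fset) (is_deriveM (Hf J t) (Hg (I `\` J)%fset t)).
  rewrite /GRing.scale /= => D; apply: (is_derive_eq D).
  by rewrite mulrDr addrC [_ * mcoeff J (df t)]mulrC.
have := is_derive_bigsum (fpowerset I) H.
congr is_derive.
by apply/funext => u /=; rewrite (mcoeffM I (f u)).
Qed.

Lemma gderiv_mull a f df : gderiv f df ->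
  gderiv (fun t => a * f t) (fun t => a * df t).
Proof.
move=> Hf; apply: (gderiv_eq (gderivM (gderiv_cst a) Hf)) => t.
by rewrite mul0r add0r.
Qed.

Lemma gderiv_unique f df dg : gderiv f df -> gderiv f dg -> df =1 dg.
Proof.
move=> H1 H2 t; apply/malgP => I; have := H1 I t; have := H2 I t.
by move=> [_ <-] [_ <-].
Qed.

Lemma gderiv0_cst f s t : gderiv f (fun _ => 0) -> f s = f t.
Proof.
move=> Hf; apply/malgP => I.
apply: (is_derive_0_is_cst (f := fun u => mcoeff I (f u))) => u.
by have := Hf I u; rewrite mcoeff0.
Qed.

Lemma gderiv_mcoeff0 f df I :
  gderiv f df -> (forall t, mcoeff I (f t) = 0) -> forall t, mcoeff I (df t) = 0.
Proof.
move=> Hf H0 t; have [_ <-] := Hf I t.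
rewrite (_ : (fun u => _) = cst 0); last by apply/funext => u; rewrite H0.
by rewrite derive_cst.
Qed.

Lemma gderiv_parity p f df : gderiv f df ->
  (forall t, has_parity p (f t)) -> forall t, has_parity p (df t).
Proof.
move=> Hf Hp t I nz; apply/eqP; apply: contraNT nz => oI.
apply/eqP/(gderiv_mcoeff0 Hf) => u; apply/eqP; apply: contraNT oI.
by move=> /Hp ->.
Qed.

Definition gcontinuous f := forall I, continuous (fun t => mcoeff I (f t)).

Lemma gderiv_continuous f df : gderiv f df -> gcontinuous f.
Proof.
move=> Hf I t; apply: differentiable_continuous; apply/derivable1_diffP.
by have [] := Hf I t.
Qed.

Lemma gcontinuousD f g : gcontinuous f -> gcontinuous g ->
  gcontinuous (fun t => f t + g t).
Proof.
move=> Hf Hg I t; rewrite (_ : (fun t => _) =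
  fun t => mcoeff I (f t) + mcoeff I (g t)); last by apply/funext => u; rewrite mcoeffD.
by apply: continuousD; [exact: Hf | exact: Hg].
Qed.

Lemma gcontinuousZ (c : R) f : gcontinuous f -> gcontinuous (fun t => c *: f t).
Proof.
move=> Hf I t; rewrite (_ : (fun t => _) =
  fun t => c * mcoeff I (f t)); last by apply/funext => u; rewrite mcoeffZ.
by apply: continuousM; [exact: cst_continuous | exact: Hf].
Qed.

Lemma gcontinuousM f g : gcontinuous f -> gcontinuous g ->
  gcontinuous (fun t => f t * g t).
Proof.
move=> Hf Hg I; rewrite (_ : (fun t => _) = fun t => \sum_(J <- fpowerset I)
   gsign J (I `\` J)%fset * (mcoeff J (f t) * mcoeff (I `\` J)%fset (g t))); last first.
  by apply/funext => u; rewrite mcoeffM.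
elim: (enum_fset (fpowerset I)) => [|J r IH] t.
  rewrite (_ : (fun t => _) = fun=> 0); last by apply/funext => u; rewrite big_nil.
  exact: cst_continuous.
rewrite (_ : (fun t => _) = fun t => gsign J (I `\` J)%fset *
    (mcoeff J (f t) * mcoeff (I `\` J)%fset (g t)) + \sum_(J <- r)
   gsign J (I `\` J)%fset * (mcoeff J (f t) * mcoeff (I `\` J)%fset (g t))); last first.
  by apply/funext => u; rewrite big_cons.
have H1 : {for t, continuous (fun t => gsign J (I `\` J)%fset *
    (mcoeff J (f t) * mcoeff (I `\` J)%fset (g t)))}.
  apply: continuousM; first exact: cst_continuous.
  by apply: continuousM; [exact: Hf | exact: Hg].
exact: continuousD H1 (IH t).
Qed.

End Derivative.

(** * The exponential of super numbers: derivative, injectivity, surjectivity *)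

Section Exponential.
Variable R : realType.
Implicit Types (a b c u : superR R) (t : R).

Lemma body_soul_mulZ (x e : R) (z nu : superR R) :
  (x * e) *: z + e *: (nu * z) = (x%:A + nu) * (e *: z).
Proof. by rewrite mulrDl mulr_algl scalerA scalerAr. Qed.

(** The real variable enters through [expR (t * x)] and through a polynomial in the soul of [a]. The
    truncation order is that of [a], the same for all [t], whereas the one of [t *: a] drops at
    [t = 0] as soon as the generators disappear. *)
Lemma gderiv_gexp a :
  gderiv (fun t => gexp (t *: a)) (fun t => a * gexp (t *: a)).
Proof.
set n := nil_order a; set x := body a; set nu := soul a.
have n0 : nu ^+ n = 0 by exact: soul_nilp.
pose s t : superR R := \sum_(k < n) (t ^+ k / k`!%:R) *: nu ^+ k.
have E t : gexp (t *: a) = expR (t * x) *: s t.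
  have n0' : soul (t *: a) ^+ n = 0 by rewrite soulZ exprZn n0 scaler0.
  rewrite (gexpE n0') bodyZ /s; apply: congr1; apply: eq_bigr => k _.
  by rewrite soulZ exprZn scalerA mulrC.
have ds : gderiv s (fun t => nu * s t).
  pose dc (k : nat) t := t ^+ k.-1 / (k.-1)`!%:R *+ (0 < k)%N.
  have := gderiv_sum (index_enum 'I_n)
    (F := fun k t => (t ^+ k / k`!%:R) *: nu ^+ k)
    (dF := fun k t => dc k t *: nu ^+ k).
  move=> H; apply: (gderiv_eq (H _)).
    move=> k I t; rewrite mcoeffZ.
    have dX := is_deriveX k (is_derive_id t (1 : R)); rewrite exprfctE in dX.
    have D := is_deriveZ (mcoeff I (nu ^+ k) / k`!%:R) dX.
    rewrite /GRing.scale /= in D; apply: (is_derive_eq (f' :=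
       mcoeff I (nu ^+ k) / k`!%:R * (k%:R * t ^+ k.-1 * 1))).
      move: D; congr is_derive; apply/funext => v /=.
      by rewrite mcoeffZ /GRing.scale /=; ring.
    have X (m : nat) (y : R) : y / m`!%:R * (m%:R * t ^+ m.-1 * 1) = dc m t * y.
      case: m => [|m]; rewrite /dc /=; first by rewrite mulr0n !mul0r mulr0.
      rewrite mulr1n factS natrM; field.
      by rewrite nat1r !pnatr_eq0 /= -lt0n fact_gt0.
    exact: X.
  by move=> t; rewrite (mulr_nilp_sum (fun k => t ^+ k / k`!%:R) n0).
have dexp t : is_derive t (1 : R) (fun t => expR (t * x)) (x * expR (t * x)).
  have dm : is_derive t (1 : R) (fun t => t * x) x.
    have := is_deriveZ x (is_derive_id t (1 : R)); rewrite /GRing.scale /= mulr1.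
    by congr is_derive; apply/funext => v /=; rewrite mulrC.
  rewrite mulrC.
  exact: (is_derive1_comp (f := expR) (g := fun t : R => t * x) (is_derive_expR (t * x)) dm).
have := gderivS dexp ds.
move=> D; apply: (gderiv_eq (eq_gderiv D _)) => t; rewrite ?E //.
have X (e : R) (z : superR R) : (x * e) *: z + e *: (nu * z) = a * (e *: z).
  transitivity ((x%:A + nu) * (e *: z)); last by rewrite -soulE.
  exact: body_soul_mulZ.
exact: X.
Qed.

Lemma even_gexp a : is_even a -> is_even (gexp a).
Proof. exact: even_taylor. Qed.

Lemma body_gexp a : body (gexp a) = expR (body a).
Proof. exact: body_taylor. Qed.

Lemma gexp_alg (x : R) : gexp (x%:A : superR R) = (expR x)%:A.
Proof.
have n0 : soul (x%:A : superR R) ^+ 1 = 0 by rewrite soul_alg expr1.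
rewrite (gexpE n0) body_alg big_ord_recl big_ord0 addr0 expr0 fact0 invr1.
by rewrite scale1r.
Qed.

Lemma gexp0 : gexp (0 : superR R) = 1.
Proof. by rewrite -(scale0r 1) gexp_alg expR0 scale1r. Qed.

Lemma gexpV a : is_even a -> gexp a * gexp (- a) = 1.
Proof.
move=> Ha; pose f t := gexp (t *: a) * gexp (t *: (- a)).
have df : gderiv f (fun _ => 0).
  apply: (gderiv_eq (gderivM (gderiv_gexp a) (gderiv_gexp (- a)))) => t.
  rewrite mulNr mulrN [gexp (t *: a) * (a * _)]mulrA.
  by rewrite -(even_comm (gexp (t *: a)) Ha) subrr.
have := gderiv0_cst 1 0 df; rewrite /f !scale1r !scale0r => ->.
by rewrite gexp0 mul1r.
Qed.

Lemma gexpVl a : is_even a -> gexp (- a) * gexp a = 1.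
Proof. by move=> Ha; rewrite -{2}[a]opprK gexpV //; exact: evenN. Qed.

(* Uniqueness for the linear equation [f' = a f]: [exp (- t a) f] is constant. *)
Lemma gderiv_linear a f : is_even a -> gderiv f (fun t => a * f t) ->
  forall t, f t = gexp (t *: a) * f 0.
Proof.
move=> Ha Hf t; pose h t := gexp (t *: (- a)) * f t.
have dh : gderiv h (fun _ => 0).
  apply: (gderiv_eq (gderivM (gderiv_gexp (- a)) Hf)) => v.
  by rewrite mulrA -(even_comm (gexp _) Ha) mulNr mulNr addNr.
have := gderiv0_cst t 0 dh; rewrite /h scale0r gexp0 mul1r => <-.
rewrite mulrA scalerN gexpV ?mul1r //; exact: evenZ.
Qed.

Lemma gexpD a b : is_even a -> is_even b -> gexp (a + b) = gexp a * gexp b.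
Proof.
move=> Ha Hb; pose f t := gexp (t *: a) * gexp (t *: b).
have df : gderiv f (fun t => (a + b) * f t).
  apply: (gderiv_eq (gderivM (gderiv_gexp a) (gderiv_gexp b))) => t.
  have X (A B : superR R) : a * A * B + A * (b * B) = (a + b) * (A * B).
    rewrite mulrDl [a * (_ * _)]mulrA [b * (_ * _)]mulrA (even_comm A Hb).
    by rewrite [A * (b * B)]mulrA.
  exact: X.
have := gderiv_linear (evenD Ha Hb) df 1; rewrite /f !scale1r !scale0r.
by rewrite gexp0 !mulr1.
Qed.

Lemma gexp_neq0 a : body (gexp a) != 0.
Proof. by rewrite body_gexp gt_eqF // expR_gt0. Qed.

Lemma gexp_inj a b : is_even a -> is_even b -> gexp a = gexp b -> a = b.
Proof.
move=> Ha Hb E; apply/eqP; rewrite -subr_eq0; apply/eqP; set c := a - b.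
have Hc : is_even c by exact: evenB.
have E1 : gexp c = 1 by rewrite gexpD ?E ?gexpV //; exact: evenN.
have c0 : body c = 0 by apply: expR_inj; rewrite -body_gexp E1 body1 expR0.
have sc : soul c = c by exact: soul_body0.
pose n := nil_order c.
have n0 : soul c ^+ n.+1 = 0 by apply: soul_nilp; rewrite leqW.
move: E1; rewrite (gexpE n0) c0 expR0 scale1r big_ord_recl sc expr0 fact0.
rewrite invr1 scale1r -{2}[1]addr0 => /addrI.
(* Once [c] has no body, [gexp c - 1] equals [c * r] with [r] of body 1, hence invertible; so
   [gexp c = 1] forces [c = 0]. *)
pose r : superR R := \sum_(k < n) (k.+1)`!%:R^-1 *: c ^+ k.
have -> : \sum_(i < n) (lift ord0 i)`!%:R^-1 *: c ^+ lift ord0 i = c * r.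
  rewrite mulr_sumr; apply: eq_bigr => k _.
  by rewrite -scalerAr -exprS.
have Hr : is_even r by apply: even_sum => k; apply: evenZ; exact: evenX.
have r0 : body r != 0.
  have -> : body r = 1%:R^-1 by exact: (body_nilp_sum (fun k => (k.+1)`!%:R^-1)).
  by rewrite invr1 oner_eq0.
by move=> cr; rewrite -[c]mulr1 -(ginvM Hr r0) mulrA cr mul0r.
Qed.

(** Second-order expansion with the remainder kept inside the same finite set of generators, so that
    the degree count of the iteration below applies to it. *)
Lemma gexpN_small S n nu : supported n.+1 S nu ->
  exists r : superR R, supported 0 S r /\ gexp (- nu) = 1 - nu + nu * nu * r.
Proof.
move=> Hnu; pose m := #|` S|.+1.
have Hnu1 : supported 1 S nu by exact: supportedW Hnu.
have nu0 : body (- nu) = 0.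
  apply/eqP; apply: contraTT isT; rewrite bodyN oppr_eq0 => /Hnu.
  by rewrite cardfs0.
have m0 : soul (- nu) ^+ m.+2 = 0.
  rewrite (soul_body0 nu0); apply: (supported_nilp (S := S)).
    exact: supportedN.
  by rewrite /m ltnS leqW.
exists (\sum_(k < m) (k.+2)`!%:R^-1 *: (- nu) ^+ k); split.
  apply: supported_sum => k; apply: supportedZ; rewrite -[0%N](muln0 k).
  by apply/supportedX/supportedN; exact: supportedW Hnu1.
rewrite (gexpE m0) nu0 expR0 scale1r (soul_body0 nu0) 2!big_ord_recl addrA.
rewrite !fact0 expr0 invr1 expr1 !scale1r; congr (_ + _).
rewrite mulr_sumr; apply: eq_bigr => k _.
by rewrite -[nu * nu]mulrNN -scalerAr -mulrA -!exprS.
Qed.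

(* Newton iteration [a := a + nu] with [nu = u exp(-a) - 1], which at least
   doubles the degree of the error. *)
Lemma gexp_surj u : is_even u -> 0 < body u ->
  exists2 a, is_even a & gexp a = u.
Proof.
move=> Hu u0; pose S := generators u.
have /(_ #|` S|) [a [Ha _ Hsup]] : forall n, exists a, [/\ is_even a, supported 0 S a &
    supported n.+1 S (u * gexp (- a) - 1)].
  elim=> [|n [a [Ha Hsa Hs]]].
    exists (ln (body u))%:A; split; [exact: evenA | exact: supported_alg |].
    rewrite -scaleNr gexp_alg expRN lnK //.
    apply: supported_body0.
      apply: supportedD; last by apply/supportedN/supported1.
      apply: (supportedM (n := 0) (m := 0)); last exact: supported_alg.
      exact: supported_generators.
    by rewrite bodyB bodyM body_alg body1 divff ?subrr // gt_eqF.
  set nu := u * gexp (- a) - 1 in Hs.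
  have Hnu : is_even nu.
    apply: evenB; last exact: even1.
    by apply: evenM => //; apply: even_gexp; exact: evenN.
  have [r [Hr Er]] := gexpN_small Hs.
  exists (a + nu); split; first exact: evenD.
    by apply: supportedD => //; exact: supportedW Hs.
  rewrite opprD gexpD ?mulrA; [|exact: evenN|exact: evenN].
  have -> : u * gexp (- a) = 1 + nu by rewrite /nu addrC subrK.
  rewrite Er; clearbody nu.
  have -> : (1 + nu) * (1 - nu + nu * nu * r) - 1 =
            nu * nu * ((1 + nu) * r - 1).
    rewrite mulrDr [(1 + nu) * (1 - nu)](_ : _ = 1 - nu * nu); last first.
      by rewrite mulrDl mul1r mulrDr mulr1 mulrN addrA subrK.
    rewrite addrAC [1 - _ - 1]addrAC subrr sub0r addrC mulrBr mulr1.
    have H1 : is_even (1 + nu) by apply: evenD => //; exact: even1.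
    have X : (1 + nu) * (nu * nu * r) = nu * nu * ((1 + nu) * r).
      by rewrite mulrA (even_comm (nu * nu) H1) -mulrA.
    by rewrite X.
  apply: (@supportedW _ _ (n.+1 + n.+1 + 0)); first by rewrite addn0 addSnnS leq_addl.
  apply: supportedM; first exact: supportedM.
  apply: supportedD; last by apply/supportedN/supported1.
  apply: (supportedM (n := 0) (m := 0)) => //.
  apply: supportedD; first exact: supported1.
  by apply: supportedW Hs.
exists a => //; have /eqP := supported_eq0 (ltnSn _) Hsup.
by rewrite subr_eq0 => /eqP E; rewrite -[gexp a]mul1r -E -mulrA gexpVl // mulr1.
Qed.

End Exponential.

(** * Products of truncated power series *)

Section CauchyProduct.
Context {K : comNzRingType}.
Implicit Types (nu : grassmann K) (c d : nat -> K).

Lemma horner_alg_poly c nu n :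
  horner_alg nu (\poly_(i < n) c i) = \sum_(i < n) c i *: nu ^+ i.
Proof.
rewrite poly_def raddf_sum; apply: eq_bigr => i _.
rewrite -mul_polyC [LHS](rmorphM (horner_alg nu)) /= horner_algC mulr_algl.
by rewrite (rmorphXn (horner_alg nu)) /= horner_algX.
Qed.

(** Both sums are values at [nu] of polynomials over the commutative ring [K], so the product is
    computed in [{poly K}] and the degrees from [n] on are then dropped. *)
Lemma nilp_sumM c d nu n : nu ^+ n = 0 ->
  (\sum_(i < n) c i *: nu ^+ i) * (\sum_(i < n) d i *: nu ^+ i) =
  \sum_(m < n) (\sum_(i < m.+1) c i * d (m - i)%N) *: nu ^+ m.
Proof.
move=> n0; rewrite -(horner_alg_poly c nu n) -(horner_alg_poly d nu n) -rmorphM.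
set p := _ * _ : {poly K}; pose N := maxn (size p) n.
have -> : p = \poly_(m < N) p`_m.
  apply/polyP => i; rewrite coef_poly; case: ltnP => // Ni.
  by rewrite nth_default // (leq_trans (leq_maxl _ _) Ni).
rewrite [LHS](horner_alg_poly (fun m => p`_m) nu N).
have N0 : nu ^+ N = 0 by apply: nilp_leq n0; exact: leq_maxr.
rewrite (nilp_sum_widen (f := fun k x => p`_k *: x) (fun k => scaler0 _ _) N0 n0).
apply: eq_bigr => m _; apply: (congr1 ( *:%R^~ _)).
rewrite coefM; apply: eq_bigr => i _; rewrite !coef_poly.
rewrite (leq_trans (ltn_ord i) (ltn_ord m)).
by rewrite (leq_ltn_trans (leq_subr _ _) (ltn_ord m)).
Qed.

End CauchyProduct.

(** * Square roots and cancellation by invertible even numbers *)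

Section SquareRoot.
Variable R : realType.
Implicit Types (a b c : superR R).
Local Open Scope classical_set_scope.

(* The coefficients of the Taylor series of [sqrt (1 + x)]. *)
Fixpoint binom_half (k : nat) : R :=
  if k is k'.+1 then binom_half k' * (2^-1 - k'%:R) / k%:R else 1.

Lemma binom_halfS k :
  k.+1%:R * binom_half k.+1 = binom_half k * (2^-1 - k%:R).
Proof. by rewrite /= mulrC divfK // pnatr_eq0. Qed.

(** Coefficient form of the fact that the square [q] of the series is [1 + x]. The recurrence for
    [binom_half] gives [(k + 1) q_(k+1) = (1 - k) q_k], that is [(1 + x) q' = q]; the factor [1 - k]
    kills [q_2], and with it everything beyond. *)
Lemma binom_half_conv m :
  \sum_(i < m.+1) binom_half i * binom_half (m - i) = (m <= 1)%:R.
Proof.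
pose q m := \sum_(i < m.+1) binom_half i * binom_half (m - i).
rewrite -/(q m).
have qS k : k.+1%:R * q k.+1 = (1 - k%:R) * q k.
  have E1 (i : 'I_k.+2) : k.+1%:R = i%:R + (k.+1 - i)%:R :> R.
    by rewrite -natrD subnKC // -ltnS ltn_ord.
  pose A := \sum_(i < k.+2) (i%:R * binom_half i) * binom_half (k.+1 - i).
  pose B := \sum_(i < k.+2) binom_half i * ((k.+1 - i)%:R * binom_half (k.+1 - i)).
  have -> : k.+1%:R * q k.+1 = A + B.
    rewrite /A /B -big_split mulr_sumr /=; apply: eq_bigr => i _.
    by rewrite (E1 i); ring.
  have -> : A = \sum_(i < k.+1) (binom_half i * (2^-1 - i%:R)) * binom_half (k - i).
    rewrite /A big_ord_recl mul0r mul0r add0r; apply: eq_bigr => i _.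
    by rewrite -binom_halfS.
  have -> : B = \sum_(i < k.+1) binom_half i * (binom_half (k - i) * (2^-1 - (k - i)%:R)).
    rewrite /B big_ord_recr /= subnn mul0r mulr0 addr0; apply: eq_bigr => i _.
    by rewrite subSn ?binom_halfS // -ltnS ltn_ord.
  rewrite /q mulr_sumr -big_split /=; apply: eq_bigr => i _.
  have ik : (i <= k)%N by rewrite -ltnS ltn_ord.
  by rewrite natrB //; field.
have q0 : q 0%N = 1 by rewrite /q big_ord1 mulr1.
have q1 : q 1%N = 1 by have := qS 0%N; rewrite q0 !mul1r subr0 mulr1.
case: m => [|[|m]] //.
elim: m => [|m IH].
  have := qS 1%N; rewrite subrr mul0r => /eqP; rewrite mulf_eq0 pnatr_eq0 /=.
  by move=> /eqP.
by have := qS m.+2; rewrite IH mulr0 => /eqP; rewrite mulf_eq0 pnatr_eq0 /= => /eqP.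
Qed.

Lemma gsqrtE a n : 0 < body a -> soul a ^+ n = 0 ->
  gsqrt a = Num.sqrt (body a) *:
    \sum_(k < n) binom_half k *: ((body a)^-1 *: soul a) ^+ k.
Proof.
move=> a0 n0.
(* The k-th derivative of the square root, with the power [1/2 - k] written as a square root over an
   integer power. *)
pose g (k : nat) (x : R) : R := k`!%:R * binom_half k * (Num.sqrt x * (x ^+ k)^-1).
have jg : jet_on [set x : R | 0 < x] g.
  move=> k y y0; rewrite /mkset in y0.
  have y0' : y != 0 by rewrite gt_eqF.
  have dX : is_derive y (1 : R) (fun x : R => x ^+ k) (k%:R * y ^+ k.-1).
    have H := is_deriveX k (is_derive_id y (1 : R)); rewrite exprfctE in H.
    by apply: is_derive_eq H _; rewrite [LHS]mulr1.
  have dV := is_deriveV (f := fun x : R => x ^+ k) (expf_neq0 k y0') dX.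
  have H := is_deriveZ (k`!%:R * binom_half k) (is_deriveM (is_derive1_sqrt y0) dV).
  apply: is_derive_eq H _.
  have s0 : Num.sqrt y != 0 by rewrite gt_eqF // sqrtr_gt0.
  have ss : Num.sqrt y * Num.sqrt y = y by rewrite -expr2 sqr_sqrtr // ltW.
  rewrite /GRing.scale /= /g factS natrM.
  have -> : k.+1%:R * k`!%:R * binom_half k.+1 = k`!%:R * (binom_half k * (2^-1 - k%:R)).
    by rewrite -binom_halfS; ring.
  have -> : (2 * Num.sqrt y)^-1 = Num.sqrt y / (2 * y).
    by rewrite -{3}ss; field.
  case: k {dX dV} => [|k]; first by rewrite /= expr0 expr1; field.
  rewrite [k.+1.-1]/= !exprS; field.
  by rewrite y0' expf_neq0.
rewrite /gsqrt (@taylor_on R [set x | 0 < x] _ g a n _ _ jg) //; last first.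
  by move=> y _; rewrite /g fact0 expr0 invr1 !mul1r mulr1.
rewrite scaler_sumr; apply: eq_bigr => k _.
rewrite exprZn 2!scalerA; apply: (congr1 ( *:%R^~ _)).
rewrite /g exprVn; field.
by rewrite expf_neq0 ?gt_eqF //= pnatr_eq0 -lt0n fact_gt0.
Qed.

Lemma body_gsqrt a : body (gsqrt a) = Num.sqrt (body a).
Proof. exact: body_taylor. Qed.

Lemma even_gsqrt a : is_even a -> is_even (gsqrt a).
Proof. exact: even_taylor. Qed.

Lemma sum_leq1 (A : algType R) (mu : A) n :
  \sum_(m < n.+2) (m <= 1)%:R *: mu ^+ m = 1 + mu.
Proof.
rewrite 2!big_ord_recl big1 => [|k _]; last by rewrite scale0r.
by rewrite addr0 !scale1r expr0 expr1.
Qed.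

Lemma scaleD1V (A : algType R) (x : R) (nu : A) : x != 0 ->
  x *: (1 + x^-1 *: nu) = x%:A + nu.
Proof. by move=> x0; rewrite scalerDr scalerA divff // scale1r. Qed.

Lemma gsqrt_sqr a : 0 < body a -> gsqrt a * gsqrt a = a.
Proof.
move=> a0; pose n := nil_order a; pose mu := (body a)^-1 *: soul a.
have n0 : soul a ^+ n.+2 = 0 by apply: soul_nilp; rewrite 2?leqW.
have m0 : mu ^+ n.+2 = 0 by rewrite /mu exprZn n0 scaler0.
rewrite (gsqrtE a0 n0) -/mu -scalerAl -scalerAr scalerA -expr2 sqr_sqrtr ?ltW //.
rewrite (nilp_sumM binom_half binom_half m0).
rewrite (eq_bigr (fun m : 'I_n.+2 => (m <= 1)%:R *: mu ^+ m)); last first.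
  by move=> m _; rewrite binom_half_conv.
rewrite sum_leq1 /mu scaleD1V ?gt_eqF //.
by rewrite -soulE.
Qed.

Lemma mulrI_body a b c : is_even c -> body c != 0 -> c * a = c * b -> a = b.
Proof.
move=> Hc c0 E; have Vc : ginv c * c = 1 by rewrite -even_comm ?ginvM.
by rewrite -[a]mul1r -Vc -mulrA E mulrA Vc mul1r.
Qed.

Lemma mulrDB_comm (A : pzRingType) (x y : A) :
  x * y = y * x -> x * x = y * y -> (x + y) * (x - y) = 0.
Proof. by move=> E Exy; rewrite mulrDl !mulrBr Exy E addrA subrK subrr. Qed.

(** [(a + b) (a - b) = 0], and the first factor is invertible because its body is positive. *)
Lemma sqr_inj_body a b : is_even a -> is_even b ->
  0 < body a -> 0 < body b -> a * a = b * b -> a = b.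
Proof.
move=> Ha Hb a0 b0 E; apply/eqP; rewrite -subr_eq0; apply/eqP.
apply: (mulrI_body (c := a + b)); first exact: evenD.
  by rewrite bodyD gt_eqF // addr_gt0.
rewrite mulr0; exact: (mulrDB_comm (even_comm b Ha) E).
Qed.

Lemma ginv_unique a b : is_even a -> body a != 0 -> a * b = 1 -> ginv a = b.
Proof.
by move=> Ha a0 E; apply: (mulrI_body Ha a0); rewrite ginvM // E.
Qed.

Lemma even_ginv a : is_even a -> is_even (ginv a).
Proof. exact: even_taylor. Qed.

Lemma body_ginv a : body (ginv a) = (body a)^-1.
Proof. exact: body_taylor. Qed.

Lemma ginv_gexp a : is_even a -> ginv (gexp a) = gexp (- a).
Proof.
move=> Ha; apply: ginv_unique; [exact: even_gexp | exact: gexp_neq0 | exact: gexpV].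
Qed.

End SquareRoot.

(** * Real and imaginary parts of complex super numbers *)

Section MapCoeff.
Variables (K L : comNzRingType) (f : K -> L).

Lemma mcoeff_map I (a : grassmann K) : f 0 = 0 ->
  mcoeff I (map_coeff f a) = f (mcoeff I a).
Proof.
move=> f0; rewrite mcoeffE; case: ifP => // /negbT /mcoeff_outdom ->.
by rewrite f0.
Qed.

End MapCoeff.

Section ComplexParts.
Variable R : realType.
Implicit Types (z w : superC R) (a : superR R) (I : {fset nat}).

Lemma mcoeff_gRe I z : mcoeff I (gRe z) = complex.Re (mcoeff I z).
Proof. exact: mcoeff_map. Qed.

Lemma mcoeff_gIm I z : mcoeff I (gIm z) = complex.Im (mcoeff I z).
Proof. exact: mcoeff_map. Qed.

Lemma mcoeff_gconj I z : mcoeff I (gconj z) = conjc (mcoeff I z).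
Proof. by apply: mcoeff_map; rewrite conjc0. Qed.

Lemma mcoeff_gcomplex I a : mcoeff I (gcomplex a) = (mcoeff I a)%:C%C.
Proof. exact: mcoeff_map. Qed.

Lemma gsign_complex I J : gsign I J = (gsign I J : R)%:C%C.
Proof.
by rewrite /gsign; case: ifP => // _; rewrite rmorphXn rmorphN1.
Qed.

Lemma superC_eq z w : gRe z = gRe w -> gIm z = gIm w -> z = w.
Proof.
move=> ERe EIm; apply/malgP => I; apply/eqP; rewrite eq_complex.
by rewrite -!mcoeff_gRe -!mcoeff_gIm ERe EIm !eqxx.
Qed.

Lemma gReD z w : gRe (z + w) = gRe z + gRe w.
Proof. by apply/malgP => I; rewrite mcoeffD !mcoeff_gRe mcoeffD raddfD. Qed.

Lemma gImD z w : gIm (z + w) = gIm z + gIm w.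
Proof. by apply/malgP => I; rewrite mcoeffD !mcoeff_gIm mcoeffD raddfD. Qed.

Lemma gReN z : gRe (- z) = - gRe z.
Proof. by apply/malgP => I; rewrite mcoeffN !mcoeff_gRe mcoeffN raddfN. Qed.

Lemma gRe_conj z : gRe (gconj z) = gRe z.
Proof.
by apply/malgP => I; rewrite !mcoeff_gRe mcoeff_gconj; case: (mcoeff I z).
Qed.

Lemma gIm_conj z : gIm (gconj z) = - gIm z.
Proof.
by apply/malgP => I; rewrite mcoeffN !mcoeff_gIm mcoeff_gconj; case: (mcoeff I z).
Qed.

Lemma gRe_complex a : gRe (gcomplex a) = a.
Proof. by apply/malgP => I; rewrite mcoeff_gRe mcoeff_gcomplex. Qed.

Lemma gIm_complex a : gIm (gcomplex a) = 0.
Proof. by apply/malgP => I; rewrite mcoeff_gIm mcoeff_gcomplex mcoeff0. Qed.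

Lemma gReM z w : gRe (z * w) = gRe z * gRe w - gIm z * gIm w.
Proof.
apply/malgP => I; rewrite mcoeff_gRe mcoeffB (mcoeffM I z) (mcoeffM I (gRe z)).
rewrite (mcoeffM I (gIm z)) -sumrB raddf_sum /=; apply: eq_bigr => J _.
rewrite gsign_complex !mcoeff_gRe !mcoeff_gIm.
case: (mcoeff J z) => a b; case: (mcoeff _ w) => c d /=.
by rewrite mul0r subr0 mulrBr.
Qed.

Lemma gImM z w : gIm (z * w) = gRe z * gIm w + gIm z * gRe w.
Proof.
apply/malgP => I; rewrite mcoeff_gIm mcoeffD (mcoeffM I z) (mcoeffM I (gRe z)).
rewrite (mcoeffM I (gIm z)) -big_split raddf_sum /=; apply: eq_bigr => J _.
rewrite gsign_complex !mcoeff_gRe !mcoeff_gIm.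
case: (mcoeff J z) => a b; case: (mcoeff _ w) => c d /=.
by rewrite mul0r addr0 mulrDr.
Qed.

Lemma gReZi z : gRe ('i%C *: z) = - gIm z.
Proof.
apply/malgP => I; rewrite mcoeffN mcoeff_gRe mcoeff_gIm mcoeffZ.
by case: (mcoeff I z) => a b /=; rewrite mul0r sub0r mul1r.
Qed.

Lemma gImZi z : gIm ('i%C *: z) = gRe z.
Proof.
apply/malgP => I; rewrite mcoeff_gRe mcoeff_gIm mcoeffZ.
by case: (mcoeff I z) => a b /=; rewrite mul0r add0r mul1r.
Qed.

Lemma parity_complex p z :
  has_parity p z <-> has_parity p (gRe z) /\ has_parity p (gIm z).
Proof.
split=> [H|[HRe HIm] I].
  split=> I nz; apply: H; apply: contraNneq nz => E.
    by rewrite mcoeff_gRe E.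
  by rewrite mcoeff_gIm E.
rewrite eq_complex negb_and -mcoeff_gRe -mcoeff_gIm /=.
by case/orP => [/HRe|/HIm].
Qed.

Lemma is_realE z : is_real z <-> gIm z = 0.
Proof.
split=> [E|E].
  apply/malgP => I; have : - mcoeff I (gIm z) = mcoeff I (gIm z).
    by rewrite -{2}E gIm_conj mcoeffN.
  by rewrite mcoeff0; lra.
by apply: superC_eq; rewrite ?gRe_conj // gIm_conj E oppr0.
Qed.

End ComplexParts.

(** * Real coordinates on the ambient superspace *)

Section Coordinates.
Variable R : realType.
Implicit Types (X Y Z : superspace R) (a : superR R) (i : nat).

(* Real coordinates, in the order
   x_1, x_2, Re x, Im x, Re phi, Im phi, Re psi, Im psi. *)
Definition crd X i : superR R :=
  nth 0 [:: x1 X; x2 X; gRe (xc X); gIm (xc X); gRe (phi X); gIm (phi X);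
            gRe (psi X); gIm (psi X)] i.

Definition svec (c : nat -> superR R) : superspace R :=
  (c 0%N, c 1%N, gcomplex (c 2%N) + 'i%C *: gcomplex (c 3%N),
   gcomplex (c 4%N) + 'i%C *: gcomplex (c 5%N),
   gcomplex (c 6%N) + 'i%C *: gcomplex (c 7%N)).

Lemma crd_svec c i : (i < 8)%N -> crd (svec c) i = c i.
Proof.
case: i => [|[|[|[|[|[|[|[|//]]]]]]]] _ //;
by rewrite /crd /= ?gReD ?gImD ?gReZi ?gImZi ?gIm_complex ?gRe_complex
  ?oppr0 ?addr0 ?add0r.
Qed.

Lemma crd_default X i : (8 <= i)%N -> crd X i = 0.
Proof. by move=> ?; rewrite /crd nth_default. Qed.

Lemma crdP X Y : (forall i, (i < 8)%N -> crd X i = crd Y i) -> X = Y.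
Proof.
move=> E.
have E1 : x1 X = x1 Y := E 0%N isT.
have E2 : x2 X = x2 Y := E 1%N isT.
have E3 : xc X = xc Y := superC_eq (E 2%N isT) (E 3%N isT).
have E4 : phi X = phi Y := superC_eq (E 4%N isT) (E 5%N isT).
have E5 : psi X = psi Y := superC_eq (E 6%N isT) (E 7%N isT).
case: X Y E1 E2 E3 E4 E5 {E} => [[[[a b] c] d] e] [[[[a' b'] c'] d'] e'].
by rewrite /x1 /x2 /xc /phi /psi /= => -> -> -> -> ->.
Qed.

Lemma crdD X Y i : crd (X + Y) i = crd X i + crd Y i.
Proof.
have [i8|i8] := ltnP i 8; last by rewrite !crd_default // addr0.
by case: i i8 => [|[|[|[|[|[|[|[|//]]]]]]]] _; rewrite /crd /= ?gReD ?gImD.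
Qed.

Lemma gRe_complexM a z : gRe (gcomplex a * z) = a * gRe z.
Proof. by rewrite gReM gRe_complex gIm_complex mul0r subr0. Qed.

Lemma gIm_complexM a z : gIm (gcomplex a * z) = a * gIm z.
Proof. by rewrite gImM gRe_complex gIm_complex mul0r addr0. Qed.

Lemma crdZ a X i : crd (sscale a X) i = a * crd X i.
Proof.
have [i8|i8] := ltnP i 8; last by rewrite !crd_default // mulr0.
by case: i i8 => [|[|[|[|[|[|[|[|//]]]]]]]] _;
  rewrite /crd /= ?gRe_complexM ?gIm_complexM.
Qed.

Lemma crd0 i : crd 0 i = 0.
Proof.
have := crdD 0 0 i; rewrite addr0 -{1}[crd 0 i]addr0 => /addrI E.
by rewrite -E.
Qed.

Lemma crd_sum (T : Type) (r : seq T) (F : T -> superspace R) i :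
  crd (\sum_(j <- r) F j) i = \sum_(j <- r) crd (F j) i.
Proof.
elim: r => [|j r IH]; first by rewrite !big_nil crd0.
by rewrite !big_cons crdD IH.
Qed.

Definition graded X := forall i, (i < 8)%N -> has_parity (3 < i)%N (crd X i).

Lemma gradedP X :
  [/\ is_even (x1 X), is_even (x2 X), is_even (xc X),
      is_odd (phi X) & is_odd (psi X)] <-> graded X.
Proof.
split=> [[/is_evenE H1 /is_evenE H2 /is_evenE/parity_complex[H3 H4]
    /is_oddE/parity_complex[H5 H6] /is_oddE/parity_complex[H7 H8]]|H].
  by case=> [|[|[|[|[|[|[|[|//]]]]]]]] _.
split; try apply/is_evenE; try apply/is_oddE.
- exact: (H 0%N isT).
- exact: (H 1%N isT).
- by apply/parity_complex; split; [exact: (H 2%N isT) | exact: (H 3%N isT)].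
- by apply/parity_complex; split; [exact: (H 4%N isT) | exact: (H 5%N isT)].
- by apply/parity_complex; split; [exact: (H 6%N isT) | exact: (H 7%N isT)].
Qed.

(** The axes of [Im x], [Im phi] and [Im psi]: their vanishing cuts out the real subspace used for
    [H2], so both dimensions are treated together. *)
Definition imag_axis i := (i == 3)%N || (i == 5)%N || (i == 7)%N.

Lemma ambientP h X : ambient h X <->
  graded X /\ (h = H2 -> forall i, imag_axis i -> crd X i = 0).
Proof.
rewrite /ambient gradedP; split=> -[gX rX]; split=> // /rX.
  by case=> /is_realE ? /is_realE ? /is_realE ? i /orP[/orP[]|] /eqP ->.
by move=> H; split; apply/is_realE; [exact: (H 3%N)|exact: (H 5%N)|exact: (H 7%N)].
Qed.

Lemma gradedD X Y : graded X -> graded Y -> graded (X + Y).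
Proof. by move=> HX HY i i8; rewrite crdD; apply: parityD; [exact: HX|exact: HY]. Qed.

Lemma gradedZ a X : is_even a -> graded X -> graded (sscale a X).
Proof.
move=> /is_evenE Ha HX i i8; rewrite crdZ -[(3 < i)%N]addFb.
by apply: parityM => //; exact: HX.
Qed.

Lemma ambient_graded h X : ambient h X -> graded X.
Proof. by case/ambientP. Qed.

Lemma ambientD h X Y : ambient h X -> ambient h Y -> ambient h (X + Y).
Proof.
move=> /ambientP[gX rX] /ambientP[gY rY]; apply/ambientP; split.
  exact: gradedD.
by move=> h2 i Hi; rewrite crdD rX // rY // addr0.
Qed.

Lemma ambientZ h a X : is_even a -> ambient h X -> ambient h (sscale a X).
Proof.
move=> Ha /ambientP[gX rX]; apply/ambientP; split; first exact: gradedZ.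
by move=> h2 i Hi; rewrite crdZ rX // mulr0.
Qed.

Lemma sscaleA a b X : sscale a (sscale b X) = sscale (a * b) X.
Proof. by apply: crdP => i _; rewrite [LHS]crdZ [RHS]crdZ [X in a * X = _]crdZ [LHS]mulrA. Qed.

Lemma sscale1 X : sscale 1 X = X.
Proof. by apply: crdP => i _; rewrite crdZ mul1r. Qed.

Lemma sscale0 X : sscale 0 X = 0.
Proof. by apply: crdP => i _; rewrite crdZ mul0r crd0. Qed.

Lemma sderivP (X X' : R -> superspace R) : sderiv X X' <->
  forall i, (i < 8)%N -> gderiv (fun t => crd (X t) i) (fun t => crd (X' t) i).
Proof.
split=> [[H1 H2 [H3 H4] [H5 H6] [H7 H8]]|H].
  by case=> [|[|[|[|[|[|[|[|//]]]]]]]] _.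
split; [exact: (H 0%N isT) | exact: (H 1%N isT) | split | split | split].
- exact: (H 2%N isT).
- exact: (H 3%N isT).
- exact: (H 4%N isT).
- exact: (H 5%N isT).
- exact: (H 6%N isT).
- exact: (H 7%N isT).
Qed.

Lemma sderiv_graded (X X' : R -> superspace R) : sderiv X X' ->
  (forall t, graded (X t)) -> forall t, graded (X' t).
Proof.
move=> /sderivP dX gX t i i8; apply: (gderiv_parity (dX i i8)) => u.
exact: gX.
Qed.

Lemma sderiv_ambient h (X X' : R -> superspace R) : sderiv X X' ->
  (forall t, ambient h (X t)) -> forall t, ambient h (X' t).
Proof.
move=> dX aX t; apply/ambientP; split.
  by apply: (sderiv_graded dX) => u; have /ambientP[] := aX u.
move=> h2 i Hi; have i8 : (i < 8)%N by move: Hi => /orP[/orP[]|] /eqP ->.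
move/sderivP: dX => /(_ i i8) dX; apply/malgP => I; rewrite mcoeff0.
apply: (gderiv_mcoeff0 dX) => u; have /ambientP[_ rX] := aX u.
by rewrite (rX h2 i Hi) mcoeff0.
Qed.

End Coordinates.

(** * The bilinear form in real coordinates *)

Section Form.
Variable R : realType.
Implicit Types (X Y Z : superspace R) (a : superR R) (i : nat).

(** The form pairs [x_1] with [x_2], each part of [x] with itself, and each part of [phi] with the
    same part of [psi]. *)
Definition dual_axis i := nth 0%N [:: 1; 0; 2; 3; 6; 7; 4; 5]%N i.

(** These are the weights once the coordinate of the first argument stands on the left. On odd axes
    that reordering costs a sign, hence opposite weights on paired odd axes. *)
Definition form_weight i : R := nth 0 [:: 2^-1; 2^-1; -1; -1; 1; -1; -1; 1] i.

Definition axis_parity i : bool := (3 < i)%N.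

Lemma dual_axis_lt i : (i < 8)%N -> (dual_axis i < 8)%N.
Proof. by case: i => [|[|[|[|[|[|[|[|//]]]]]]]]. Qed.

Lemma dual_axisK i : (i < 8)%N -> dual_axis (dual_axis i) = i.
Proof. by case: i => [|[|[|[|[|[|[|[|//]]]]]]]]. Qed.

Lemma axis_parity_dual i : (i < 8)%N -> axis_parity (dual_axis i) = axis_parity i.
Proof. by case: i => [|[|[|[|[|[|[|[|//]]]]]]]]. Qed.

Lemma imag_axis_dual i : (i < 8)%N -> imag_axis (dual_axis i) = imag_axis i.
Proof. by case: i => [|[|[|[|[|[|[|[|//]]]]]]]]. Qed.

Lemma form_weight_dual i : (i < 8)%N ->
  form_weight (dual_axis i) = (-1) ^+ axis_parity i * form_weight i.
Proof.
by case: i => [|[|[|[|[|[|[|[|//]]]]]]]] _;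
   rewrite /form_weight /= ?expr0 ?expr1 ?mulN1r ?mul1r ?opprK.
Qed.

Lemma form_weight_neq0 i : (i < 8)%N -> form_weight i != 0.
Proof.
by case: i => [|[|[|[|[|[|[|[|//]]]]]]]] _;
   rewrite /form_weight /= ?oppr_eq0 ?oner_eq0 ?invr_eq0 ?pnatr_eq0.
Qed.

Lemma gReM_conj (z w : superC R) :
  gRe (z * gconj w + gconj z * w) =
  2 *: (gRe z * gRe w + gIm z * gIm w) :> superR R.
Proof.
rewrite gReD 2!{1}gReM 2!{1}gRe_conj 2!{1}gIm_conj {1}mulrN {1}mulNr !opprK.
by rewrite scaler_nat mulr2n.
Qed.

Lemma gReM_conj2 (z w : superC R) :
  gRe (gconj z * gconj w) = gRe (z * w).
Proof. by rewrite 2!{1}gReM 2!{1}gRe_conj 2!{1}gIm_conj {1}mulrNN. Qed.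

Lemma form_halves (V : lmodType R) (u v s p q : V) :
  2^-1 *: (u + v + (- (2 *: s) + p + q + p + q)) = 2^-1 *: (u + v) - s + p + q.
Proof.
have two (w : V) : 2^-1 *: (w + w) = w.
  by rewrite -mulr2n -(scaler_nat 2 w) scalerA mulVf ?pnatr_eq0 // scale1r.
have -> : - (2 *: s) + p + q + p + q = - (2 *: s) + ((p + q) + (p + q)).
  by rewrite -!addrA.
rewrite (scalerDr _ (u + v)) (scalerDr _ (- (2 *: s))) two scalerN scalerA.
by rewrite mulVf ?pnatr_eq0 // scale1r !addrA.
Qed.

Lemma sum_weights (V : lmodType R) (a b c d p q r s : V) :
  2^-1 *: (a + b) - (c + d) + (p - q) + (- r + s) =
  \sum_(i < 8) form_weight i *: nth 0 [:: a; b; c; d; p; q; r; s] i.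
Proof.
rewrite 8!big_ord_recl big_ord0 addr0 /form_weight /=.
by rewrite scalerDr !scaleN1r !scale1r opprD -!addrA.
Qed.

Lemma gRe_form (z w a b c d : superC R) :
  gRe (- (z * gconj w + gconj z * w) + a * d + c * b
       + gconj a * gconj d + gconj c * gconj b) =
  - (2 *: (gRe z * gRe w + gIm z * gIm w))
  + (gRe a * gRe d - gIm a * gIm d) + (gRe c * gRe b - gIm c * gIm b)
  + (gRe a * gRe d - gIm a * gIm d) + (gRe c * gRe b - gIm c * gIm b).
Proof.
rewrite {1}gReD; apply: (congr2 +%R); last by rewrite {1}gReM_conj2 {1}gReM.
rewrite {1}gReD; apply: (congr2 +%R); last by rewrite {1}gReM_conj2 {1}gReM.
rewrite {1}gReD; apply: (congr2 +%R); last by rewrite {1}gReM.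
rewrite {1}gReD; apply: (congr2 +%R); last by rewrite {1}gReM.
by rewrite {1}gReN {1}gReM_conj.
Qed.

Lemma sformE X Y : sform X Y =
  2^-1 *: (crd X 0 * crd Y 1 + crd X 1 * crd Y 0)
  - (crd X 2 * crd Y 2 + crd X 3 * crd Y 3)
  + (crd X 4 * crd Y 6 - crd X 5 * crd Y 7)
  + (crd Y 4 * crd X 6 - crd Y 5 * crd X 7).
Proof.
rewrite /sform gRe_form; exact: form_halves.
Qed.

Lemma nth_dual_axis (A : pzRingType) (f g : nat -> A) i : (i < 8)%N ->
  nth 0 [:: f 0%N * g 1%N; f 1%N * g 0%N; f 2%N * g 2%N; f 3%N * g 3%N; f 4%N * g 6%N; f 5%N * g 7%N;
            f 6%N * g 4%N; f 7%N * g 5%N] i = f i * g (dual_axis i).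
Proof. by case: i => [|[|[|[|[|[|[|[|//]]]]]]]]. Qed.

Lemma sform_sum X Y : graded X -> graded Y ->
  sform X Y = \sum_(i < 8) form_weight i *: (crd X i * crd Y (dual_axis i)).
Proof.
move=> gX gY; rewrite sformE.
have anti j k : (3 < j < 8)%N -> (3 < k < 8)%N -> crd Y j * crd X k = - (crd X k * crd Y j).
  move=> /andP[j3 j8] /andP[k3 k8]; have := parity_comm (gY j j8) (gX k k8).
  by rewrite j3 k3 expr1 mulN1r.
rewrite (anti 4 6)%N // (anti 5 7)%N // opprK sum_weights.
apply: eq_bigr => i _; apply: congr1; exact: nth_dual_axis.
Qed.

End Form.

(** * Bilinearity, symmetry, nondegeneracy and body of the form *)

Section FormCalculus.
Variable R : realType.
Implicit Types (X Y Z W : superspace R) (a : superR R) (i : nat).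

Lemma even_sform X Y : graded X -> graded Y -> is_even (sform X Y).
Proof.
move=> gX gY; rewrite sform_sum //; apply: even_sum => i; apply: evenZ.
apply/is_evenE; have i8 := ltn_ord i.
have := parityM (gX i i8) (gY _ (dual_axis_lt i8)).
by rewrite -/(axis_parity _) -/(axis_parity (dual_axis i)) axis_parity_dual // addbb.
Qed.

Lemma sformDl X Y Z : graded X -> graded Y -> graded Z ->
  sform (X + Y) Z = sform X Z + sform Y Z.
Proof.
move=> gX gY gZ.
rewrite (sform_sum gX gZ) (sform_sum gY gZ) (sform_sum (gradedD gX gY) gZ).
rewrite -big_split; apply: eq_bigr => i _ /=.
by rewrite {1}crdD {1}mulrDl {1}scalerDr.
Qed.

Definition dual_ord (i : 'I_8) : 'I_8 := Ordinal (dual_axis_lt (ltn_ord i)).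

Lemma dual_ordK : involutive dual_ord.
Proof. by move=> i; apply: val_inj; rewrite /= dual_axisK. Qed.

(** On odd axes the antisymmetry of the weights cancels the anticommutation of the coordinates. *)
Lemma sformC X Y : graded X -> graded Y -> sform X Y = sform Y X.
Proof.
move=> gX gY; rewrite (sform_sum gX gY) (sform_sum gY gX).
rewrite [LHS](reindex_inj (inv_inj dual_ordK)); apply: eq_bigr => i _ /=.
have i8 := ltn_ord i; rewrite (dual_axisK i8) (form_weight_dual R i8).
have := parity_comm (gY i i8) (gX _ (dual_axis_lt i8)).
rewrite -/(axis_parity _) -/(axis_parity (dual_axis i)) (axis_parity_dual i8) andbb.
move=> ->; rewrite mulrC -scalerA; apply: congr1.
by case: axis_parity; rewrite ?expr1 ?expr0 ?scaleN1r ?mulN1r ?scale1r ?mul1r.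
Qed.

Lemma sformDr X Y Z : graded X -> graded Y -> graded Z ->
  sform X (Y + Z) = sform X Y + sform X Z.
Proof.
move=> gX gY gZ; rewrite (sformC gX (gradedD gY gZ)) (sformDl gY gZ gX).
by rewrite (sformC gX gY) (sformC gX gZ).
Qed.

Lemma sformZl a X Y : is_even a -> graded X -> graded Y ->
  sform (sscale a X) Y = a * sform X Y.
Proof.
move=> Ha gX gY; rewrite (sform_sum (gradedZ Ha gX) gY) (sform_sum gX gY).
rewrite mulr_sumr; apply: eq_bigr => i _.
by rewrite {1}crdZ -{1}scalerAr {1}mulrA.
Qed.

Lemma sformZr a X Y : is_even a -> graded X -> graded Y ->
  sform X (sscale a Y) = a * sform X Y.
Proof.
move=> Ha gX gY.
by rewrite (sformC gX (gradedZ Ha gY)) (sformZl Ha gY gX) (sformC gX gY).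
Qed.

Lemma gderiv_sform (X X' Y Y' : R -> superspace R) :
    (forall t, graded (X t)) -> (forall t, graded (Y t)) ->
    sderiv X X' -> sderiv Y Y' ->
  gderiv (fun t => sform (X t) (Y t))
         (fun t => sform (X' t) (Y t) + sform (X t) (Y' t)).
Proof.
move=> gX gY dX dY.
have gX' := sderiv_graded dX gX; have gY' := sderiv_graded dY gY.
pose F (i : 'I_8) t := form_weight R i *: (crd (X t) i * crd (Y t) (dual_axis i)).
pose dF (i : 'I_8) t := form_weight R i *:
  (crd (X' t) i * crd (Y t) (dual_axis i) + crd (X t) i * crd (Y' t) (dual_axis i)).
have H (i : 'I_8) : gderiv (F i) (dF i).
  apply: gderivZ; apply: gderivM; first exact: (sderivP X X').1.
  by apply: (sderivP Y Y').1 => //; exact: dual_axis_lt.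
apply: (gderiv_eq (eq_gderiv (gderiv_sum (index_enum 'I_8) H) _)) => t.
  by rewrite sform_sum.
rewrite (sform_sum (gX' t) (gY t)) (sform_sum (gX t) (gY' t)) -big_split.
by apply: eq_bigr => i _ /=; rewrite /dF scalerDr.
Qed.

Lemma gcontinuous_sform (X X' Y Y' : R -> superspace R) :
    (forall t, graded (X t)) -> (forall t, graded (Y t)) ->
    sderiv X X' -> sderiv Y Y' ->
  gcontinuous (fun t => sform (X t) (Y t)).
Proof. by move=> gX gY dX dY; apply: gderiv_continuous (gderiv_sform gX gY dX dY). Qed.

Definition theta (j : nat) : superR R := mkmalgU [fset j] 1.

Lemma theta_odd j : has_parity true (theta j).
Proof.
move=> I; rewrite mcoeffU; case: (eqVneq [fset j] I) => [<-|_].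
  by rewrite cardfs1.
by rewrite mulr0n eqxx.
Qed.

(** For a generator outside [I], the coefficient of [a] at [I] reappears up to sign in the product.
    The supply of generators must be infinite: with finitely many, the top monomial would be
    annihilated by all of them. *)
Lemma mul_theta_eq0 a : (forall j, a * theta j = 0) -> a = 0.
Proof.
move=> H; apply/malgP => I; rewrite mcoeff0.
pose j := (\max_(i <- I) i).+1.
have jI : j \notin I.
  apply/negP => jI; have : (j <= \max_(i <- I) i)%N by exact: leq_bigmax_seq.
  by rewrite ltnn.
have : mcoeff (j |` I) (a * theta j) = 0 by rewrite H mcoeff0.
have IJ : (j |` I) `\` I = [fset j].
  by rewrite fsetDUl fsetDv fsetU0; apply/fsetDidPl; rewrite fdisjoint1X.
rewrite (mcoeffM (j |` I) a) (bigD1_seq I) /= ?fset_uniq ?fpowersetE ?fsubsetU1 //.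
rewrite IJ {1}/theta mcoeffUU mulr1 big_seq_cond big1 ?addr0; last first.
  move=> J; rewrite fpowersetE => /andP[JS JI]; rewrite /theta mcoeffU.
  case: eqVneq => [E|_]; last by rewrite mulr0n !mulr0.
  move: JI; rewrite (_ : J = I) ?eqxx //.
  have jJ : j \notin J by have := fset11 j; rewrite E in_fsetD => /andP[].
  apply/fsetP => x; have := congr1 (fun A : {fset nat} => x \in A) E.
  rewrite in_fset1 in_fsetD in_fset1U.
  case: (eqVneq x j) => [->|/negbTE xj] /=; first by rewrite (negbTE jI) (negbTE jJ).
  have := fsubsetP JS x; rewrite in_fset1U xj.
  by case: (x \in J); case: (x \in I) => //= /(_ isT).
rewrite /gsign fdisjointX1 jI => /eqP; rewrite mulf_eq0 signr_eq0 /=.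
by move/eqP.
Qed.

Lemma sform_svec W (e : superR R) i : (i < 8)%N -> graded W ->
    has_parity (axis_parity i) e ->
  sform W (svec (fun k => if k == dual_axis i then e else 0)) =
  form_weight R i *: (crd W i * e).
Proof.
move=> i8 gW He; rewrite sform_sum //; last first.
  move=> k k8; rewrite crd_svec //; case: eqP => [->|_]; last exact: parity0.
  by rewrite -/(axis_parity _) axis_parity_dual.
rewrite (bigD1 (Ordinal i8)) //= crd_svec ?dual_axis_lt // eqxx.
rewrite big1 ?addr0 // => k ki; rewrite crd_svec ?dual_axis_lt //.
case: eqP => [E|_]; last by rewrite mulr0 scaler0.
by case/eqP: ki; apply: val_inj; rewrite /= -[LHS]dual_axisK // E dual_axisK.
Qed.

Lemma sform_nondegenerate h W : ambient h W ->
  (forall c, ambient h c -> sform W c = 0) -> W = 0.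
Proof.
move=> /ambientP[gW rW] H; apply: crdP => i i8; rewrite crd0.
(* Test vectors of the real subspace cannot reach the imaginary axes, but there [W] vanishes by
   assumption. *)
have [/andP[/eqP h2 im]|him] := boolP (((if h is H2 then true else false) == true) && imag_axis i).
  by apply: rW => //; case: (h) h2.
have key e : has_parity (axis_parity i) e -> crd W i * e = 0.
  move=> He; have := sform_svec i8 gW He; rewrite H.
    move/esym/eqP; rewrite scaler_eq0 (negbTE (form_weight_neq0 _ i8)) /=.
    by move/eqP.
  apply/ambientP; split.
    move=> k k8; rewrite crd_svec //; case: eqP => [->|_]; last exact: parity0.
    by rewrite -/(axis_parity _) axis_parity_dual.
  move=> h2 k imk; have k8 : (k < 8)%N by move: imk => /orP[/orP[]|] /eqP ->.
  rewrite crd_svec //; case: eqP => // kE.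
  by move: him imk; rewrite h2 kE imag_axis_dual //= => /negbTE ->.
(* On an odd axis the entry of the test vector must be odd, which excludes [1]; all generators are
   tried instead. *)
case: (boolP (axis_parity i)) => pi.
  by apply: mul_theta_eq0 => j; apply: key; rewrite pi; exact: theta_odd.
by have := key 1; rewrite mulr1; apply; rewrite (negbTE pi); exact: parity1.
Qed.

Lemma body_odd a : has_parity true a -> body a = 0.
Proof.
by move=> Ha; apply/eqP; apply: contraTT isT => /Ha; rewrite cardfs0.
Qed.

(** Odd coordinates have no body, so what remains is the Minkowski form of signature (1,3) in
    light-cone coordinates. *)
Lemma body_sform X Y : graded X -> graded Y -> body (sform X Y) =
  2^-1 * (body (crd X 0) * body (crd Y 1) + body (crd X 1) * body (crd Y 0))
  - (body (crd X 2) * body (crd Y 2) + body (crd X 3) * body (crd Y 3)).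
Proof.
move=> gX gY; rewrite sform_sum //.
have -> : body (\sum_(i < 8) form_weight R i *: (crd X i * crd Y (dual_axis i))) =
   \sum_(i < 8) form_weight R i * (body (crd X i) * body (crd Y (dual_axis i))).
  by rewrite /body raddf_sum; apply: eq_bigr => i _; rewrite /= -!/(body _) bodyZ bodyM.
have X0 i : (3 < i < 8)%N -> body (crd X i) = 0.
  by move=> /andP[i3 i8]; apply: body_odd; have := gX i i8; rewrite i3.
rewrite 8!big_ord_recl big_ord0 addr0 /=.
rewrite (X0 4%N) // (X0 5%N) // (X0 6%N) // (X0 7%N) //.
by rewrite !mul0r !mulr0 !addr0 /form_weight /=; ring.
Qed.

End FormCalculus.

(** * Integrals depending on a parameter and the fundamental lemma *)

Section IntervalIntegral.
Variable R : realType.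
Implicit Types (f F : R -> R) (a b : R).
Local Open Scope classical_set_scope.
Notation mu := lebesgue_measure.

Lemma is_derive_congr f F (x df dF : R) : is_derive x (1 : R) f df ->
  f =1 F -> df = dF -> is_derive x (1 : R) F dF.
Proof. by move=> D /funext <- <-. Qed.

Lemma continuous_mul f F : continuous f -> continuous F ->
  continuous (fun t => f t * F t).
Proof. by move=> cf cF t; exact: continuousM (cf t) (cF t). Qed.

Lemma continuous_add f F : continuous f -> continuous F ->
  continuous (fun t => f t + F t).
Proof. by move=> cf cF t; exact: continuousD (cf t) (cF t). Qed.

Lemma continuous_scale (c : R) f : continuous f -> continuous (fun t => c * f t).
Proof. by move=> cf; apply: continuous_mul => // t; exact: cst_continuous. Qed.

Lemma continuous_bump a b : continuous (fun t : R => (t - a) * (b - t)).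
Proof.
have ci t : {for t, continuous (fun s : R => s)} by exact: cvg_id.
have cc (c : R) t : {for t, continuous (fun _ : R => c)} by exact: cst_continuous.
apply: continuous_mul => t; first exact: continuousB (ci t) (cc a t).
exact: continuousB (cc b t) (ci t).
Qed.

Lemma continuous_itv_integrable f a b : continuous f ->
  mu.-integrable `[a, b] (EFin \o f).
Proof.
move=> cf; apply: continuous_compact_integrable; first exact: segment_compact.
by apply: continuous_subspaceT.
Qed.

Lemma Rintegral_derive f F a b : a < b -> continuous f ->
  (forall t, is_derive t (1 : R) F (f t)) ->
  (\int[mu]_(t in `[a, b]) f t)%R = F b - F a.
Proof.
move=> ab cf dF.
have cF : continuous F.
  move=> t; apply: differentiable_continuous; apply/derivable1_diffP.
  by have [] := dF t.
rewrite /Rintegral (@continuous_FTC2 R f F a b) //.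
- exact: continuous_subspaceT.
- split.
  + by move=> x _; have [] := dF x.
  + by apply: cvg_at_right_filter; exact: cF.
  + by apply: cvg_at_left_filter; exact: cF.
- by move=> x _; rewrite derive1E; have [_ ->] := dF x.
Qed.

(** For [|e| < d] the integral is itself a quadratic polynomial in [e], whose derivative at 0 is its
    linear coefficient. The restriction on [e] reflects that the Lagrangian is polynomial only near
    the given velocity. *)
Lemma Rintegral_quadratic (A0 A1 A2 : R -> R) (J : R -> R -> R) a b (d : R) :
    continuous A0 -> continuous A1 -> continuous A2 -> 0 < d ->
    (forall e t, `|e| < d -> a <= t <= b ->
       J e t = A0 t + e * A1 t + e ^+ 2 * A2 t) ->
  is_derive (0 : R) (1 : R) (fun e => \int[mu]_(t in `[a, b]) J e t)%R
    (\int[mu]_(t in `[a, b]) A1 t)%R.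
Proof.
move=> c0 c1 c2 d0 HJ.
set k0 := (\int[mu]_(t in `[a, b]) A0 t)%R.
set k1 := (\int[mu]_(t in `[a, b]) A1 t)%R.
pose k2 := (\int[mu]_(t in `[a, b]) A2 t)%R.
refine (@near_eq_is_derive R R R (fun e : R => k0 + e * k1 + e ^+ 2 * k2)
  (fun e => \int[mu]_(t in `[a, b]) J e t)%R 0 1 k1 _ _).
  near=> e.
  have ed : `|e| < d.
    near: e; apply/nbhs_ballP; exists d => // y.
    by rewrite /ball /= sub0r normrN.
  transitivity (\int[mu]_(t in `[a, b]) (A0 t + (e * A1 t + e ^+ 2 * A2 t)))%R.
    have i0 := continuous_itv_integrable a b c0.
    have i1 := continuous_itv_integrable a b c1.
    have i2 := continuous_itv_integrable a b c2.
    have mI : measurable (`[a, b] : set R) by exact: measurable_itv.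
    have ie1 : mu.-integrable `[a, b] (EFin \o (fun t => e * A1 t)).
      by apply/continuous_itv_integrable/continuous_scale.
    have ie2 : mu.-integrable `[a, b] (EFin \o (fun t => e ^+ 2 * A2 t)).
      by apply/continuous_itv_integrable/continuous_scale.
    have ie : mu.-integrable `[a, b] (EFin \o (fun t => e * A1 t + e ^+ 2 * A2 t)).
      by apply/continuous_itv_integrable/continuous_add; exact: continuous_scale.
    by rewrite RintegralD // RintegralD // !RintegralZl // addrA.
  apply: eq_Rintegral => t; rewrite inE /= in_itv /= => Ht.
  by rewrite HJ // addrA.
have H1 := is_deriveZ k1 (is_derive_id (0 : R) (1 : R)).
have H2 := is_deriveX 2 (is_derive_id (0 : R) (1 : R)); rewrite exprfctE in H2.
have H3 := is_deriveD (is_deriveD (is_derive_cst k0 (0 : R) (1 : R)) H1) (is_deriveZ k2 H2).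
apply: (is_derive_congr H3) => [e|].
  transitivity (k0 + k1 * e + k2 * e ^+ 2) => //.
  by rewrite [k1 * e]mulrC [k2 * _]mulrC.
by rewrite /GRing.scale /= expr1 mulr0 !mul0r mulr0 addr0 add0r mulr1.
Unshelve. all: by end_near. Qed.

Lemma itv_bounded f a b : a <= b -> continuous f ->
  exists2 B, 0 <= B & forall t, a <= t <= b -> `|f t| <= B.
Proof.
move=> ab cf.
have cn : {within `[a, b], continuous (fun t => `|f t|)}.
  apply: continuous_subspaceT => t; apply: continuous_comp; first exact: cf.
  exact: norm_continuous.
by have [c _ Hc] := EVT_max ab cn; exists `|f c|.
Qed.

Lemma quadratic_lt0 (v p q : R -> R) a b : a <= b ->
    continuous v -> continuous p -> continuous q -> (forall t, v t < 0) ->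
  exists2 d, 0 < d & forall e t, `|e| < d -> a <= t <= b ->
    v t + e * p t + e ^+ 2 * q t < 0.
Proof.
move=> ab cv cp cq v0.
have [c _ Hc] := EVT_max ab (continuous_subspaceT cv).
have [B B0 HB] := itv_bounded ab cp; have [C C0 HC] := itv_bounded ab cq.
have m0 : 0 < - v c by rewrite oppr_gt0.
pose D := B + C + 1; have D0 : 0 < D by rewrite /D; lra.
(* [|e| < 1] gives [e ^+ 2 <= |e|], so the perturbation is at most [|e| * (B + C)], less than the
   gap [- v c]. The summand 1 in [D] keeps the divisor positive when both bounds are zero. *)
exists (Num.min 1 (- v c / D)); first by rewrite lt_min ltr01 divr_gt0.
move=> e t; rewrite lt_min => /andP[e1 eD] Ht.
have vt : v t <= v c by apply: Hc; rewrite in_itv.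
have e0 := normr_ge0 e.
have eDv : `|e| * D < - v c by rewrite -ltr_pdivlMr.
have pB : e * p t <= `|e| * B.
  apply: le_trans (ler_norm _) _; rewrite normrM ler_wpM2l //; exact: HB.
have qC : e ^+ 2 * q t <= `|e| * C.
  apply: le_trans (ler_norm _) _; rewrite normrM normrX expr2 -mulrA.
  apply: ler_wpM2l => //; apply: le_trans (HC t Ht).
  by rewrite ler_piMl // ltW.
by move: eDv; rewrite /D !mulrDr mulr1; lra.
Qed.

(* Fundamental lemma of the calculus of variations, for the test functions
   [(t - a) (b - t)] only. *)
Lemma bump_integral_eq0 f : continuous f ->
    (forall a b, a < b ->
       (\int[mu]_(t in `[a, b]) ((t - a) * (b - t) * f t))%R = 0) ->
  forall t, f t = 0.
Proof.
have main g : continuous g -> (forall a b, a < b ->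
     (\int[mu]_(t in `[a, b]) ((t - a) * (b - t) * g t))%R = 0) ->
    forall t, g t <= 0.
  move=> cg H t; rewrite leNgt; apply/negP => gt0.
  have [r r0 Hr] : exists2 r, 0 < r & forall s, `|t - s| < r -> g t / 2 < g s.
    have := cg t => /cvgrPdist_lt /(_ (g t / 2)).
    rewrite divr_gt0 // => /(_ isT) /nbhs_ballP[r /= r0 Hr].
    exists r => // s ts; have := Hr s ts; rewrite ltr_norml => /andP[_]; lra.
  pose a := t - r / 2; pose b := t + r / 2.
  have ab : a < b by rewrite /a /b; lra.
  have cT := @continuous_bump a b.
  (* Primitive of the bump, written as [(b - a) (s - a) - (s - a)^2]; the bump thus has the positive
     integral [(b - a)^3 / 6]. *)
  pose F (s : R) := - (s - a) ^+ 3 / 3 + (b - a) * (s - a) ^+ 2 / 2.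
  have dF s : is_derive s (1 : R) F ((s - a) * (b - s)).
    have d1 : is_derive s (1 : R) (fun s : R => s - a) 1.
      have := is_deriveB (is_derive_id s (1 : R)) (is_derive_cst a s (1 : R)).
      by rewrite subr0.
    have d3 := is_deriveX 3 d1; have d2 := is_deriveX 2 d1.
    rewrite exprfctE in d3; rewrite exprfctE in d2.
    have D := is_deriveD (is_deriveZ (- 3^-1) d3) (is_deriveZ ((b - a) / 2) d2).
    apply: (is_derive_congr D) => [u|].
      transitivity (- 3^-1 * (u - a) ^+ 3 + (b - a) / 2 * (u - a) ^+ 2) => //.
      by rewrite /F; field.
    by rewrite /GRing.scale /=; field.
  have I1 := Rintegral_derive ab cT dF.
  have cgT : continuous (fun s : R => (s - a) * (b - s) * g s).
    exact: continuous_mul.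
  have mI : measurable (`[a, b] : set R) by exact: measurable_itv.
  have : (\int[mu]_(s in `[a, b]) (g t / 2 * ((s - a) * (b - s))) <=
         \int[mu]_(s in `[a, b]) ((s - a) * (b - s) * g s))%R.
    apply: le_Rintegral => //.
    - by apply/continuous_itv_integrable/continuous_scale.
    - exact: continuous_itv_integrable.
    - move=> s /=; rewrite in_itv /= => /andP[as_ sb]; rewrite mulrC.
      apply: ler_wpM2l; first by rewrite mulr_ge0 // subr_ge0.
      apply/ltW/Hr; rewrite ltr_norml; move: as_ sb; rewrite /a /b => as_ sb.
      by apply/andP; split; lra.
  rewrite H // RintegralZl //; last exact: continuous_itv_integrable.
  have -> : (\int[mu]_(s in `[a, b]) ((s - a) * (b - s)))%R = (b - a) ^+ 3 / 6.
    by rewrite I1 /F; field.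
  rewrite leNgt => /negP; apply; apply: mulr_gt0; first by rewrite divr_gt0.
  by rewrite divr_gt0 // exprn_gt0 // subr_gt0.
move=> cf H t; apply/eqP; rewrite eq_le main //=.
have := main (fun t => - f t) _ _ t; rewrite oppr_le0; apply.
  by move=> s; apply: continuousN; exact: cf.
move=> a b ab; have := H a b ab => E.
rewrite (_ : (fun t => _) = fun t => -1 * ((t - a) * (b - t) * f t)); last first.
  by apply/funext => s; ring.
rewrite RintegralZl ?E ?mulr0 //.
by apply/continuous_itv_integrable/continuous_mul => //; exact: continuous_bump.
Qed.

End IntervalIntegral.

(** * Causal inequalities in Minkowski space *)

Section Causality.
Variable R : realFieldType.
Implicit Types x v e f : R.

(** Reversed Cauchy-Schwarz. Write [s] for the squared Euclidean length of [(v2, v3)].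
    Arithmetic-geometric mean, then Cauchy-Schwarz on the last two coordinates, bound [x0 x1 v0 v1]
    by [x0 x1 s - s]; as [x0 x1] is positive, [v0 v1 > s] is impossible. *)
Lemma lorentz_tangent_le0 x0 x1 x2 x3 v0 v1 v2 v3 :
    2^-1 * (x0 * x1 + x1 * x0) - (x2 * x2 + x3 * x3) = 1 ->
    2^-1 * (x0 * v1 + x1 * v0) - (x2 * v2 + x3 * v3) = 0 ->
  2^-1 * (v0 * v1 + v1 * v0) - (v2 * v2 + v3 * v3) <= 0.
Proof.
move=> HX0 HXV0.
have HX : x0 * x1 - (x2 * x2 + x3 * x3) = 1 by rewrite -[RHS]HX0; field.
have HXV : x0 * v1 + x1 * v0 = 2 * (x2 * v2 + x3 * v3).
  by apply/eqP; rewrite -subr_eq0 -(mulr0 2) -HXV0; apply/eqP; field.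
rewrite (_ : 2^-1 * _ = v0 * v1); last by field.
set s := v2 * v2 + v3 * v3.
have s0 : 0 <= s by rewrite /s; nra.
have x01 : 0 < x0 * x1 by nra.
have AMGM : (x0 * v1) * (x1 * v0) <= (x2 * v2 + x3 * v3) ^+ 2.
  have -> : x2 * v2 + x3 * v3 = (x0 * v1 + x1 * v0) / 2 by rewrite HXV; field.
  have := sqr_ge0 (x0 * v1 - x1 * v0); rewrite !expr2; nra.
have CS : (x2 * v2 + x3 * v3) ^+ 2 <= (x2 * x2 + x3 * x3) * s.
  by have := sqr_ge0 (x2 * v3 - x3 * v2); rewrite /s !expr2; nra.
have E : (x2 * x2 + x3 * x3) * s = x0 * x1 * s - s.
  have -> : x2 * x2 + x3 * x3 = x0 * x1 - 1 by lra.
  by ring.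
rewrite leNgt; apply/negP => K.
have : 0 < x0 * x1 * (v0 * v1 - s) by exact: mulr_gt0.
have -> : x0 * x1 * (v0 * v1 - s) = (x0 * v1) * (x1 * v0) - x0 * x1 * s by ring.
lra.
Qed.

(** A null vector [e] outside the future would lie in the past cone and [f] in the future cone, and
    such vectors pair non-positively: with [p], [q], [r] below, [(2 r)^2 <= (p + q)^2] contradicts
    [- 2 r = 4 - (p + q)] and [p + q <= 0]. *)
Lemma lorentz_null_future e0 e1 e2 e3 f0 f1 f2 f3 :
    2^-1 * (e0 * e1 + e1 * e0) - (e2 * e2 + e3 * e3) = 0 ->
    2^-1 * (f0 * f1 + f1 * f0) - (f2 * f2 + f3 * f3) = 0 ->
    2^-1 * (e0 * f1 + e1 * f0) - (e2 * f2 + e3 * f3) = 2 ->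
    0 < e0 + e1 + (f0 + f1) ->
  0 < e0 + e1.
Proof.
move=> He' Hf' Hef' S.
have He : e0 * e1 = e2 * e2 + e3 * e3 by lra.
have Hf : f0 * f1 = f2 * f2 + f3 * f3 by lra.
have Hef : e0 * f1 + e1 * f0 - 2 * (e2 * f2 + e3 * f3) = 4 by lra.
 rewrite ltNge; apply/negP => e_le0.
have e01 : 0 <= e0 * e1 by rewrite He; nra.
have f01 : 0 <= f0 * f1 by rewrite Hf; nra.
have e0_le0 : e0 <= 0 by rewrite leNgt; apply/negP => ?; nra.
have e1_le0 : e1 <= 0 by rewrite leNgt; apply/negP => ?; nra.
have f0_ge0 : 0 <= f0 by rewrite leNgt; apply/negP => ?; nra.
have f1_ge0 : 0 <= f1 by rewrite leNgt; apply/negP => ?; nra.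
pose p := e0 * f1; pose q := e1 * f0; pose r := e2 * f2 + e3 * f3.
have p0 : p <= 0 by rewrite /p mulr_le0_ge0.
have q0 : q <= 0 by rewrite /q mulr_le0_ge0.
have rpq : r ^+ 2 <= p * q.
  have -> : p * q = (e2 * e2 + e3 * e3) * (f2 * f2 + f3 * f3).
    by rewrite -He -Hf /p /q; ring.
  by have := sqr_ge0 (e2 * f3 - e3 * f2); rewrite /r !expr2; nra.
have rE : - (2 * r) = 4 - (p + q) by rewrite /p /q /r; lra.
have r2 : (2 * r) ^+ 2 = (4 - (p + q)) ^+ 2 by rewrite -rE sqrrN.
have : (2 * r) ^+ 2 <= (p + q) ^+ 2.
  have := sqr_ge0 (p - q); move: rpq; rewrite !expr2; nra.
by rewrite r2 !expr2; nra.
Qed.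

End Causality.

(** * Perturbed Lagrangian and test variations *)

Section FirstVariation.
Variable R : realType.
Implicit Types (X Y V W : superspace R) (lam : superR R) (I : {fset nat}).

Lemma body_tangent_le0 X V : graded X -> graded V ->
  body (sform X X) = 1 -> body (sform X V) = 0 -> body (sform V V) <= 0.
Proof.
move=> gX gV HX HXV; rewrite {1}(body_sform gV gV).
exact: (lorentz_tangent_le0 (etrans (esym (body_sform gX gX)) HX)
          (etrans (esym (body_sform gX gV)) HXV)).
Qed.

Lemma pert_algebra (A : lalgType R) (e : R) (a b c : A) :
  a + e%:A * b + (e%:A * b + e%:A * (e%:A * c)) =
  a + e *: (2 *: b) + e ^+ 2 *: c.
Proof.
by rewrite !mulr_algl expr2 -(scalerA e e) scaler_nat mulr2n scalerDr !addrA.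
Qed.

Lemma sform_pert (e : R) X Y : graded X -> graded Y ->
  sform (X + sscale e%:A Y) (X + sscale e%:A Y) =
  sform X X + e *: (2 *: sform X Y) + e ^+ 2 *: sform Y Y.
Proof.
move=> gX gY; have Ee : is_even (e%:A : superR R) by exact: evenA.
have gZ := gradedZ Ee gY.
rewrite (sformDl gX gZ (gradedD gX gZ)) (sformDr gX gX gZ) (sformDr gZ gX gZ).
rewrite (sformC gZ gX) (sformZl Ee gY gZ) (sformZr Ee gX gY) (sformZr Ee gY gY).
exact: pert_algebra.
Qed.

Lemma gnorm_lt0 (a : superR R) : body a < 0 -> Defs.gnorm a = - a.
Proof. by move=> a0; rewrite gnormE ?lt_eqF // ltr0_sg // scaleN1r. Qed.

Lemma lagrangian_algebra (A : lalgType R) (e e2 : R) (a b c a' b' c' l : A) :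
    (forall x (y : A), l * (x *: y) = x *: (l * y)) ->
  - (a + e *: b + e2 *: c) + l * (a' + e *: b' + e2 *: c' - 1) =
  (- a + l * (a' - 1)) + e *: (- b + l * b') + e2 *: (- c + l * c').
Proof.
move=> lZ; rewrite mulrBr !mulrDr !lZ mulrN !scalerDr !scalerN !opprD !mulr1.
rewrite (addrAC _ (e2 *: (l * c')) (- l)) (addrAC _ (e *: (l * b')) (- l)).
by rewrite addrACA (addrACA (- a)).
Qed.

(** The sign condition on the perturbed velocity replaces [gnorm] by negation, which leaves a
    quadratic polynomial in [e] with no remainder. *)
Lemma lagrangian_pert (e : R) lam X V Y W :
    graded X -> graded V -> graded Y -> graded W ->
    body (sform (V + sscale e%:A W) (V + sscale e%:A W)) < 0 ->
  lagrangian lam (X + sscale e%:A Y) (V + sscale e%:A W) =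
  (- sform V V + lam * (sform X X - 1)) +
  e *: (- (2 *: sform V W) + lam * (2 *: sform X Y)) +
  e ^+ 2 *: (- sform W W + lam * sform Y Y).
Proof.
move=> gX gV gY gW Hneg; rewrite /lagrangian (gnorm_lt0 Hneg).
apply: etrans (congr2 (fun u v => - u + lam * (v - 1))
  (sform_pert e gV gW) (sform_pert e gX gY)) _.
by apply: lagrangian_algebra => x y; rewrite scalerAr.
Qed.

Lemma crd_scale_alg (x : R) X i : crd (sscale x%:A X) i = x *: crd X i.
Proof. by rewrite crdZ mulr_algl. Qed.

(** A polynomial and all its derivatives in closed form: a variation must be a [curve], which
    carries its whole jet, and must vanish at [a] and [b]. *)
Definition bump (a b : R) (n : nat) (t : R) : R :=
  match n with
  | 0 => (t - a) * (b - t)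
  | 1 => a + b - 2 * t
  | 2 => - 2
  | _ => 0
  end.

Lemma is_derive_bump a b n (t : R) :
  is_derive t (1 : R) (bump a b n) (bump a b n.+1 t).
Proof.
have di : is_derive t (1 : R) (fun s : R => s) 1 := is_derive_id t (1 : R).
have dc (c : R) : is_derive t (1 : R) (fun _ : R => c) 0 := is_derive_cst c t (1 : R).
case: n => [|[|[|n]]]; last exact: (dc 0).
- have D := is_deriveM (is_deriveB di (dc a)) (is_deriveB (dc b) di).
  apply: (is_derive_congr D) => // ; rewrite /GRing.scale /=.
  change ((t - a) * (0 - 1) + (b - t) * (1 - 0) = a + b - 2 * t); ring.
- have D := is_deriveB (dc (a + b)) (is_deriveZ 2 di).
  by apply: (is_derive_congr D) => //; rewrite /GRing.scale /= mulr1 sub0r.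
- exact: (dc (- 2)).
Qed.

Lemma bump_jetP a b c n : sderiv
  (fun t => sscale (bump a b n t)%:A c) (fun t => sscale (bump a b n.+1 t)%:A c).
Proof.
apply/sderivP => i _.
have := gderivS (is_derive_bump a b n) (gderiv_cst (crd c i)).
move=> D; apply: (gderiv_eq (eq_gderiv D _)) => t; first by rewrite crd_scale_alg.
by rewrite crd_scale_alg scaler0 addr0.
Qed.

Definition bump_curve a b (c : superspace R) : curve R :=
  Curve (bump_jetP a b c).

Lemma curve_graded (X : curve R) n :
  (forall t, graded (position X t)) -> forall t, graded (jet X n t).
Proof.
by move=> g0; elim: n => // n IH; exact: (sderiv_graded (jetP X n) IH).
Qed.

Lemma curve_ambient h (X : curve R) n :
  (forall t, ambient h (position X t)) -> forall t, ambient h (jet X n t).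
Proof.
by move=> g0; elim: n => // n IH; exact: (sderiv_ambient (jetP X n) IH).
Qed.

End FirstVariation.

(** * The first variation of the action *)

Section EulerLagrange.
Variables (R : realType) (X : curve R).
Hypothesis gX : forall t, graded (position X t).
Hypothesis X_spacelike : forall t, body (sform (velocity X t) (velocity X t)) < 0.
Implicit Types (lam : R -> superR R) (I : {fset nat}).
Local Open Scope classical_set_scope.
Notation mu := lebesgue_measure.

Let gV t : graded (velocity X t). Proof. exact: (curve_graded (n := 1) gX). Qed.
Let gA t : graded (jet X 2 t). Proof. exact: (curve_graded (n := 2) gX). Qed.

(** Since the velocity is spacelike, the Lagrangian reads [- <V, V> + lam (<X, X> - 1)]; integrating
    [- 2 <X', eta'>] by parts produces [+ 2 <X'', eta>], whence the plus sign. *)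
Definition euler_lagrange lam t : superspace R :=
  jet X 2 t + sscale (lam t) (position X t).

Lemma curve_sform_cont (Y Z : curve R) m n :
    (forall t, graded (position Y t)) -> (forall t, graded (position Z t)) ->
  gcontinuous (fun t => sform (jet Y m t) (jet Z n t)).
Proof.
move=> gY gZ; apply: gcontinuous_sform (jetP Y m) (jetP Z n).
  exact: curve_graded.
exact: curve_graded.
Qed.

Lemma sform_euler_lagrange lam t (c : superspace R) :
    is_even (lam t) -> graded c ->
  sform (euler_lagrange lam t) c =
  sform (jet X 2 t) c + lam t * sform (position X t) c.
Proof.
move=> Hl gc; rewrite (sformDl (@gA t) (gradedZ Hl (@gX t)) gc).
by rewrite (sformZl Hl (@gX t) gc).
Qed.

Lemma gcontinuousN (f : R -> superR R) :
  gcontinuous f -> gcontinuous (fun t => - f t).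
Proof.
move=> cf; rewrite (_ : (fun t => _) = fun t => -1 *: f t).
  exact: gcontinuousZ.
by apply/funext => t; rewrite scaleN1r.
Qed.

Lemma mcoeff_quadratic I (A B C : superR R) (e : R) :
  mcoeff I (A + e *: B + e ^+ 2 *: C) =
  mcoeff I A + e * mcoeff I B + e ^+ 2 * mcoeff I C.
Proof. by rewrite {1}mcoeffD {1}mcoeffD {1}mcoeffZ {1}mcoeffZ. Qed.

Lemma euler_lagrange_algebra (A : algType R) (p q r l w : A) : w = p + l * r ->
  - (2 *: q) + l * (2 *: r) = - 2 *: (p + q) + 2 *: w.
Proof.
move=> ->; rewrite -scalerAr scaleNr 2!scalerDr opprD (addrC (- (2 *: p))).
by rewrite -[RHS]addrA (addrA (- (2 *: p))) addNr add0r.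
Qed.

Lemma first_variation lam (eta : curve R) (a b : R) I :
    (forall t, is_even (lam t)) -> gcontinuous lam ->
    a < b -> (forall t, graded (position eta t)) ->
    position eta a = 0 -> position eta b = 0 ->
  is_derive (0 : R) (1 : R) (action_coeff I lam X eta a b)
    (\int[mu]_(t in `[a, b])
       mcoeff I (2 *: sform (euler_lagrange lam t) (position eta t)))%R.
Proof.
move=> Hl cl ab gE Ea Eb.
have gE' t : graded (velocity eta t) by exact: (curve_graded (n := 1) gE).
pose L0 t := - sform (velocity X t) (velocity X t) +
  lam t * (sform (position X t) (position X t) - 1).
pose L1 t := - (2 *: sform (velocity X t) (velocity eta t)) +
  lam t * (2 *: sform (position X t) (position eta t)).
pose L2 t := - sform (velocity eta t) (velocity eta t) +
  lam t * sform (position eta t) (position eta t).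
have cXX : gcontinuous (fun t => sform (position X t) (position X t)).
  exact: (curve_sform_cont (m := 0) (n := 0) gX gX).
have cXE : gcontinuous (fun t => sform (position X t) (position eta t)).
  exact: (curve_sform_cont (m := 0) (n := 0) gX gE).
have cEE : gcontinuous (fun t => sform (position eta t) (position eta t)).
  exact: (curve_sform_cont (m := 0) (n := 0) gE gE).
have cVV : gcontinuous (fun t => sform (velocity X t) (velocity X t)).
  exact: (curve_sform_cont (m := 1) (n := 1) gX gX).
have cVW : gcontinuous (fun t => sform (velocity X t) (velocity eta t)).
  exact: (curve_sform_cont (m := 1) (n := 1) gX gE).
have cWW : gcontinuous (fun t => sform (velocity eta t) (velocity eta t)).
  exact: (curve_sform_cont (m := 1) (n := 1) gE gE).
have cAE : gcontinuous (fun t => sform (jet X 2 t) (position eta t)).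
  exact: (curve_sform_cont (m := 2) (n := 0) gX gE).
have cL0 : gcontinuous L0.
  apply: gcontinuousD; first exact: gcontinuousN.
  apply: gcontinuousM; first exact: cl.
  apply: gcontinuousD; first exact: cXX.
  by apply: gderiv_continuous; exact: gderiv_cst.
have cL1 : gcontinuous L1.
  apply: gcontinuousD; first exact: gcontinuousN (gcontinuousZ cVW).
  by apply: gcontinuousM; [exact: cl | exact: gcontinuousZ].
have cL2 : gcontinuous L2.
  apply: gcontinuousD; first exact: gcontinuousN.
  by apply: gcontinuousM; [exact: cl | exact: cEE].
have c2VW : gcontinuous (fun t => 2 *: sform (velocity X t) (velocity eta t)).
  exact: gcontinuousZ.
have [d d0 Hd] := quadratic_lt0 (ltW ab) (cVV fset0)
  (c2VW fset0) (cWW fset0) X_spacelike.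
have J := Rintegral_quadratic (cL0 I) (cL1 I) (cL2 I) d0
  (J := fun e t => mcoeff I (lagrangian (lam t)
      (position X t + sscale e%:A (position eta t))
      (velocity X t + sscale e%:A (velocity eta t)))) (a := a) (b := b).
(* Integration by parts: the two integrands differ by the derivative of [- 2 <X', eta>], whose
   boundary values vanish because [eta] is zero at both ends. *)
have H1 : (\int[mu]_(t in `[a, b]) mcoeff I (L1 t))%R =
    (\int[mu]_(t in `[a, b])
       mcoeff I (2 *: sform (euler_lagrange lam t) (position eta t)))%R.
  pose G t := sform (velocity X t) (position eta t).
  have dG : gderiv G (fun t => sform (jet X 2 t) (position eta t) +
      sform (velocity X t) (velocity eta t)).
    exact: gderiv_sform (@gV) gE (jetP X 1) (jetP eta 0).
  have dG2 := gderivZ (- 2) dG.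
  pose f1 t := mcoeff I (- 2 *: (sform (jet X 2 t) (position eta t) +
      sform (velocity X t) (velocity eta t))).
  pose f2 t := mcoeff I (2 *: sform (euler_lagrange lam t) (position eta t)).
  have cdG : gcontinuous (fun t => sform (jet X 2 t) (position eta t) +
      sform (velocity X t) (velocity eta t)) := gcontinuousD cAE cVW.
  have cf1 : continuous f1 := @gcontinuousZ R (- 2) _ cdG I.
  have cW : gcontinuous (fun t => sform (euler_lagrange lam t) (position eta t)).
    have -> : (fun t => sform (euler_lagrange lam t) (position eta t)) =
        fun t => sform (jet X 2 t) (position eta t) +
        lam t * sform (position X t) (position eta t).
      by apply/funext => t; exact: sform_euler_lagrange.
    by apply: gcontinuousD; [exact: cAE | exact: gcontinuousM].
  have cf2 : continuous f2 := @gcontinuousZ R 2 _ cW I.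
  transitivity (\int[mu]_(t in `[a, b]) (f1 t + f2 t))%R.
    apply: eq_Rintegral => t _; rewrite /f1 /f2 -mcoeffD; apply: congr1.
    have E := sform_euler_lagrange (Hl t) (gE t).
    exact: euler_lagrange_algebra E.
  rewrite RintegralD //; [|exact: continuous_itv_integrable..].
  have S0 (Y : superspace R) : graded Y -> sform Y 0 = 0.
    move=> gY; rewrite -(sscale0 Y) (sformZr (@even0 _) gY gY).
    exact: mul0r.
  have Ga : G a = 0 by rewrite /G Ea; exact: S0 (@gV a).
  have Gb : G b = 0 by rewrite /G Eb; exact: S0 (@gV b).
  have X2 (x y : superR R) : x = 0 -> y = 0 ->
      mcoeff I (- 2 *: x) - mcoeff I (- 2 *: y) = 0.
    by move=> -> ->; rewrite subrr.
  have F1 := etrans (Rintegral_derive ab cf1 (fun t => dG2 I t)) (X2 _ _ Gb Ga).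
  rewrite {1}F1; exact: add0r.
rewrite -H1; apply: J => e t ed tab.
have Hneg : body (sform (velocity X t + sscale e%:A (velocity eta t))
                        (velocity X t + sscale e%:A (velocity eta t))) < 0.
  rewrite /body; have -> := etrans (congr1 (mcoeff fset0) (sform_pert e (@gV t) (gE' t)))
    (mcoeff_quadratic fset0 _ _ _ e).
  exact: Hd.
exact: (etrans (congr1 (mcoeff I)
  (lagrangian_pert (lam t) (@gX t) (@gV t) (gE t) (gE' t) Hneg))
  (mcoeff_quadratic I _ _ _ e)).
Qed.

End EulerLagrange.

(** * Criticality and the Euler-Lagrange equation *)

Section Critical.
Variables (R : realType) (h : dimension) (X : curve R).
Hypothesis aX : forall t, ambient h (position X t).
Hypothesis X_spacelike : forall t, body (sform (velocity X t) (velocity X t)) < 0.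
Local Open Scope classical_set_scope.
Notation mu := lebesgue_measure.

Let gX t : graded (position X t). Proof. exact: ambient_graded (aX t). Qed.

(** A variation equal to a bump times a constant ambient vector [c] isolates the pairing of the
    equation with [c]; the fundamental lemma removes the integral, and nondegeneracy on the ambient
    space removes [c]. *)
Lemma critical_euler_lagrange : critical h X ->
  exists2 lam : R -> superR R, forall t, is_even (lam t) &
    forall t, euler_lagrange X lam t = 0.
Proof.
case=> lam [Hl cl H]; exists lam => // t.
apply: (sform_nondegenerate (h := h)).
  apply: ambientD; first exact: curve_ambient.
  exact: ambientZ.
move=> c ac; have gc := ambient_graded ac.
apply/malgP => I; rewrite mcoeff0.
pose f t := 2 * mcoeff I (sform (euler_lagrange X lam t) c).
suff : f t = 0 by move=> /eqP; rewrite mulf_eq0 pnatr_eq0 => /eqP.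
apply: (bump_integral_eq0 (f := f)) => [|a b ab].
  apply: continuous_scale.
  suff : gcontinuous (fun t => sform (euler_lagrange X lam t) c) by [].
  rewrite (_ : (fun t => _) = fun t => sform (jet X 2 t) c +
      lam t * sform (position X t) c); last first.
    by apply/funext => s; rewrite sform_euler_lagrange.
  have dc : sderiv (fun _ : R => c) (fun _ => 0).
    by apply/sderivP => i _; rewrite crd0; exact: gderiv_cst.
  apply: gcontinuousD; last apply: gcontinuousM; last first.
  - exact: gcontinuous_sform (@gX) (fun _ => gc) (jetP X 0) dc.
  - exact: cl.
  exact: gcontinuous_sform (curve_graded (n := 2) (@gX)) (fun _ => gc) (jetP X 2) dc.
have aB s : ambient h (position (bump_curve a b c) s).
  by apply: ambientZ => //; exact: evenA.
have Ba : position (bump_curve a b c) a = 0.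
  by rewrite /position /= subrr mul0r scale0r sscale0.
have Bb : position (bump_curve a b c) b = 0.
  by rewrite /position /= subrr mulr0 scale0r sscale0.
have D0 := H a b (bump_curve a b c) ab aB Ba Bb I.
have D1 := first_variation (@gX) X_spacelike I Hl cl ab
  (fun s => ambient_graded (aB s)) Ba Bb.
have E : (0 : R) = (\int[mu]_(t in `[a, b]) mcoeff I (2 *:
   sform (euler_lagrange X lam t) (position (bump_curve a b c) t)))%R.
  by have [_ <-] := D0; have [_ <-] := D1.
rewrite [RHS]E; apply: eq_Rintegral => s _.
have gW : graded (euler_lagrange X lam s).
  by apply: gradedD; [exact: (curve_graded (n := 2) (@gX)) | exact: gradedZ].
have -> : sform (euler_lagrange X lam s) (position (bump_curve a b c) s) =
   ((s - a) * (b - s)) *: sform (euler_lagrange X lam s) c.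
  apply: etrans (sformZr _ gW gc) _; first exact: evenA.
  exact: mulr_algl.
rewrite {1}mcoeffZ {1}mcoeffZ /f.
have X2 (u y : R) : u * (2 * y) = 2 * (u * y) by ring.
exact: X2.
Qed.

Lemma euler_lagrange_critical (lam : R -> superR R) :
    (forall t, is_even (lam t)) -> gcontinuous lam ->
    (forall t, euler_lagrange X lam t = 0) ->
  critical h X.
Proof.
move=> Hl cl H0; exists lam; split=> // a b eta ab aE Ea Eb I.
have gE t : graded (position eta t) := ambient_graded (aE t).
have := first_variation (@gX) X_spacelike I Hl cl ab gE Ea Eb.
rewrite (_ : (\int[mu]_(t in _) _)%R = 0) //.
have S0 (Y : superspace R) : graded Y -> sform 0 Y = 0.
  by move=> gY; rewrite -(sscale0 Y) (sformZl (@even0 _) gY gY) mul0r.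
transitivity (\int[mu]_(t in `[a, b]) (cst 0 t : R))%R.
  by apply: eq_Rintegral => t _; rewrite H0 (S0 _ (gE t)) scaler0 mcoeff0.
by rewrite Rintegral_cst ?mul0r.
Qed.

End Critical.

(** * Exponential curves in a null frame and their Taylor extension *)

Section ExponentialCurve.
Variable R : realType.
Implicit Types (E F X : superspace R) (a b c k s u : superR R) (t : R).
Local Open Scope classical_set_scope.

(** Two independent scalars, rather than a scalar and its inverse, make exchanging and rescaling the
    null vectors plain identities. *)
Definition comb a b E F : superspace R :=
  sscale (2^-1)%:A (sscale a E + sscale b F).

Lemma crd_comb a b E F i :
  crd (comb a b E F) i = 2^-1 *: (a * crd E i + b * crd F i).
Proof.
rewrite /comb crd_scale_alg; apply: congr1.
by rewrite {1}crdD {1}crdZ {1}crdZ.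
Qed.

Lemma combC a b E F : comb a b E F = comb b a F E.
Proof. by rewrite /comb; apply: congr1; exact: addrC. Qed.

Lemma comb_scale a b c c' E F :
  comb (a * c) (b * c') E F = comb a b (sscale c E) (sscale c' F).
Proof. by rewrite /comb !sscaleA. Qed.

Lemma ambient_comb h a b E F : is_even a -> is_even b ->
  ambient h E -> ambient h F -> ambient h (comb a b E F).
Proof.
move=> Ha Hb aE aF; apply: ambientZ; first exact: evenA.
by apply: ambientD; exact: ambientZ.
Qed.

Lemma comb_algebra (A : algType R) (x y z w : A) :
  (2^-1)%:A * ((2^-1)%:A * (x * (y * 0) + x * (w * 2) + (z * (y * 2) + z * (w * 0)))) =
  2^-1 *: (x * w + z * y).
Proof.
rewrite !mulr0 add0r addr0 2!mulr_algl !mulrA -mulrDl.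
rewrite mulr_natr -(scaler_nat 2 (x * w + z * y)); apply: congr1.
by rewrite scalerA mulVf ?pnatr_eq0 // scale1r.
Qed.

Lemma sform_lin2 a b a' b' E F x y z :
    is_even a -> is_even b -> is_even a' -> is_even b' ->
    graded E -> graded F ->
    sform E E = x -> sform E F = y -> sform F F = z ->
  sform (sscale a E + sscale b F) (sscale a' E + sscale b' F) =
  a * (a' * x) + a * (b' * y) + (b * (a' * y) + b * (b' * z)).
Proof.
move=> Ha Hb Ha' Hb' gE gF EE EF FF.
have gaE := gradedZ Ha gE; have gbF := gradedZ Hb gF.
have gaE' := gradedZ Ha' gE; have gbF' := gradedZ Hb' gF.
have gS' := gradedD gaE' gbF'.
have FE : sform F E = y by rewrite -EF; exact: sformC.
apply: etrans (sformDl gaE gbF gS') _; apply: (congr2 +%R).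
  apply: etrans (sformDr gaE gaE' gbF') _; apply: (congr2 +%R).
    apply: etrans (sformZl Ha gE gaE') (congr1 _ _).
    exact: etrans (sformZr Ha' gE gE) (congr1 _ EE).
  apply: etrans (sformZl Ha gE gbF') (congr1 _ _).
  exact: etrans (sformZr Hb' gE gF) (congr1 _ EF).
apply: etrans (sformDr gbF gaE' gbF') _; apply: (congr2 +%R).
  apply: etrans (sformZl Hb gF gaE') (congr1 _ _).
  exact: etrans (sformZr Ha' gF gE) (congr1 _ FE).
apply: etrans (sformZl Hb gF gbF') (congr1 _ _).
exact: etrans (sformZr Hb' gF gF) (congr1 _ FF).
Qed.

Lemma sform_scale2 a b E F : is_even a -> is_even b -> graded E -> graded F ->
  sform (sscale a E) (sscale b F) = a * (b * sform E F).
Proof.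
move=> Ha Hb gE gF.
exact: etrans (sformZl Ha gE (gradedZ Hb gF)) (congr1 _ (sformZr Hb gE gF)).
Qed.

Lemma sform_comb a b a' b' E F :
    is_even a -> is_even b -> is_even a' -> is_even b' ->
    graded E -> graded F ->
    sform E E = 0 -> sform F F = 0 -> sform E F = 2 ->
  sform (comb a b E F) (comb a' b' E F) = 2^-1 *: (a * b' + b * a').
Proof.
move=> Ha Hb Ha' Hb' gE gF EE FF EF.
have He : is_even ((2^-1)%:A : superR R) by exact: evenA.
have gS := gradedD (gradedZ Ha gE) (gradedZ Hb gF).
have gS' := gradedD (gradedZ Ha' gE) (gradedZ Hb' gF).
have S := sform_lin2 Ha Hb Ha' Hb' gE gF EE EF FF.
apply: etrans (sform_scale2 He He gS gS') _.
apply: etrans (congr1 (fun u => _ * (_ * u)) S) _.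
exact: comb_algebra.
Qed.

Definition exp_jet k E F (n : nat) t : superspace R :=
  comb (k ^+ n * gexp (t *: k)) ((- k) ^+ n * gexp (t *: (- k))) E F.

Lemma gderiv_pow_gexp k n :
  gderiv (fun t => k ^+ n * gexp (t *: k)) (fun t => k ^+ n.+1 * gexp (t *: k)).
Proof.
apply: (gderiv_eq (gderiv_mull (k ^+ n) (gderiv_gexp k))) => t.
by rewrite exprSr mulrA.
Qed.

Lemma gderiv_mulr a (f df : R -> superR R) : gderiv f df ->
  gderiv (fun t => f t * a) (fun t => df t * a).
Proof.
move=> Hf; apply: (gderiv_eq (gderivM Hf (gderiv_cst a))) => t.
by rewrite mulr0 addr0.
Qed.

Lemma exp_jetP k E F n : sderiv (exp_jet k E F n) (exp_jet k E F n.+1).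
Proof.
apply/sderivP => i _.
have D := gderivZ (2^-1) (gderivD (gderiv_mulr (crd E i) (gderiv_pow_gexp k n))
  (gderiv_mulr (crd F i) (gderiv_pow_gexp (- k) n))).
apply: (gderiv_eq (eq_gderiv D _)) => t; rewrite /exp_jet crd_comb //.
Qed.

Definition exp_curve k E F : curve R := Curve (exp_jetP k E F).

Lemma exp_curve_position k E F t :
  position (exp_curve k E F) t = comb (gexp (t *: k)) (gexp (t *: (- k))) E F.
Proof.
have X2 (x y : superR R) : comb (k ^+ 0 * x) ((- k) ^+ 0 * y) E F = comb x y E F.
  by rewrite {1}expr0 {1}expr0 {1}mul1r {1}mul1r.
exact: X2.
Qed.

(** Reconciles two expansions: [curve_ext] is a Taylor sum about the body of [s], cut at the order
    of [s], whereas [gexp (s * a)] expands about the body of the product. The powers of [a] split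
    off because [a] is even. *)
Lemma gexp_shift a s : is_even a -> is_even s ->
  gexp (s * a) = \sum_(n < nil_order s)
    (n`!%:R^-1 *: soul s ^+ n) * (a ^+ n * gexp (body s *: a)).
Proof.
move=> Ha Hs; have Hn := even_soul Hs.
have sE : s * a = body s *: a + soul s * a.
  by rewrite {1}(soulE s) mulrDl mulr_algl.
have Hna : is_even (soul s * a) by exact: evenM.
rewrite sE gexpD //; last exact: evenZ.
have XM n : (soul s * a) ^+ n = soul s ^+ n * a ^+ n.
  by apply: exprMn_comm; rewrite /GRing.comm even_comm.
have b0 : body (soul s * a) = 0 by rewrite bodyM body_soul mul0r.
have n0 : soul (soul s * a) ^+ nil_order s = 0.
  by rewrite (soul_body0 b0) XM (soul_nilp (leqnn _)) mul0r.
rewrite (gexpE n0) b0 expR0 scale1r (soul_body0 b0).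
have Hg : is_even (gexp (body s *: a)) by apply/even_gexp/evenZ.
rewrite (even_comm _ Hg) mulr_suml; apply: eq_bigr => n _; rewrite XM.
have X2 (A : algType R) (r : R) (x y z : A) : r *: (x * y) * z = r *: x * (y * z).
  by rewrite -!scalerAl mulrA.
exact: X2.
Qed.

Lemma crd_curve_ext (X : curve R) s i : crd (curve_ext X s) i =
  \sum_(n < nil_order s) (n`!%:R^-1 *: soul s ^+ n) * crd (jet X n (body s)) i.
Proof. by rewrite crd_sum; apply: eq_bigr => n _; exact: crdZ. Qed.

Lemma sum_comb_algebra (A : algType R) n (c p q : nat -> A) (x y : A) :
  \sum_(i < n) c i * (2^-1 *: (p i * x + q i * y)) =
  2^-1 *: ((\sum_(i < n) c i * p i) * x + (\sum_(i < n) c i * q i) * y).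
Proof.
rewrite !mulr_suml -big_split scaler_sumr; apply: eq_bigr => i _ /=.
by rewrite -scalerAr mulrDr !mulrA.
Qed.

Lemma exp_curve_ext k E F s : is_even k -> is_even s ->
  curve_ext (exp_curve k E F) s = comb (gexp (s * k)) (gexp (- (s * k))) E F.
Proof.
move=> Hk Hs; apply: crdP => i _.
have gk := gexp_shift Hk Hs; have gNk := gexp_shift (evenN Hk) Hs.
rewrite mulrN in gNk.
apply: etrans (crd_curve_ext _ s i) _; apply: etrans _ (esym (crd_comb _ _ E F i)).
apply: etrans _ (congr2 (fun u v => 2^-1 *: (u * crd E i + v * crd F i)) (esym gk) (esym gNk)).
apply: etrans _ (sum_comb_algebra _ (fun n => n`!%:R^-1 *: soul s ^+ n)
  (fun n => k ^+ n * gexp (body s *: k)) (fun n => (- k) ^+ n * gexp (body s *: - k))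
  (crd E i) (crd F i)).
by apply: eq_bigr => n _; apply: congr1; exact: crd_comb.
Qed.

(** Hence agreement at real times implies agreement at even super parameters. *)
Lemma jet_unique (X Y : curve R) : (forall t, position X t = position Y t) ->
  forall n t, jet X n t = jet Y n t.
Proof.
move=> XY; elim=> [|n IH] t; first exact: XY.
apply: crdP => i i8.
have dX := (sderivP _ _).1 (jetP X n) i i8.
have dY := (sderivP _ _).1 (jetP Y n) i i8.
have dY' := eq_gderiv dY (fun v => congr1 (fun Z => crd Z i) (esym (IH v))).
exact: (gderiv_unique dX dY' t).
Qed.

Lemma curve_ext_unique (X Y : curve R) s :
  (forall t, position X t = position Y t) -> curve_ext X s = curve_ext Y s.
Proof.
move=> XY; rewrite /curve_ext; apply: eq_bigr => n _.
by rewrite (jet_unique XY).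
Qed.

End ExponentialCurve.

(** * Geodesics are exactly exponential curves in null frames *)

Section Classification.
Variables (R : realType) (h : dimension).
Implicit Types (E F X V : superspace R) (a b c k s u : superR R) (t : R).
Local Open Scope classical_set_scope.

Lemma scale_half_double (W : lmodType R) (u : W) : 2^-1 *: (u + u) = u.
Proof. by rewrite -mulr2n -(scaler_nat 2 u) scalerA mulVf ?pnatr_eq0 // scale1r. Qed.

Lemma double_eq0 (W : lmodType R) (u : W) : u + u = 0 -> u = 0.
Proof. by move=> E; rewrite -(scale_half_double u) E scaler0. Qed.

Lemma half_comm_sum a b s : is_even b -> a * b = s ->
  2^-1 *: (a * b + b * a) = s.
Proof.
move=> Hb E; have Eba : b * a = s := etrans (even_comm a Hb) E.
exact: etrans (congr2 (fun u w => 2^-1 *: (u + w)) E Eba) (scale_half_double s).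
Qed.

(** Meant for [a] and [b] equal to plus or minus the inverse of [k], with [<V, V> = - k^2]: equal
    signs give null vectors, opposite signs the pairing 2. *)
Lemma sform_frame a b V X : is_even a -> is_even b -> graded V -> graded X ->
    sform X X = 1 -> sform X V = 0 ->
  sform (sscale a V + X) (sscale b V + X) = a * (b * sform V V) + 1.
Proof.
move=> Ha Hb gV gX XX XV; have VX : sform V X = 0 by rewrite -XV; exact: sformC.
have gaV := gradedZ Ha gV; have gbV := gradedZ Hb gV.
have S : sform (sscale a V + X) (sscale b V + X) =
    a * (b * sform V V) + a * 0 + (b * 0 + 1).
  apply: etrans (sformDl gaV gX (gradedD gbV gX)) _; apply: (congr2 +%R).
    apply: etrans (sformDr gaV gbV gX) _; apply: (congr2 +%R).
      exact: etrans (sformZl Ha gV gbV) (congr1 _ (sformZr Hb gV gV)).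
    exact: etrans (sformZl Ha gV gX) (congr1 _ VX).
  apply: etrans (sformDr gX gbV gX) _; apply: (congr2 +%R) => //.
  exact: etrans (sformZr Hb gX gV) (congr1 _ XV).
by rewrite S !mulr0 addr0 add0r.
Qed.

(** The second-order operator factors: [v / k + x] and [- v / k + x] solve first-order equations
    with rates [k] and [- k], and [x] is half their sum. *)
Lemma linear_ode2 k (x v : R -> superR R) : is_even k -> body k != 0 ->
    gderiv x v -> gderiv v (fun t => k * k * x t) ->
  forall t, x t = 2^-1 *: (gexp (t *: k) * (ginv k * v 0 + x 0) +
                           gexp (t *: (- k)) * (- ginv k * v 0 + x 0)).
Proof.
move=> Hk k0 dx dv t; set ki := ginv k.
have kiK : ki * k = 1 by rewrite -(even_comm ki Hk); exact: ginvM.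
have Kki : k * ki = 1 by exact: ginvM.
have kikkx (y : superR R) : ki * (k * k * y) = k * y.
  by rewrite -mulrA mulrA kiK mul1r.
have dz : gderiv (fun t => ki * v t + x t) (fun t => k * (ki * v t + x t)).
  apply: (gderiv_eq (gderivD (gderiv_mull ki dv) dx)) => r.
  have X2 (p q : superR R) : ki * (k * k * p) + q = k * (ki * q + p).
    by rewrite kikkx mulrDr mulrA Kki mul1r addrC.
  exact: X2.
have dy : gderiv (fun t => - ki * v t + x t) (fun t => - k * (- ki * v t + x t)).
  apply: (gderiv_eq (gderivD (gderiv_mull (- ki) dv) dx)) => r.
  have X2 (p q : superR R) : - ki * (k * k * p) + q = - k * (- ki * q + p).
    rewrite mulNr kikkx mulrDr [- k * (- ki * q)]mulrA mulrNN Kki mul1r mulNr.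
    by rewrite addrC.
  exact: X2.
have X2 (p q : superR R) : q = 2^-1 *: (ki * p + q + (- ki * p + q)).
  by rewrite mulNr addrACA subrr add0r scale_half_double.
exact: (etrans (X2 (v t) (x t)) (congr2 (fun u w => 2^-1 *: (u + w))
  (gderiv_linear Hk dz t) (gderiv_linear (evenN Hk) dy t))).
Qed.

Lemma hyperbolic_velocity (X : curve R) :
    (forall t, hyperbolic h (position X t)) ->
  forall t, sform (position X t) (velocity X t) = 0.
Proof.
move=> HX t.
have gX r : graded (position X r) by have [aX _ _] := HX r; exact: ambient_graded aX.
have gV : graded (velocity X t) by exact: (curve_graded (n := 1) gX).
have D := gderiv_sform gX gX (jetP X 0) (jetP X 0).
have D0 : gderiv (fun r => sform (position X r) (position X r)) (fun _ => 0).
  by apply: (eq_gderiv (gderiv_cst 1)) => r; have [_ ->] := HX r.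
have := gderiv_unique D D0 t; rewrite (sformC gV (gX t)); exact: double_eq0.
Qed.

Lemma geodesic_exp_curve (X : curve R) : geodesic_curve h X ->
  exists k E F, [/\ is_even k /\ 0 < body k, ambient h E /\ ambient h F,
    [/\ sform E E = 0, sform F F = 0 & sform E F = 2],
    (forall t, position X t = position (exp_curve k E F) t) &
    forall t, sform (velocity X t) (velocity X t) = - (k * k)].
Proof.
move=> [HX HV crit].
have aX t : ambient h (position X t) by have [] := HX t.
have gX t : graded (position X t) by exact: ambient_graded (aX t).
have gV t : graded (velocity X t) by exact: (curve_graded (n := 1) gX).
have gA t : graded (jet X 2 t) by exact: (curve_graded (n := 2) gX).
have XX t : sform (position X t) (position X t) = 1 by have [] := HX t.
have XV := hyperbolic_velocity HX.
pose q t := sform (velocity X t) (velocity X t).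
(* A geodesic velocity is nonzero in body and tangent to the hyperboloid, so the weak inequality
   becomes strict. *)
have neg t : body (q t) < 0.
  rewrite lt_neqAle HV /=; apply: body_tangent_le0 (gX t) (gV t) _ _.
    by rewrite XX body1.
  by rewrite XV body0.
have [lam Hl EL] := critical_euler_lagrange aX neg crit.
have AE t : jet X 2 t = sscale (- lam t) (position X t).
  apply: crdP => i _; rewrite {1}crdZ mulNr; apply/eqP; rewrite -addr_eq0; apply/eqP.
  have := congr1 (fun Z => crd Z i) (EL t); rewrite /euler_lagrange crd0 {1}crdD.
  by rewrite {1}crdZ.
(* Differentiate [<X, X'> = 0] and insert [X'' = - lam X], with [<X, X> = 1]: the multiplier is
   determined by the curve. *)
have lamq t : lam t = q t.
  have D := gderiv_sform gX gV (jetP X 0) (jetP X 1).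
  have D0 : gderiv (fun r => sform (position X r) (velocity X r)) (fun _ => 0).
    by apply: (eq_gderiv (gderiv_cst 0)) => r; rewrite XV.
  have E0 := gderiv_unique D D0 t.
  have E1 : sform (position X t) (jet X 2 t) = - lam t.
    rewrite AE; apply: etrans (sformZr (evenN (Hl t)) (gX t) (gX t)) _.
    by rewrite XX mulr1.
  have X2 (x y l : superR R) : y = - l -> x + y = 0 -> l = x.
    by move=> -> /eqP; rewrite subr_eq0 => /eqP.
  exact: X2 E1 E0.
(* The derivative of [q] is twice [<X', X''>], a multiple of [<X', X> = 0]; conservation of speed is
   what makes the equation have constant coefficients. *)
have qE t : q t = q 0.
  have D := gderiv_sform gV gV (jetP X 1) (jetP X 1).
  apply: gderiv0_cst; apply: (gderiv_eq D) => r.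
  have E1 : sform (velocity X r) (jet X 2 r) = 0.
    rewrite AE; apply: etrans (sformZr (evenN (Hl r)) (gV r) (gX r)) _.
    have -> : sform (velocity X r) (position X r) = 0.
      by rewrite -(XV r); exact: sformC.
    by rewrite mulr0.
  have E2 : sform (jet X 2 r) (velocity X r) = 0 by rewrite -E1; exact: sformC.
  by rewrite E1 E2 addr0.
pose c := - q 0; pose k := gsqrt c.
have Hq0 : is_even (q 0) by apply: even_sform.
have Hc : is_even c by exact: evenN.
have c0 : 0 < body c by rewrite bodyN oppr_gt0.
have kk : k * k = c by exact: gsqrt_sqr.
have Hk : is_even k by exact: even_gsqrt.
have bk : 0 < body k by rewrite body_gsqrt sqrtr_gt0.
have bk0 : body k != 0 by rewrite gt_eqF.
have Hki : is_even (ginv k) by exact: even_ginv.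
have kiK : ginv k * k = 1 by rewrite -(even_comm _ Hk); exact: ginvM.
exists k, (sscale (ginv k) (velocity X 0) + position X 0),
          (sscale (- ginv k) (velocity X 0) + position X 0).
have aV : ambient h (velocity X 0) by exact: (curve_ambient 1 aX).
have q0 : sform (velocity X 0) (velocity X 0) = - (k * k) by rewrite kk opprK.
have ki2 : ginv k * (ginv k * (k * k)) = 1 by rewrite [ginv k * (k * k)]mulrA kiK mul1r.
split; first by [].
- by split; apply: ambientD => //; apply: ambientZ => //; exact: evenN.
- split.
  + apply: etrans (sform_frame Hki Hki (gV 0) (gX 0) (XX 0) (XV 0)) _.
    by rewrite q0 2!mulrN ki2 addNr.
  + apply: etrans (sform_frame (evenN Hki) (evenN Hki) (gV 0) (gX 0) (XX 0) (XV 0)) _.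
    by rewrite q0 [- ginv k * - _]mulrNN mulNr ki2 addNr.
  + apply: etrans (sform_frame Hki (evenN Hki) (gV 0) (gX 0) (XX 0) (XV 0)) _.
    by rewrite q0 [- ginv k * - _]mulrNN ki2.
- move=> t; rewrite exp_curve_position; apply: crdP => i i8.
  have dx := (sderivP _ _).1 (jetP X 0) i i8.
  have dv := (sderivP _ _).1 (jetP X 1) i i8.
  have dv' : gderiv (fun t => crd (jet X 1 t) i) (fun t => k * k * crd (jet X 0 t) i).
    apply: (gderiv_eq dv) => r; rewrite AE lamq qE kk; exact: crdZ.
  apply: etrans (linear_ode2 Hk bk0 dx dv' t) _.
  apply: etrans _ (esym (crd_comb _ _ _ _ i)); apply: congr1; apply: (congr2 +%R).
    by apply: congr1; rewrite {1}crdD {1}crdZ.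
  by apply: congr1; rewrite {1}crdD {1}crdZ.
- by move=> t; rewrite -/(q t) qE kk opprK.
Qed.

Lemma exp_curve_velocity_sform k E F t : is_even k ->
    graded E -> graded F ->
    sform E E = 0 -> sform F F = 0 -> sform E F = 2 ->
  sform (velocity (exp_curve k E F) t) (velocity (exp_curve k E F) t) = - (k * k).
Proof.
move=> Hk gE gF EE FF EF.
have Hg : is_even (gexp (t *: k)) by apply: even_gexp; exact: evenZ.
have Hg' : is_even (gexp (t *: (- k))).
  by apply: even_gexp; apply: evenZ; exact: evenN.
have gg : gexp (t *: k) * gexp (t *: (- k)) = 1.
  by rewrite scalerN; apply: gexpV; exact: evenZ.
have Ha : is_even (k ^+ 1 * gexp (t *: k)) by apply: evenM => //; exact: evenX.
have Hb : is_even ((- k) ^+ 1 * gexp (t *: (- k))).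
  by apply: evenM => //; apply: evenX; exact: evenN.
apply: etrans (sform_comb Ha Hb Ha Hb gE gF EE FF EF) _.
have X2 (g g' : superR R) : is_even g -> is_even g' -> g * g' = 1 ->
    k ^+ 1 * g * ((- k) ^+ 1 * g') = - (k * k).
  move=> Eg Eg' gg'; rewrite !expr1 mulNr mulrN; apply: congr1.
  by rewrite -mulrA (mulrA g k) (even_comm k Eg) -mulrA gg' mulr1.
by apply: half_comm_sum Hb _; exact: X2.
Qed.

Lemma body_crd_comb a b E F i : body (crd (comb a b E F) i) =
  2^-1 * (body a * body (crd E i) + body b * body (crd F i)).
Proof. by rewrite crd_comb bodyZ bodyD {1}bodyM {1}bodyM. Qed.

Lemma gexp_gt0 a : 0 < body (gexp a).
Proof. by rewrite body_gexp; exact: expR_gt0. Qed.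

Lemma body_time X : body (x1 X + x2 X) = body (crd X 0) + body (crd X 1).
Proof. exact: bodyD. Qed.

Lemma exp_jet_algebra (A : algType R) (kk g g' x y : A) :
  2^-1 *: (kk ^+ 2 * g * x + (- kk) ^+ 2 * g' * y) +
  - (kk * kk) * (2^-1 *: (kk ^+ 0 * g * x + (- kk) ^+ 0 * g' * y)) = 0.
Proof.
rewrite !expr0 !mul1r sqrrN -expr2 mulNr -scalerAr mulrDr !mulrA.
exact: subrr.
Qed.

Lemma exp_curve_geodesic k E F : is_even k -> 0 < body k ->
    light_cone h E -> light_cone h F -> sform E F = 2 ->
  geodesic_curve h (exp_curve k E F).
Proof.
move=> Hk k0 [aE EE E0] [aF FF F0] EF.
have gE := ambient_graded aE; have gF := ambient_graded aF.
have Hg t : is_even (gexp (t *: k)) by apply: even_gexp; exact: evenZ.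
have Hg' t : is_even (gexp (t *: (- k))).
  by apply: even_gexp; apply: evenZ; exact: evenN.
have aP t : ambient h (position (exp_curve k E F) t).
  by rewrite exp_curve_position; exact: ambient_comb.
have VV t := exp_curve_velocity_sform t Hk gE gF EE FF EF.
have kk0 : 0 < body (k * k) by rewrite bodyM mulr_gt0.
split.
- move=> t; split; first exact: aP.
    rewrite exp_curve_position.
    apply: etrans (sform_comb (Hg t) (Hg' t) (Hg t) (Hg' t) gE gF EE FF EF) _.
    have gg : gexp (t *: k) * gexp (t *: (- k)) = 1.
      by rewrite scalerN; apply: gexpV; exact: evenZ.
    exact: half_comm_sum (Hg' t) gg.
  rewrite exp_curve_position body_time {1}body_crd_comb {1}body_crd_comb.
  move: E0 F0; rewrite {1}body_time {1}body_time => E0 F0.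
  have X2 (g g' p q r s : R) : 0 < g -> 0 < g' -> 0 < p + q -> 0 < r + s ->
      0 < 2^-1 * (g * p + g' * r) + 2^-1 * (g * q + g' * s).
    move=> g0 g0' pq rs.
    rewrite -mulrDr pmulr_rgt0 ?invr_gt0 // addrACA -2!mulrDr.
    by apply: addr_gt0; exact: mulr_gt0.
  exact: X2 (gexp_gt0 _) (gexp_gt0 _) E0 F0.
- by move=> t; rewrite VV bodyN oppr_eq0 gt_eqF.
(* The multiplier is the constant value of [<X', X'>]; it cancels [X'' = k^2 X]. *)
refine (@euler_lagrange_critical R h (exp_curve k E F) aP _ (fun _ => - (k * k)) _ _ _).
- by move=> t; rewrite VV bodyN oppr_lt0.
- by move=> t; apply: evenN; exact: evenM.
- by apply: gderiv_continuous; exact: gderiv_cst.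
- move=> t; apply: crdP => i _; apply: etrans _ (esym (crd0 R i)).
  have S := etrans (crdZ (- (k * k)) (exp_jet k E F 0 t) i)
    (congr1 _ (crd_comb _ _ E F i)).
  apply: etrans (crdD _ _ i) _.
  apply: etrans (congr2 +%R (crd_comb _ _ E F i) S) _.
  exact: exp_jet_algebra.
Qed.

End Classification.

(** * Polynomial identities behind the constants of the chord *)

Section ChordAlgebra.
(** Division is replaced by its defining relations: [s], [w] and [r] are the inverses of [l - 1],
    [l + 1] and [2 l]. *)
Variables (A : comNzRingType) (d l r s w : A).
Hypotheses (Hs : (l - 1) * s = 1) (Hw : (l + 1) * w = 1).
Hypotheses (Hd : l * l * (d - 1) = d + 1) (Hr : 2 * l * r = 1).

Let T := (l + 1) * s.
Let Ti := (l - 1) * w.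
Let M := (l - 1) * r.
Let N := (l + 1) * r.

Lemma chord_mulTi : T * Ti = 1.
Proof.
transitivity (((l - 1) * s) * ((l + 1) * w)); first by rewrite /T /Ti; ring.
by rewrite Hs Hw mulr1.
Qed.

(** Over the common denominator [l^2 - 1] the sum is [2 (l^2 + 1) / (l^2 - 1)], which is [2 d] for
    [l^2 = (d + 1) / (d - 1)]. *)
Lemma chord_addTi : T + Ti = 2 * d.
Proof.
have E1 : T = (l + 1) * (l + 1) * (s * w).
  transitivity ((l + 1) * s * ((l + 1) * w)); last by ring.
  by rewrite Hw mulr1.
have E2 : Ti = (l - 1) * (l - 1) * (s * w).
  transitivity ((l - 1) * w * ((l - 1) * s)); last by ring.
  by rewrite Hs mulr1.
have E3 : 2 * d = 2 * d * (((l - 1) * s) * ((l + 1) * w)).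
  by rewrite Hs Hw !mulr1.
apply/eqP; rewrite -subr_eq0 E1 E2 {}E3; apply/eqP.
transitivity (s * w * 2 * ((d + 1) - l * l * (d - 1))); first by ring.
by rewrite Hd subrr mulr0.
Qed.

Lemma chord_sum2 : M * (1 - l) + N * (1 + l) = 2.
Proof.
transitivity (2 * (2 * l * r)); first by rewrite /M /N; ring.
by rewrite Hr mulr1.
Qed.

Lemma chord_sum0 : M * (1 + l) + N * (1 - l) = 0.
Proof. by rewrite /M /N; ring. Qed.

Lemma chord_mulTM : T * M = N.
Proof.
transitivity ((l - 1) * s * N); first by rewrite /T /M /N; ring.
by rewrite Hs mul1r.
Qed.

Lemma chord_mulTiN : Ti * N = M.
Proof.
transitivity ((l + 1) * w * M); first by rewrite /Ti /M /N; ring.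
by rewrite Hw mul1r.
Qed.

(** The bracket has the shape in which [sform_lin2] expands the square of [(1 - l) P + (1 + l) Q],
    and equals [2 ((d + 1) - l^2 (d - 1))]. Nullity of this vector is what dictates the value of
    [l]. *)
Lemma chord_null (m : A) : m * (m * ((1 - l) * ((1 - l) * 1) +
  (1 - l) * ((1 + l) * d) + ((1 + l) * ((1 - l) * d) + (1 + l) * ((1 + l) * 1)))) = 0.
Proof.
transitivity (m * m * 2 * ((d + 1) - l * l * (d - 1))); first by ring.
by rewrite Hd subrr mulr0.
Qed.

Lemma chord_null' (m : A) : m * (m * ((1 + l) * ((1 + l) * 1) +
  (1 + l) * ((1 - l) * d) + ((1 - l) * ((1 + l) * d) + (1 - l) * ((1 - l) * 1)))) = 0.
Proof.
transitivity (m * m * 2 * ((d + 1) - l * l * (d - 1))); first by ring.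
by rewrite Hd subrr mulr0.
Qed.

(** The bracket equals [4 (d + 1)], and [M N = (l^2 - 1) / (4 l^2)] where
    [(l^2 - 1) (d + 1) = 2 l^2]. *)
Lemma chord_pair : M * (N * ((1 - l) * ((1 + l) * 1) +
  (1 - l) * ((1 - l) * d) + ((1 + l) * ((1 + l) * d) + (1 + l) * ((1 - l) * 1)))) = 2.
Proof.
set q := _ + _; have -> : q = 4 * (d + 1).
  apply/eqP; rewrite -subr_eq0; apply/eqP.
  transitivity (2 * (l * l * (d - 1) - (d + 1))); first by rewrite /q; ring.
  by rewrite Hd subrr mulr0.
have K : (l * l - 1) * (d + 1) = 2 * (l * l).
  apply/eqP; rewrite -subr_eq0; apply/eqP.
  transitivity (l * l * (d - 1) - (d + 1)); first by ring.
  by rewrite Hd subrr.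
transitivity (4 * (r * r) * ((l * l - 1) * (d + 1))); first by rewrite /M /N; ring.
rewrite K; transitivity (2 * ((2 * l * r) * (2 * l * r))); first by ring.
by rewrite Hr !mulr1.
Qed.

Lemma hyperbola_inj (u u' v v' : A) : u * u' = 1 -> v * v' = 1 ->
  u + u' = v + v' -> (1 - u' * v') * (u - v) = 0.
Proof.
move=> Hu Hv E.
transitivity (u - v - (u * u') * v' + (v * v') * u'); first by ring.
rewrite Hu Hv !mul1r; transitivity (u + u' - (v + v')); first by ring.
by rewrite E subrr.
Qed.

End ChordAlgebra.

(** * The null frame spanned by two points *)

Section Chord.
Variables (R : realType) (h : dimension) (P Q : superspace R).
Hypotheses (HP : hyperbolic h P) (HQ : hyperbolic h Q).
Hypothesis dPQ : 1 < body (sform P Q).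
Implicit Types (a b k s t u v : superR R).
Local Open Scope classical_set_scope.

Definition chord_d : superR R := sform P Q.
Definition chord_l : superR R := gsqrt ((chord_d + 1) * ginv (chord_d - 1)).
Definition chord_T : superR R := (chord_l + 1) * ginv (chord_l - 1).
Definition chord_M : superR R := (chord_l - 1) * ginv (2 * chord_l).
Definition chord_N : superR R := (chord_l + 1) * ginv (2 * chord_l).
Definition chord_E : superspace R :=
  sscale chord_M (sscale (1 - chord_l) P + sscale (1 + chord_l) Q).
Definition chord_F : superspace R :=
  sscale chord_N (sscale (1 + chord_l) P + sscale (1 - chord_l) Q).

Notation d := chord_d.
Notation l := chord_l.
Notation T := chord_T.
Notation M := chord_M.
Notation N := chord_N.
Notation E := chord_E.
Notation F := chord_F.

Lemma chord_gP : graded P.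
Proof. by case: HP => /ambient_graded. Qed.

Lemma chord_gQ : graded Q.
Proof. by case: HQ => /ambient_graded. Qed.

Lemma chord_d_even : is_even d.
Proof. apply: even_sform; [exact: chord_gP | exact: chord_gQ]. Qed.

Lemma chord_dB1_even : is_even (d - 1).
Proof. apply: evenB; [exact: chord_d_even | exact: even1]. Qed.

Lemma chord_dD1_even : is_even (d + 1).
Proof. apply: evenD; [exact: chord_d_even | exact: even1]. Qed.

Lemma chord_dB1_gt0 : 0 < body (d - 1).
Proof. by rewrite bodyB body1 subr_gt0. Qed.

Lemma chord_arg_even : is_even ((d + 1) * ginv (d - 1)).
Proof. apply: evenM chord_dD1_even _; exact: even_ginv chord_dB1_even. Qed.

Lemma chord_arg_gt1 : 1 < body ((d + 1) * ginv (d - 1)).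
Proof.
rewrite bodyM body_ginv ltr_pdivlMr; last exact: chord_dB1_gt0.
by rewrite mul1r bodyB bodyD body1 ltrD2l; lra.
Qed.

Lemma chord_l_even : is_even l.
Proof. exact: even_gsqrt chord_arg_even. Qed.

Lemma chord_l_gt1 : 1 < body l.
Proof.
rewrite body_gsqrt -[ltLHS]sqrtr1 ltr_sqrt; first exact: chord_arg_gt1.
by apply: lt_trans chord_arg_gt1.
Qed.

Lemma chord_l_sqr : l * l * (d - 1) = d + 1.
Proof.
have A0 : 0 < body ((d + 1) * ginv (d - 1)) by apply: lt_trans chord_arg_gt1.
have I1 : ginv (d - 1) * (d - 1) = 1.
  apply: etrans (even_comm _ (even_ginv chord_dB1_even)) _.
  by apply: ginvM chord_dB1_even _; rewrite gt_eqF // chord_dB1_gt0.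
apply: etrans (congr1 (fun u => u * (d - 1)) (gsqrt_sqr A0)) _.
by rewrite -mulrA I1 mulr1.
Qed.

Lemma chord_lB1_even : is_even (l - 1).
Proof. apply: evenB; [exact: chord_l_even | exact: even1]. Qed.

Lemma chord_lD1_even : is_even (l + 1).
Proof. apply: evenD; [exact: chord_l_even | exact: even1]. Qed.

Lemma chord_2l_even : is_even (2 * l).
Proof.
rewrite mulr_natl mulr2n; apply: evenD; exact: chord_l_even.
Qed.

Lemma chord_lB1_inv : (l - 1) * ginv (l - 1) = 1.
Proof.
apply: ginvM chord_lB1_even _.
by rewrite bodyB body1 subr_eq0 gt_eqF // chord_l_gt1.
Qed.

Lemma chord_lD1_inv : (l + 1) * ginv (l + 1) = 1.
Proof.
apply: ginvM chord_lD1_even _.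
by rewrite bodyD body1 gt_eqF //; have := chord_l_gt1; lra.
Qed.

Lemma chord_2l_inv : 2 * l * ginv (2 * l) = 1.
Proof.
apply: ginvM chord_2l_even _; rewrite mulr_natl mulr2n bodyD gt_eqF //.
by have := chord_l_gt1; lra.
Qed.

(** The inverse of [T], written without [ginv T] so that the relations for [l - 1] and [l + 1]
    suffice to compute with it. *)
Definition chord_Ti : superR R := (l - 1) * ginv (l + 1).
Notation Ti := chord_Ti.

Lemma chord_identities :
  [/\ T * Ti = 1, T + Ti = 2 * d, T * M = N, Ti * N = M &
  [/\ M * (1 - l) + N * (1 + l) = 2, M * (1 + l) + N * (1 - l) = 0 &
  [/\ M * (M * ((1 - l) * ((1 - l) * 1) + (1 - l) * ((1 + l) * d) +
       ((1 + l) * ((1 - l) * d) + (1 + l) * ((1 + l) * 1)))) = 0,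
     N * (N * ((1 + l) * ((1 + l) * 1) + (1 + l) * ((1 - l) * d) +
       ((1 - l) * ((1 + l) * d) + (1 - l) * ((1 - l) * 1)))) = 0 &
     M * (N * ((1 - l) * ((1 + l) * 1) + (1 - l) * ((1 - l) * d) +
       ((1 + l) * ((1 + l) * d) + (1 + l) * ((1 - l) * 1)))) = 2]]].
Proof.
rewrite /T /Ti /M /N.
have := chord_2l_inv; have := chord_l_sqr; have := chord_lD1_inv; have := chord_lB1_inv.
(* All quantities are even, so they are lifted together to the commutative ring, where the chord
   identities apply. *)
have [d' ->] := even_partP chord_d_even.
have [r' ->] := even_partP (even_ginv chord_2l_even).
have [s' ->] := even_partP (even_ginv chord_lB1_even).
have [w' ->] := even_partP (even_ginv chord_lD1_even).
have [l' ->] := even_partP chord_l_even.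
move=> Hs Hw Hd Hr.
have Hs' : (l' - 1) * s' = 1 by apply: val_inj.
have Hw' : (l' + 1) * w' = 1 by apply: val_inj.
have Hd' : l' * l' * (d' - 1) = d' + 1 by apply: val_inj.
have Hr' : 2 * l' * r' = 1 by apply: val_inj.
split; last split; last split.
- exact: (congr1 val (chord_mulTi Hs' Hw')).
- exact: (congr1 val (chord_addTi Hs' Hw' Hd')).
- exact: (congr1 val (chord_mulTM r' Hs')).
- exact: (congr1 val (chord_mulTiN r' Hw')).
- exact: (congr1 val (chord_sum2 Hr')).
- exact: (congr1 val (chord_sum0 l' r')).
- exact: (congr1 val (chord_null Hd' ((l' - 1) * r'))).
- exact: (congr1 val (chord_null' Hd' ((l' + 1) * r'))).
- exact: (congr1 val (chord_pair Hd' Hr')).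
Qed.

Lemma chord_TTi : T * Ti = 1. Proof. by case: chord_identities. Qed.
Lemma chord_TDTi : T + Ti = 2 * d. Proof. by case: chord_identities. Qed.

Lemma chord_T_even : is_even T.
Proof. apply: evenM chord_lD1_even _; exact: even_ginv chord_lB1_even. Qed.

Lemma chord_Ti_even : is_even Ti.
Proof. apply: evenM chord_lB1_even _; exact: even_ginv chord_lD1_even. Qed.

Lemma chord_M_even : is_even M.
Proof. apply: evenM chord_lB1_even _; exact: even_ginv chord_2l_even. Qed.

Lemma chord_N_even : is_even N.
Proof. apply: evenM chord_lD1_even _; exact: even_ginv chord_2l_even. Qed.

Lemma chord_T_gt1 : 1 < body T.
Proof.
have l1 := chord_l_gt1.
have B0 : 0 < body (l - 1) by rewrite bodyB body1 subr_gt0.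
rewrite bodyM body_ginv ltr_pdivlMr // mul1r bodyB bodyD body1; lra.
Qed.

Lemma chord_T_gt0 : 0 < body T.
Proof. exact: lt_trans chord_T_gt1. Qed.

Lemma chord_ginvT : ginv T = Ti.
Proof.
apply: ginv_unique chord_T_even _ chord_TTi.
by rewrite gt_eqF // chord_T_gt0.
Qed.

Lemma chord_1Bl_even : is_even (1 - l).
Proof. apply: evenB; [exact: even1 | exact: chord_l_even]. Qed.

Lemma chord_1Dl_even : is_even (1 + l).
Proof. apply: evenD; [exact: even1 | exact: chord_l_even]. Qed.

Lemma lin_coeff (A : pzRingType) (m n x y p q : A) :
  m * (x * p + y * q) + n * (y * p + x * q) =
  (m * x + n * y) * p + (m * y + n * x) * q.
Proof. by rewrite !mulrDr !mulrDl !mulrA addrACA. Qed.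

Lemma crd_scale_lin2 a b c (X Y : superspace R) i :
  crd (sscale a (sscale b X + sscale c Y)) i = a * (b * crd X i + c * crd Y i).
Proof.
apply: etrans (crdZ _ _ i) _; apply: congr1.
apply: etrans (crdD _ _ i) _; apply: (congr2 +%R); exact: crdZ.
Qed.

Lemma two_mul_half (A : algType R) (x y : A) : 2^-1 *: (2 * x + 0 * y) = x.
Proof.
by rewrite mul0r addr0 mulr_natl -(scaler_nat 2 x) scalerA mulVf ?pnatr_eq0 // scale1r.
Qed.

Lemma two_mul_half' (A : algType R) (x y : A) : 2^-1 *: (0 * x + 2 * y) = y.
Proof. by rewrite addrC; exact: two_mul_half. Qed.

Lemma chord_P : comb 1 1 E F = P.
Proof.
have [_ _ _ _ [S2 S0 _]] := chord_identities.
apply: crdP => i _; apply: etrans (crd_comb _ _ _ _ i) _.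
rewrite {1}mul1r {1}mul1r.
apply: etrans (congr2 (fun u v => 2^-1 *: (u + v)) (crd_scale_lin2 _ _ _ _ _ i)
  (crd_scale_lin2 _ _ _ _ _ i)) _.
apply: etrans (congr1 _ (lin_coeff _ _ _ _ _ _)) _.
apply: etrans (congr2 (fun u v => 2^-1 *: (u * _ + v * _)) S2 S0) _.
exact: two_mul_half.
Qed.

(** Multiplying [E] by [T] and [F] by [Ti] exchanges the normalizations [M] and [N], which turns the
    computation for [P] into the one for [Q]. *)
Lemma chord_Q : comb T Ti E F = Q.
Proof.
have [_ _ TM TiN [S2 S0 _]] := chord_identities.
apply: crdP => i _; apply: etrans (crd_comb _ _ _ _ i) _.
apply: etrans (congr2 (fun u v => 2^-1 *: (T * u + Ti * v))
  (crd_scale_lin2 _ _ _ _ _ i) (crd_scale_lin2 _ _ _ _ _ i)) _.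
apply: etrans (congr2 (fun u v => 2^-1 *: (u + v)) (mulrA _ _ _) (mulrA _ _ _)) _.
apply: etrans (congr2 (fun u v => 2^-1 *: (u * _ + v * _)) TM TiN) _.
apply: etrans (congr1 _ (lin_coeff _ _ _ _ _ _)) _.
have S0' : N * (1 - l) + M * (1 + l) = 0 by rewrite addrC.
have S2' : N * (1 + l) + M * (1 - l) = 2 by rewrite addrC.
apply: etrans (congr2 (fun u v => 2^-1 *: (u * _ + v * _)) S0' S2') _.
exact: two_mul_half'.
Qed.

Lemma chord_aE : ambient h E.
Proof.
have [aP _ _] := HP; have [aQ _ _] := HQ.
apply: ambientZ chord_M_even _; apply: ambientD.
  exact: ambientZ chord_1Bl_even aP.
exact: ambientZ chord_1Dl_even aQ.
Qed.

Lemma chord_aF : ambient h F.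
Proof.
have [aP _ _] := HP; have [aQ _ _] := HQ.
apply: ambientZ chord_N_even _; apply: ambientD.
  exact: ambientZ chord_1Dl_even aP.
exact: ambientZ chord_1Bl_even aQ.
Qed.

Lemma chord_gE : graded E. Proof. exact: ambient_graded chord_aE. Qed.
Lemma chord_gF : graded F. Proof. exact: ambient_graded chord_aF. Qed.

Lemma chord_forms : [/\ sform E E = 0, sform F F = 0 & sform E F = 2].
Proof.
have [_ _ _ _ [_ _ [EE FF EF]]] := chord_identities.
have [_ PP _] := HP; have [_ QQ _] := HQ.
have gP := chord_gP; have gQ := chord_gQ.
have Hm := chord_1Bl_even; have Hp := chord_1Dl_even.
have HM := chord_M_even; have HN := chord_N_even.
have g1 := gradedD (gradedZ Hm gP) (gradedZ Hp gQ).
have g2 := gradedD (gradedZ Hp gP) (gradedZ Hm gQ).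
split.
- apply: etrans (sform_scale2 HM HM g1 g1) _.
  apply: etrans (congr1 (fun u => M * (M * u)) (sform_lin2 Hm Hp Hm Hp gP gQ PP erefl QQ)) _.
  exact: EE.
- apply: etrans (sform_scale2 HN HN g2 g2) _.
  apply: etrans (congr1 (fun u => N * (N * u)) (sform_lin2 Hp Hm Hp Hm gP gQ PP erefl QQ)) _.
  exact: FF.
- apply: etrans (sform_scale2 HM HN g1 g2) _.
  apply: etrans (congr1 (fun u => M * (N * u)) (sform_lin2 Hm Hp Hp Hm gP gQ PP erefl QQ)) _.
  exact: EF.
Qed.

Lemma null_future (X Y Z : superspace R) : graded X -> graded Y ->
    sform X X = 0 -> sform Y Y = 0 -> sform X Y = 2 ->
    comb 1 1 X Y = Z -> 0 < body (x1 Z + x2 Z) ->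
  0 < body (x1 X + x2 X).
Proof.
move=> gX gY XX YY XY EZ; rewrite {1}body_time => Z0; rewrite {1}body_time.
have b2 : body (2 : superR R) = 2 by rewrite bodyD body1.
apply: (lorentz_null_future
  (etrans (esym (body_sform gX gX)) (etrans (congr1 _ XX) body0))
  (etrans (esym (body_sform gY gY)) (etrans (congr1 _ YY) body0))
  (etrans (esym (body_sform gX gY)) (etrans (congr1 _ XY) b2))).
have C i : body (crd Z i) = 2^-1 * (1 * body (crd X i) + 1 * body (crd Y i)).
  by rewrite -EZ {1}body_crd_comb body1.
have X2 (z0 z1 x0 x1' y0 y1 : R) : z0 = 2^-1 * (1 * x0 + 1 * y0) ->
   z1 = 2^-1 * (1 * x1' + 1 * y1) -> 0 < z0 + z1 -> 0 < x0 + x1' + (y0 + y1).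
  by move=> -> ->; lra.
exact: X2 (C 0%N) (C 1%N) Z0.
Qed.

Lemma chord_lightE : light_cone h E.
Proof.
have [EE FF EF] := chord_forms; split => //; first exact: chord_aE.
by have [_ _] := HP; exact: (null_future chord_gE chord_gF EE FF EF chord_P).
Qed.

Lemma chord_lightF : light_cone h F.
Proof.
have [EE FF EF] := chord_forms; split => //; first exact: chord_aF.
have FE : sform F E = 2 by rewrite -EF; exact: sformC chord_gF chord_gE.
have [_ _] := HP; apply: (null_future chord_gF chord_gE FF EE FE).
exact: etrans (combC _ _ _ _) chord_P.
Qed.

End Chord.

(** * Two points determine the frame and the parameter difference *)

Section ChordUniqueness.

Lemma inv_lt_self (F : realFieldType) (x : F) : 1 < x -> x^-1 < x.
Proof.
move=> x1; apply: lt_trans (x1); rewrite invf_lt1 //; exact: lt_trans x1.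
Qed.

Lemma inv_mul_lt1 (F : realFieldType) (x y : F) : 1 < x -> 1 < y -> x^-1 * y^-1 < 1.
Proof.
move=> X1 Y1; have x0 := lt_trans ltr01 X1; have y0 := lt_trans ltr01 Y1.
by apply: mulr_ilt1; rewrite ?invr_ge0 ?(ltW x0) ?(ltW y0) // invf_lt1.
Qed.

Variables (R : realType) (h : dimension) (P Q : superspace R).
Hypotheses (HP : hyperbolic h P) (HQ : hyperbolic h Q).
Hypothesis dPQ : 1 < body (sform P Q).
Implicit Types (a b k s t u v : superR R) (X Y : superspace R).
Local Open Scope classical_set_scope.

Notation d := (chord_d P Q).
Notation T := (chord_T P Q).
Notation Ti := (chord_Ti P Q).
Notation E := (chord_E P Q).
Notation F := (chord_F P Q).

Lemma gexp_subM (a b : superR R) : is_even a -> is_even b ->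
  gexp (a - b) * gexp b = gexp a.
Proof.
move=> Ha Hb; apply: etrans (esym (gexpD (evenB Ha Hb) Hb)) _.
exact: (congr1 _ (subrK b a)).
Qed.

Lemma scale_half_inj (W : lmodType R) (x y : W) : 2^-1 *: x = 2^-1 *: y -> x = y.
Proof.
move=> H; have := congr1 (fun u : W => (2 : R) *: u) H.
by rewrite !scalerA mulfV ?pnatr_eq0 // !scale1r.
Qed.

(** A two by two linear system whose determinant is, up to sign, [T - Ti]; its body is that of [T]
    minus the inverse, nonzero since the body of [T] exceeds 1. *)
Lemma comb_inj (X Y X' Y' : superspace R) :
    comb 1 1 X Y = comb 1 1 X' Y' -> comb T Ti X Y = comb T Ti X' Y' ->
  X = X' /\ Y = Y'.
Proof.
move=> H1 HT.
have T_even := chord_T_even HP HQ; have Ti_even := chord_Ti_even HP HQ.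
have C u v i : comb u v X Y = comb u v X' Y' ->
    u * crd X i + v * crd Y i = u * crd X' i + v * crd Y' i.
  move=> H; apply: scale_half_inj.
  exact: etrans (esym (crd_comb u v X Y i))
    (etrans (congr1 (fun Z => crd Z i) H) (crd_comb u v X' Y' i)).
have TTi_even : is_even (T - Ti) by exact: evenB.
have T1 := chord_T_gt1 dPQ.
have bTi : body Ti = (body T)^-1.
  by rewrite -(chord_ginvT HP HQ dPQ) body_ginv.
have TTi0 : body (T - Ti) != 0.
  have -> : body (T - Ti) = body T - (body T)^-1.
    exact: etrans (bodyB T Ti) (congr1 (fun z => body T - z) bTi).
  by move: T1; clear; move: (body T) => x x1; rewrite subr_eq0 gt_eqF // inv_lt_self.
have EX i : crd X i = crd X' i.
  apply: (mulrI_body TTi_even TTi0).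
  have X2 (A : pzRingType) (a b x y x' y' : A) : 1 * x + 1 * y = 1 * x' + 1 * y' ->
      a * x + b * y = a * x' + b * y' -> (a - b) * x = (a - b) * x'.
    rewrite !mul1r => E1 E2.
    have <- : a * x + b * y - b * (x + y) = (a - b) * x.
      by rewrite mulrDr opprD addrACA subrr addr0 mulrBl.
    by rewrite E1 E2 mulrDr opprD addrACA subrr addr0 mulrBl.
  exact: X2 (C 1 1 i H1) (C T Ti i HT).
split; apply: crdP => i _; first exact: EX.
have := C 1 1 i H1; rewrite EX => /addrI.
by rewrite {1}mul1r {1}mul1r.
Qed.

Lemma chord_unique (X Y : superspace R) (alpha beta : superR R) :
    is_even alpha -> is_even beta -> graded X -> graded Y ->
    sform X X = 0 -> sform Y Y = 0 -> sform X Y = 2 ->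
    comb (gexp alpha) (gexp (- alpha)) X Y = P ->
    comb (gexp beta) (gexp (- beta)) X Y = Q ->
    0 < body (beta - alpha) ->
  [/\ gexp (beta - alpha) = T, sscale (gexp alpha) X = E &
      sscale (gexp (- alpha)) Y = F].
Proof.
move=> Ha Hb gX gY XX YY XY EP EQ ab0.
have T_even := chord_T_even HP HQ; have Ti_even := chord_Ti_even HP HQ.
have HNa := evenN Ha; have HNb := evenN Hb.
pose w := gexp (beta - alpha); pose wi := gexp (alpha - beta).
have Hw : is_even w by apply: even_gexp; exact: evenB.
have Hwi : is_even wi by apply: even_gexp; exact: evenB.
have wE : w = gexp (- alpha) * gexp beta by rewrite /w addrC; exact: gexpD.
have wiE : wi = gexp alpha * gexp (- beta) by exact: gexpD.
have wwi : w * wi = 1.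
  by rewrite /wi -(opprB beta alpha); apply: gexpV; exact: evenB.
have w1 : 1 < body w by rewrite body_gexp expR_gt1.
(* [d] is evaluated as the form of the two points in the frame [X], [Y], which leaves only the
   difference of their parameters. *)
have wsum : w + wi = 2 * d.
  have S := sform_comb (even_gexp Ha) (even_gexp HNa) (even_gexp Hb)
    (even_gexp HNb) gX gY XX YY XY.
  have -> : d = 2^-1 *: (wi + w).
    rewrite wE wiE; apply: etrans _ S.
    exact: (congr2 (@sform R) (esym EP) (esym EQ)).
  rewrite mulr_natl mulr2n -scalerDr scale_half_double; exact: addrC.
have T1 := chord_T_gt1 dPQ.
have TTi := chord_TTi HP HQ dPQ.
have wT : w = T.
  (* Both [w] and [T] have body above 1, so the product of their inverses has body below 1. *)
  have c0 : body (1 - wi * Ti) != 0.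
    have bw : body wi = (body w)^-1.
      apply: (mulfI (x := body w)); first by rewrite gt_eqF //; lra.
      by rewrite -bodyM wwi body1 mulfV // gt_eqF //; lra.
    have bT : body Ti = (body T)^-1.
      by rewrite -(chord_ginvT HP HQ dPQ) body_ginv.
    by rewrite bodyB body1 bodyM bw bT subr_eq0 gt_eqF // inv_mul_lt1.
  have Hc : is_even (1 - wi * Ti).
    by apply: evenB; [exact: even1 | exact: evenM].
  have E1 : w + wi = T + Ti by rewrite wsum (chord_TDTi HP HQ dPQ).
  apply/eqP; rewrite -subr_eq0; apply/eqP; apply: (mulrI_body Hc c0).
  rewrite mulr0; move: wwi TTi E1 {wE wiE}.
  have [w' ->] := even_partP Hw; have [wi' ->] := even_partP Hwi.
  have [T' ->] := even_partP T_even; have [Ti' ->] := even_partP Ti_even.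
  move=> Hww HTT E1.
  have Hww' : w' * wi' = 1 by apply: val_inj.
  have HTT' : T' * Ti' = 1 by apply: val_inj.
  have E1' : w' + wi' = T' + Ti' by apply: val_inj.
  exact: (congr1 val (hyperbola_inj Hww' HTT' E1')).
have wiTi : wi = Ti.
  have w0 : body w != 0 by rewrite gt_eqF // (lt_trans ltr01 w1).
  exact: etrans (esym (ginv_unique Hw w0 wwi))
    (etrans (congr1 (@ginv R) wT) (chord_ginvT HP HQ dPQ)).
(* Rescaling the frame moves the origin of the parameter to [P], so that both frames meet [P] at 1
   and [Q] at [T]. *)
have EP' : comb 1 1 (sscale (gexp alpha) X) (sscale (gexp (- alpha)) Y) = comb 1 1 E F.
  apply: etrans (esym (comb_scale _ _ _ _ _ _)) _.
  rewrite {1}mul1r {1}mul1r; apply: etrans EP _.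
  exact: esym (chord_P HP HQ dPQ).
have EQ' : comb T Ti (sscale (gexp alpha) X) (sscale (gexp (- alpha)) Y) = comb T Ti E F.
  apply: etrans (esym (comb_scale _ _ _ _ _ _)) _.
  have A1 : T * gexp alpha = gexp beta.
    exact: etrans (congr1 (fun z => z * gexp alpha) (esym wT)) (gexp_subM Hb Ha).
  have A2 : Ti * gexp (- alpha) = gexp (- beta).
    apply: etrans (congr1 (fun z => z * gexp (- alpha)) (esym wiTi)) _.
    apply: etrans (congr1 (fun z => gexp z * gexp (- alpha)) _) (gexp_subM HNb HNa).
    by rewrite opprK addrC.
  apply: etrans (congr2 (fun u v => comb u v X Y) A1 A2) _.
  exact: etrans EQ (esym (chord_Q HP HQ dPQ)).
have [EX EY] := comb_inj EP' EQ'.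
exact: And3 wT EX EY.
Qed.

End ChordUniqueness.

(** * Geodesics through two points *)

Section ChordGeodesics.
Variables (R : realType) (h : dimension) (P Q : superspace R).
Hypotheses (HP : hyperbolic h P) (HQ : hyperbolic h Q).
Hypothesis dPQ : 1 < body (sform P Q).
Implicit Types (a b k s t u v : superR R) (X Y : superspace R).
Local Open Scope classical_set_scope.

Notation d := (chord_d P Q).
Notation T := (chord_T P Q).
Notation Ti := (chord_Ti P Q).
Notation E := (chord_E P Q).
Notation F := (chord_F P Q).

(** Excludes parameters with equal bodies: the form of the two points would have body 1, against
    distinctness. *)
Lemma body_gexp_pair a b : body a = body b ->
  body (2^-1 *: (gexp a * gexp (- b) + gexp (- a) * gexp b)) = 1.
Proof.
move=> ab; rewrite {1}bodyZ {1}bodyD {1}bodyM {1}bodyM 4!{1}body_gexp.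
by rewrite 2!{1}bodyN ab -!expRD subrr addNr expR0 -mulr2n mulVf.
Qed.

Lemma chord_line_shift k X Y s1 s : is_even k -> is_even s1 -> is_even s ->
    sscale (gexp (s1 * k)) X = E -> sscale (gexp (- (s1 * k))) Y = F ->
  comb (gexp (s * k)) (gexp (- (s * k))) X Y =
  comb (gexp ((s - s1) * k)) (gexp (- ((s - s1) * k))) E F.
Proof.
move=> Hk H1 Hs EX EY.
have Hsk := evenM Hs Hk; have H1k := evenM H1 Hk.
have B : (s - s1) * k = s * k - s1 * k by exact: mulrBl.
have D1 : gexp (s * k) = gexp ((s - s1) * k) * gexp (s1 * k).
  by rewrite B; exact: esym (gexp_subM Hsk H1k).
have D2 : gexp (- (s * k)) = gexp (- ((s - s1) * k)) * gexp (- (s1 * k)).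
  by rewrite B opprD; exact: esym (gexp_subM (evenN Hsk) (evenN H1k)).
apply: etrans (congr2 (fun u v : superR R => comb u v X Y) D1 D2) _.
apply: etrans (comb_scale _ _ _ _ _ _) _.
exact: (congr2 (comb (gexp ((s - s1) * k)) (gexp (- ((s - s1) * k)))) EX EY).
Qed.

(** The body of [k] is only nonzero: it is negative when the curve passes through [Q] before [P]. *)
Lemma geodesic_chord (X : curve R) s1 s2 : geodesic_curve h X ->
    is_even s1 -> is_even s2 -> curve_ext X s1 = P -> curve_ext X s2 = Q ->
  exists k, [/\ is_even k, body k != 0, gexp ((s2 - s1) * k) = T,
    (forall s, is_even s -> curve_ext X s =
       comb (gexp ((s - s1) * k)) (gexp (- ((s - s1) * k))) E F) &
    forall t : R, sform (velocity X t) (velocity X t) = - (k * k)].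
Proof.
move=> gX H1 H2 E1 E2.
have [k [X0 [Y0 [[Hk k0] [aX aY] [XX YY XY] pX vX]]]] := geodesic_exp_curve gX.
have gX0 := ambient_graded aX; have gY0 := ambient_graded aY.
have CX s : is_even s -> curve_ext X s = comb (gexp (s * k)) (gexp (- (s * k))) X0 Y0.
  by move=> Hs; apply: etrans (curve_ext_unique _ pX) _; exact: exp_curve_ext.
have H1k := evenM H1 Hk; have H2k := evenM H2 Hk.
have P1 := etrans (esym (CX _ H1)) E1; have Q1 := etrans (esym (CX _ H2)) E2.
have Bdiff : (s2 - s1) * k = s2 * k - s1 * k by exact: mulrBl.
have [B|B|B] := ltrgtP 0 (body (s2 * k - s1 * k)).
- have [ET EX EY] := chord_unique HP HQ dPQ H1k H2k gX0 gY0 XX YY XY P1 Q1 B.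
  have k0' : body k != 0 by rewrite gt_eqF.
  have ET' : gexp ((s2 - s1) * k) = T by rewrite Bdiff.
  exists k; apply: (And5 Hk k0' ET' _ vX) => s Hs.
  have L := chord_line_shift Hk H1 Hs EX EY.
  exact (etrans (CX s Hs) L).
(* Reversed orientation: replacing [k] by [- k] and exchanging the two null vectors describes the
   same curve and reduces to the first case. *)
- have N1 : s1 * - k = - (s1 * k) by exact: mulrN.
  have N2 : s2 * - k = - (s2 * k) by exact: mulrN.
  have NN1 : - (s1 * - k) = s1 * k.
    exact: etrans (congr1 -%R N1) (opprK (s1 * k)).
  have NN2 : - (s2 * - k) = s2 * k.
    exact: etrans (congr1 -%R N2) (opprK (s2 * k)).
  have HNk := evenN Hk.
  have YX : sform Y0 X0 = 2 by rewrite -XY; exact: sformC.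
  have P2 : comb (gexp (s1 * - k)) (gexp (- (s1 * - k))) Y0 X0 = P.
    apply: etrans (congr2 (fun u v : superR R => comb (gexp u) (gexp v) Y0 X0) N1 NN1) _.
    exact: etrans (combC _ _ _ _) P1.
  have Q2 : comb (gexp (s2 * - k)) (gexp (- (s2 * - k))) Y0 X0 = Q.
    apply: etrans (congr2 (fun u v : superR R => comb (gexp u) (gexp v) Y0 X0) N2 NN2) _.
    exact: etrans (combC _ _ _ _) Q1.
  have B2 : 0 < body (s2 * - k - s1 * - k).
    have -> : s2 * - k - s1 * - k = - (s2 * k - s1 * k).
      exact: etrans (congr2 (fun u v : superR R => u - v) N2 N1)
        (esym (opprD (s2 * k) (- (s1 * k)))).
    by rewrite {1}bodyN oppr_gt0.
  have [ET EX EY] := chord_unique HP HQ dPQ (evenM H1 HNk) (evenM H2 HNk)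
    gY0 gX0 YY XX YX P2 Q2 B2.
  have k0' : body (- k) != 0 by rewrite bodyN oppr_eq0 gt_eqF.
  have ET' : gexp ((s2 - s1) * - k) = T by rewrite mulrBl.
  exists (- k); apply: (And5 HNk k0' ET') => [s Hs|t].
    apply: etrans (CX _ Hs) _; apply: etrans (combC _ _ _ _) _.
    apply: etrans _ (chord_line_shift HNk H1 Hs EX EY).
    have N : s * - k = - (s * k) by exact: mulrN.
    have NN : - (s * - k) = s * k.
      exact: etrans (congr1 -%R N) (opprK (s * k)).
    exact (congr2 (fun u v : superR R => comb (gexp u) (gexp v) Y0 X0) (esym N) (esym NN)).
  by rewrite vX; apply: congr1; exact: esym (mulrNN k k).
- have HN1 := evenN H1k; have HN2 := evenN H2k.
  have S := sform_comb (even_gexp H1k) (even_gexp HN1) (even_gexp H2k)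
    (even_gexp HN2) gX0 gY0 XX YY XY.
  have S' := etrans (esym (congr2 (@sform R) P1 Q1)) S.
  have B' : body (s1 * k) = body (s2 * k).
    by apply/esym/eqP; rewrite -subr_eq0 -bodyB -B.
  by move: dPQ; rewrite S' {1}(body_gexp_pair B') ltxx.
Qed.

Lemma chord_geodesic k : is_even k -> 0 < body k -> geodesic_curve h (exp_curve k E F).
Proof.
move=> Hk k0; have [_ _ EF] := chord_forms HP HQ dPQ.
exact: (exp_curve_geodesic Hk k0 (chord_lightE HP HQ dPQ) (chord_lightF HP HQ dPQ) EF).
Qed.

Lemma chord_line0 : comb (gexp 0) (gexp (- 0)) E F = P.
Proof.
have E0 : gexp (- 0) = 1 :> superR R by rewrite oppr0; exact: gexp0.
apply: etrans (congr2 (fun u v : superR R => comb u v E F) (gexp0 R) E0) _.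
exact: chord_P HP HQ dPQ.
Qed.

Lemma chord_lineT u : is_even u -> gexp u = T -> comb (gexp u) (gexp (- u)) E F = Q.
Proof.
move=> Hu ET.
have EN : gexp (- u) = Ti.
  apply: etrans (esym (ginv_gexp Hu)) _.
  exact: etrans (congr1 (@ginv R) ET) (chord_ginvT HP HQ dPQ).
apply: etrans (congr2 (fun a b : superR R => comb a b E F) ET EN) _.
exact: chord_Q HP HQ dPQ.
Qed.

End ChordGeodesics.

(** * Real parameters, reparametrization and arc length *)

Section Arcs.
Variables (R : realType).
Implicit Types (a b k s t u v : superR R) (X : curve R).
Local Open Scope classical_set_scope.

Lemma curve_ext_real X (x : R) : curve_ext X x%:A = position X x.
Proof.
have S0 : soul (x%:A : superR R) = 0.
  by rewrite /soul body_alg subrr.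
rewrite /curve_ext /nil_order big_ord_recl big1 => [|i _].
  rewrite addr0 body_alg expr0 invr1 scale1r; exact: sscale1.
by rewrite S0 expr0n /= scaler0; exact: sscale0.
Qed.

Lemma affine_surj k s1 u : is_even k -> body k != 0 -> is_even s1 -> is_even u ->
  exists2 s, is_even s & (s - s1) * k = u.
Proof.
move=> Hk k0 H1 Hu.
exists (u * ginv k + s1); first exact: evenD (evenM Hu (even_ginv Hk)) H1.
apply: etrans (congr1 (fun z : superR R => z * k) (addrK s1 (u * ginv k))) _.
apply: etrans (esym (mulrA u (ginv k) k)) _.
have kV : ginv k * k = 1.
  exact: etrans (even_comm _ (even_ginv Hk)) (ginvM Hk k0).
exact: etrans (congr1 (fun z : superR R => u * z) kV) (mulr1 u).
Qed.

Lemma speed k : is_even k -> 0 < body k -> gsqrt (Defs.gnorm (- (k * k))) = k.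
Proof.
move=> Hk k0.
have kk0 : 0 < body (k * k) by rewrite {1}bodyM mulr_gt0.
have N : Defs.gnorm (- (k * k)) = k * k.
  apply: etrans (gnorm_lt0 _) (opprK (k * k)).
  by rewrite {1}bodyN oppr_lt0.
rewrite N; apply: sqr_inj_body (gsqrt_sqr kk0) => //.
  exact: even_gsqrt (evenM Hk Hk).
by rewrite {1}body_gsqrt sqrtr_gt0.
Qed.

Lemma Rintegral_itv_cst (a b c : R) : a < b ->
  (\int[lebesgue_measure]_(t in `[a, b]) c)%R = (b - a) * c.
Proof.
move=> ab; rewrite Rintegral_cst // mulrC; congr (_ * _).
have := @lebesgue_measure_itv R `[a, b]%R; rewrite /= lte_fin ab => H.
exact: (congr1 fine H).
Qed.

Lemma arc_length X k (a b : R) : is_even k -> 0 < body k -> a < b ->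
    (forall t : R, sform (velocity X t) (velocity X t) = - (k * k)) ->
  forall I : {fset nat},
    (\int[lebesgue_measure]_(t in `[a, b])
      mcoeff I (gsqrt (Defs.gnorm (sform (velocity X t) (velocity X t)))))%R =
    mcoeff I ((b - a) *: k).
Proof.
move=> Hk k0 ab vX I; rewrite mcoeffZ -Rintegral_itv_cst //.
apply: eq_Rintegral => t _.
by apply: congr1; rewrite vX; exact: speed.
Qed.

End Arcs.

(** * Geodesic arcs with real end parameters *)

Section ChordArcs.
Variables (R : realType) (h : dimension) (P Q : superspace R).
Hypotheses (HP : hyperbolic h P) (HQ : hyperbolic h Q).
Hypothesis dPQ : 1 < body (sform P Q).
Implicit Types (a b k s t u v : superR R).
Local Open Scope classical_set_scope.

Notation T := (chord_T P Q).
Notation E := (chord_E P Q).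
Notation F := (chord_F P Q).

Lemma geodesic_arc_chord (X : curve R) (a b : R) : geodesic_arc h P Q X a b ->
  exists k, [/\ is_even k, 0 < body k, gexp ((b - a) *: k) = T,
    (forall s, is_even s -> curve_ext X s =
       comb (gexp ((s - a%:A) * k)) (gexp (- ((s - a%:A) * k))) E F) &
    forall t : R, sform (velocity X t) (velocity X t) = - (k * k)].
Proof.
move=> [gX ab Xa Xb].
have Ea := etrans (curve_ext_real X a) Xa; have Eb := etrans (curve_ext_real X b) Xb.
have [k [Hk k0 ET CX vX]] :=
  geodesic_chord HP HQ dPQ gX (@evenA _ a) (@evenA _ b) Ea Eb.
have Ek : (b%:A - a%:A) * k = (b - a) *: k.
  by rewrite -scalerBl -scalerAl mul1r.
have ET' : gexp ((b - a) *: k) = T by rewrite -Ek.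
(* With [a < b] the orientation is fixed: the body of [T] exceeds 1, so [(b - a) k] has positive
   body. *)
have bk : 0 < body k.
  have := chord_T_gt1 dPQ; rewrite -ET' {1}body_gexp {1}bodyZ expR_gt1 pmulr_rgt0 //.
  by rewrite subr_gt0.
by exists k.
Qed.

(** The logarithm [u] of [T] may have a soul, so it cannot serve as the end of a real interval; it
    is taken as the speed over the unit interval instead. *)
Lemma chord_arc u : is_even u -> gexp u = T ->
  geodesic_arc h P Q (exp_curve u E F) 0 1.
Proof.
move=> Hu ET.
have u0 : 0 < body u.
  by have := chord_T_gt1 dPQ; rewrite -ET {1}body_gexp expR_gt1.
split; [exact: chord_geodesic|exact: ltr01| |].
  apply: etrans (exp_curve_position _ _ _ _) _.
  rewrite 2!{1}scale0r.
  by have := chord_line0 HP HQ dPQ; rewrite {1}oppr0.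
apply: etrans (exp_curve_position _ _ _ _) _.
by rewrite 2!{1}scale1r; exact: (chord_lineT HP HQ dPQ Hu ET).
Qed.

End ChordArcs.

(** * Unique geodesic, distance and segment *)

Section ChordConclusions.
Variables (R : realType) (h : dimension) (P Q : superspace R).
Hypotheses (HP : hyperbolic h P) (HQ : hyperbolic h Q).
Hypothesis dPQ : 1 < body (sform P Q).
Implicit Types (a b k s t u v : superR R).
Local Open Scope classical_set_scope.
Local Open Scope ring_scope.

Notation d := (chord_d P Q).
Notation T := (chord_T P Q).
Notation Ti := (chord_Ti P Q).
Notation E := (chord_E P Q).
Notation F := (chord_F P Q).

Lemma chord_log : exists D : superR R, [/\ is_even D, 0 < body D & gexp D = T].
Proof.
have [D HD ED] := gexp_surj (chord_T_even HP HQ) (chord_T_gt0 dPQ).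
exists D; split=> //.
by have := chord_T_gt1 dPQ; rewrite -ED {1}body_gexp expR_gt1.
Qed.

Lemma chord_curve_ext s : is_even s ->
  curve_ext (exp_curve 1 E F) s = comb (gexp s) (gexp (- s)) E F.
Proof.
move=> Hs; apply: etrans (exp_curve_ext _ _ (@even1 R) Hs) _.
exact: (congr1 (fun z : superR R => comb (gexp z) (gexp (- z)) E F) (mulr1 s)).
Qed.

Lemma chord_comb_gexp s : is_even s ->
  comb (gexp s) (gexp (- s)) E F = comb (gexp s) (ginv (gexp s)) E F.
Proof. by move=> Hs; rewrite {1}ginv_gexp. Qed.

Lemma chord_geodesic_unique : exists! G : set (superspace R),
  [/\ super_geodesic h G, G P & G Q].
Proof.
have [D [HD D0 ED]] := chord_log.
have b1 : 0 < body (1 : superR R) by rewrite {1}body1 ltr01.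
have g1 := chord_geodesic HP HQ dPQ (@even1 R) b1.
exists [set curve_ext (exp_curve 1 E F) s | s in is_even]; split.
  split; first by exists (exp_curve 1 E F).
    exists 0; first exact: even0.
    apply: etrans (chord_curve_ext (@even0 R)) _; exact: (chord_line0 HP HQ dPQ).
  exists D => //; apply: etrans (chord_curve_ext HD) _.
  exact: (chord_lineT HP HQ dPQ HD ED).
move=> G' [[X gX ->] [s1 H1 E1] [s2 H2 E2]].
have [k [Hk k0 ET CX _]] := geodesic_chord HP HQ dPQ gX H1 H2 E1 E2.
(* The two lines differ by the affine change of parameter sending [s] to [(s - s1) k], which maps
   even numbers onto even numbers because [k] is invertible. *)
apply/seteqP; split=> Z [s Hs <-].
  have [s' Hs' Es'] := affine_surj Hk k0 H1 Hs.
  exists s' => //; apply: etrans (CX s' Hs') _; rewrite Es'.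
  exact: esym (chord_curve_ext Hs).
exists ((s - s1) * k); first exact: evenM (evenB Hs H1) Hk.
apply: etrans (chord_curve_ext (evenM (evenB Hs H1) Hk)) _.
exact: esym (CX s Hs).
Qed.

Lemma chord_distance : exists D : superR R,
  [/\ unique (is_distance h P Q) D, gcosh D = d & gexp D = T].
Proof.
have [D [HD D0 ED]] := chord_log.
exists D; split=> //; last first.
  rewrite {1}gcoshE.
  have EN : gexp (- D) = Ti.
    apply: etrans (esym (ginv_gexp HD)) _.
    exact: etrans (congr1 (@ginv R) ED) (chord_ginvT HP HQ dPQ).
  rewrite EN ED (chord_TDTi HP HQ dPQ) mulr_natl mulr2n.
  exact: scale_half_double.
split.
  exists (exp_curve D E F), 0, 1; split; first exact: (chord_arc HP HQ dPQ HD ED).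
  move=> I; rewrite (arc_length HD D0 ltr01) ?subr0 ?scale1r // => t.
  have [EE FF EF] := chord_forms HP HQ dPQ.
  exact: (exp_curve_velocity_sform _ HD (chord_gE HP HQ) (chord_gF HP HQ) EE FF EF).
move=> D' [X [a [b [aX LX]]]].
have [k [Hk k0 ET _ vX]] := geodesic_arc_chord HP HQ dPQ aX.
have [_ ab _ _] := aX.
(* Every arc has constant speed [k], and its length has exponential [T]; injectivity of the
   exponential then makes the length independent of the arc. *)
have ED' : D' = (b - a) *: k.
  by apply/malgP => I; rewrite LX; exact: arc_length.
rewrite ED'; apply: (gexp_inj HD (@evenZ _ _ _ Hk)).
exact: etrans ED (esym ET).
Qed.

Lemma chord_segment (S : set (superspace R)) : super_segment h P Q S <->
  S = [set comb t (ginv t) E F | t in [set t | is_even t /\ 1 <= body t <= body T]].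
Proof.
pose seg (X : curve R) (a b : R) :=
  [set curve_ext X s | s in [set s | is_even s /\ a <= body s <= b]].
have segE X (a b : R) : geodesic_arc h P Q X a b -> seg X a b =
    [set comb t (ginv t) E F | t in [set t | is_even t /\ 1 <= body t <= body T]].
  move=> aX; have [k [Hk k0 ET CX _]] := geodesic_arc_chord HP HQ dPQ aX.
  (* Bounds concern bodies only, where the change of parameter is an increasing real function taking
     [a] and [b] to 1 and the body of [T]. *)
  have bE (s : superR R) : (1 <= body (gexp ((s - a%:A) * k)) <= body T) = (a <= body s <= b).
    have -> : body T = expR ((b - a) * body k).
      by rewrite -ET {1}body_gexp {1}bodyZ.
    have -> : body (gexp ((s - a%:A) * k)) = expR ((body s - a) * body k).
      by rewrite {1}body_gexp {1}bodyM {1}bodyB {1}body_alg.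
    rewrite -{1}expR0 2!ler_expR pmulr_lge0 // subr_ge0.
    by rewrite ler_pM2r // lerD2r.
  have Hsa s : is_even s -> is_even ((s - a%:A) * k).
    by move=> Hs; apply: evenM Hk; exact: evenB Hs (@evenA _ a).
  apply/seteqP; split=> Z [].
    move=> s [Hs sab] <-; exists (gexp ((s - a%:A) * k)).
      by split; [exact: even_gexp (Hsa s Hs) | rewrite bE].
    apply: etrans (esym (chord_comb_gexp (Hsa s Hs))) _.
    exact: esym (CX s Hs).
  move=> t [Ht t1] <-.
  have t0 : 0 < body t by apply: lt_le_trans ltr01 _; case/andP: t1.
  (* Conversely, an even [t] in the range has positive body, hence a logarithm, soul included, which
     is then carried back to a parameter of the arc. *)
  have [u Hu Eu] := gexp_surj Ht t0.
  have k0' : body k != 0 by rewrite gt_eqF.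
  have [s Hs Es] := affine_surj Hk k0' (@evenA _ a) Hu.
  exists s; first by split=> //; rewrite -bE Es Eu.
  apply: etrans (CX s Hs) _; rewrite Es -Eu; exact: chord_comb_gexp.
split=> [[X [a [b [aX ->]]]]|->]; first exact: segE aX.
have [D [HD D0 ED]] := chord_log.
have aD := chord_arc HP HQ dPQ HD ED.
exists (exp_curve D E F), 0, 1; split=> //; exact: esym (segE _ _ _ aD).
Qed.

Lemma chord_unit_speed : unit_speed (exp_curve 1 E F).
Proof.
move=> t; have [EE FF EF] := chord_forms HP HQ dPQ.
rewrite (exp_curve_velocity_sform t (@even1 R) (chord_gE HP HQ) (chord_gF HP HQ) EE FF EF).
rewrite mulr1; apply: etrans (gnorm_lt0 _) (opprK 1).
by rewrite {1}bodyN {1}body1 oppr_lt0 ltr01.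
Qed.

End ChordConclusions.

(** * Assembly of the theorem *)

Local Open Scope classical_set_scope.
Local Open Scope ring_scope.

Theorem theorem3p1 (R : realType) (h : dimension) (P Q : superspace R)
    (HP : hyperbolic h P) (HQ : hyperbolic h Q) (dPQ : 1 < body (sform P Q)) :
  let d : superR R := sform P Q in
  let l : superR R := gsqrt ((d + 1) * ginv (d - 1)) in
  let T : superR R := (l + 1) * ginv (l - 1) in
  let M : superR R := (l - 1) * ginv (2 * l) in
  let N : superR R := (l + 1) * ginv (2 * l) in
  let E := sscale M (sscale (1 - l) P + sscale (1 + l) Q) in
  let F := sscale N (sscale (1 + l) P + sscale (1 - l) Q) in
  let X (t : superR R) :=
    sscale (2^-1)%:A (sscale t E + sscale (ginv t) F) in
  [/\ exists! G : set (superspace R), [/\ super_geodesic h G, G P & G Q],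
      exists D : superR R,
        [/\ unique (is_distance h P Q) D, gcosh D = d & gexp D = T],
      X 1 = P /\ X T = Q,
      forall S : set (superspace R), super_segment h P Q S <->
        S = [set X t | t in [set t | is_even t /\ 1 <= body t <= body T]] &
      [/\ exists Y : curve R,
            [/\ geodesic_curve h Y, unit_speed Y &
                forall s : superR R, is_even s -> curve_ext Y s = X (gexp s)],
          light_cone h E, light_cone h F & sform E F = 2]].
Proof.
split.
- exact: chord_geodesic_unique HP HQ dPQ.
- exact: chord_distance HP HQ dPQ.
(* The second coefficient of [X t] is [ginv t], so the end points require the inverses of 1 and of
   [T]. *)
- split.
    apply: etrans (congr1 (fun z => comb 1 z _ _) _) (chord_P HP HQ dPQ).
    by apply: ginv_unique (@even1 R) _ (mulr1 1); rewrite body1 oner_neq0.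
  apply: etrans (congr1 (fun z => comb _ z _ _) _) (chord_Q HP HQ dPQ).
  exact: chord_ginvT HP HQ dPQ.
- exact: chord_segment HP HQ dPQ.
- have b1 : 0 < body (1 : superR R) by rewrite body1 ltr01.
  have [_ _ EF] := chord_forms HP HQ dPQ.
  split=> //; [|exact: chord_lightE HP HQ dPQ|exact: chord_lightF HP HQ dPQ].
  exists (exp_curve 1 (chord_E P Q) (chord_F P Q)); split.
  + exact: (chord_geodesic HP HQ dPQ (@even1 R) b1).
  + exact: chord_unit_speed HP HQ dPQ.
  + move=> s Hs; exact: etrans (chord_curve_ext _ _ Hs) (chord_comb_gexp _ _ Hs).
Qed.
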